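(* Let $n\geq 3$, let $d>0$ be an integer and let $m_1,\ldots,m_n$ be integers such that (i) $d\geq m_1\geq m_2\geq\cdots\geq m_n\geq 0$; (ii) $d-(m_1+m_2+m_3)\geq 0$; (iii) $d^2=\sum_{i=1}^n m_i^2$. Let $N=\#\{j \mid m_j\geq 2\}$ and suppose that $N\leq 8$. Then for every integer $k\geq 1$ the linear system $\mathcal{L}_{kd}(km_1,\ldots,km_n)$ is empty, unless one of the following holds: (a) $\mathcal{L}_d(m_1,\ldots,m_n)$ is a multiple of $\mathcal{L}_1(1)$; (b) $\mathcal{L}_d(m_1,\ldots,m_n)$ is a multiple of $\mathcal{L}_3(1^9)$.
   Context: We work over the complex numbers. For integers $d>0$ and $m_1,\ldots,m_n\geq 0$, $\mathcal{L}_d(m_1,\ldots,m_n)$ denotes the linear system of plane curves of degree $d$ in $\mathbb{P}^2$ having multiplicity at least $m_i$ at $p_i$ for $i=1,\ldots,n$, where $p_1,\ldots,p_n\in\mathbb{P}^2$ are general points (equivalently, the corresponding complete linear system on the blow-up $X_n$ of $\mathbb{P}^2$ at $p_1,\ldots,p_n$). The system is empty if, for $(p_1,\ldots,p_n)$ in a nonempty Zariski open subset of $(\mathbb{P}^2)^n$ (which may depend on $d,m_1,\ldots,m_n$), there is no nonzero homogeneous form of degree $d$ vanishing to order at least $m_i$ at $p_i$ for all $i$. Exponents denote repeated multiplicities: e.g. $\mathcal{L}_3(1^9)=\mathcal{L}_3(1,1,1,1,1,1,1,1,1)$. Multiplicities equal to $0$ may be added or omitted without changing the system. For a positive integer $c$,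 the multiple by $c$ of $\mathcal{L}_d(m_1,\ldots,m_n)$ is $\mathcal{L}_{cd}(cm_1,\ldots,cm_n)$. Thus the multiples of $\mathcal{L}_1(1)$ are the systems $\mathcal{L}_c(c)$ and those of $\mathcal{L}_3(1^9)$ are the systems $\mathcal{L}_{3c}(c^9)$, with $c\geq 1$. *)

(* Defs.v *)
From HB Require Import structures.
From mathcomp Require Import all_boot all_order all_algebra.
From mathcomp Require Import complex reals mpoly.

Set Implicit Arguments.
Unset Strict Implicit.
Unset Printing Implicit Defensive.

Import Order.TTheory GRing.Theory Num.Theory.
Local Open Scope ring_scope.

Section PlaneSystems.
Variable R : realType.
Local Notation C := R[i].

(* A point of (P^2)^n is given by homogeneous coordinates: an n x 3 matrix all
   of whose rows are nonzero, row i representing p_i. Every condition imposed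
   on such a matrix below is invariant under rescaling each row. *)
Definition configuration n (P : 'M[C]_(n, 3)) : Prop :=
  forall i, row i P != 0.

(* G in the coordinates of n points; the j-th coordinate of the i-th point is
   the variable of index mxvec_index i j. *)
Definition multihomogeneous n (G : {mpoly C[n * 3]}) : Prop :=
  exists e : 'I_n -> nat, forall a, a \in msupp G ->
    forall i, (\sum_(j < 3) a (mxvec_index i j))%N = e i.

Definition zariski_closed n (Z : 'M[C]_(n, 3) -> Prop) : Prop :=
  exists S : {mpoly C[n * 3]} -> Prop,
    (forall G, S G -> multihomogeneous G) /\
    forall P, configuration P ->
      (Z P <-> forall G, S G -> G.@[fun k => mxvec P 0 k] = 0).

Definition zariski_open n (U : 'M[C]_(n, 3) -> Prop) : Prop :=
  zariski_closed (fun P => ~ U P).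

Definition general_config n (A : 'M[C]_(n, 3) -> Prop) : Prop :=
  exists U : 'M[C]_(n, 3) -> Prop,
    [/\ zariski_open U,
        exists P, configuration P /\ U P
      & forall P, configuration P -> U P -> A P].

(* All partial derivatives of order < s vanish at v. For F homogeneous and
   v != 0, the order of vanishing of F at v in C^3 is the multiplicity at [v]
   of the plane curve F = 0. *)
Definition vanishes_to_order (s : nat) (F : {mpoly C[3]}) (v : 'rV[C]_3) : Prop :=
  forall a : 'X_{1..3}, (mdeg a < s)%N -> (mderivm a F).@[fun j => v 0 j] = 0.

(* The forms defining the members of L_d(m) based at the points P, with 0. *)
Definition linear_system (d n : nat) (m : n.-tuple nat) (P : 'M[C]_(n, 3))
    (F : {mpoly C[3]}) : Prop :=
  F \is d.-homog /\
  forall i : 'I_n, vanishes_to_order (tnth m i) F (row i P).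

Definition system_empty (d n : nat) (m : n.-tuple nat) : Prop :=
  general_config (fun P => forall F, linear_system d m P F -> F = 0).

End PlaneSystems.

Arguments system_empty R d [n] m.

Definition scale_mult (c n : nat) (m : n.-tuple nat) : n.-tuple nat :=
  [tuple (c * tnth m i)%N | i < n].

(* Same degree and same multiplicities in the same order, multiplicities equal
   to 0 being disregarded. *)
Definition same_system (d n : nat) (m : n.-tuple nat)
    (d' n' : nat) (m' : n'.-tuple nat) : Prop :=
  d = d' /\ [seq x <- m | x != 0%N] = [seq x <- m' | x != 0%N].

Definition is_multiple_of (d n : nat) (m : n.-tuple nat)
    (d0 n0 : nat) (m0 : n0.-tuple nat) : Prop :=
  exists c : nat, (0 < c)%N /\ same_system d m (c * d0)%N (scale_mult c m0).

(* Main.v *)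
Require Import Defs.
From HB Require Import structures.
From mathcomp Require Import all_boot all_order all_algebra.
From mathcomp Require Import complex reals mpoly.
From mathcomp Require Import ring zify boolp fingroup.perm generic_quotient.

(** Only the first eight multiplicities m_1, ..., m_8 can exceed 1; let M be the number
    of the remaining points of multiplicity 1. If M = 0 the numerical hypotheses leave
    only the multiples of L_1(1); if M > 0 and d <= 3 they leave only L_3(1^9). Suppose
    M > 0 and d > 3, and fix k.

    Emptiness is an open condition on the points, given by the minors of the matrix of
    vanishing conditions. If all these minors vanish along a line P + t V of
    configurations, a kernel vector over C[t], nonzero at t = 0, yields a family of
    forms F_0 + t F_1 + ... with F_0 <> 0. So it suffices to find one configuration P
    and one direction V such that the conditions at orders 0 and 1 in t force F_0 = 0
    ([system_empty_by_deformation]).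

    The configuration is carried by a curve. Fix a triangle T of lines and eight smooth
    points of T. The class (d; m_1, ..., m_8) is the class of T plus a
    sum of classes of nine kinds: lines, lines through the first or the second point,
    and cubics through the first r points (3 <= r <= 8); the Cremona condition
    d >= m_1 + m_2 + m_3 makes the coefficients nonnegative. Let f = 0 be the union of T
    and of distinct curves of these kinds. On each component A put as many general
    points as the class (d; m_1, ..., m_8) has degree on A; since
    d^2 = sum m_i^2, this makes M points, and f has degree d, multiplicity at least m_i
    at the eight points, and vanishes simply at the M others.

    The system L_kd(k m) based at these points has the single member f^k
    ([special_member]). Indeed a member g restricts on each side of T to a constant
    times a fixed polynomial, its zeros being prescribed; the three constants must agree
    at the vertices, and, as in Carnot's theorem, this forces them to vanish as soon as
    one of the points on T is general. So g vanishes on T, hence on one point too many of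
    every other component, hence on that component by Bezout. Therefore f divides g, and
    one concludes by induction on k.

    To first order, let the M points p_b move vertically with velocities v_b. If
    F_0 = c f^k with c <> 0, the same argument applied to F_1 shows that F_1 is
    divisible by f^(k-1), with a quotient G of degree d, of multiplicity at least m_i at
    the eight points, whose values at the p_b are proportional to v_b times the
    y-derivative of f at p_b ([first_order_values]). But the forms of class
    (d; m_1, ..., m_8) make a space of dimension at most M ([dim_class]), in which f is
    a nonzero element vanishing at the M points; so some values at the p_b are not
    attained, and velocities v_b chosen accordingly force c = 0 ([rigid_direction]).

    Plane curves are treated as polynomials in y over C[x], in the chart z = 1, and
    intersections are counted by their abscissae. *)

Set Implicit Arguments.
Unset Strict Implicit.
Unset Printing Implicit Defensive.
Import Order.TTheory GRing.Theory Num.Theory.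
Local Open Scope ring_scope.

(** * Roots of polynomials in one variable *)

Section Univariate.
Variable C : numClosedFieldType.
Implicit Types (p : {poly C}) (x : C).

(** In characteristic zero, differentiation lowers the order of a root by exactly one. *)
Lemma dvdp_exp_Xsub_deriv x s p :
  p.[x] = 0 -> ('X - x%:P) ^+ s %| p^`() -> ('X - x%:P) ^+ s.+1 %| p.
Proof.
have [-> _ _|nz px] := eqVneq p 0; first by rewrite dvdp0.
case: (multiplicity_XsubC p x) => [[|j] [u ru ep]]; rewrite nz /= in ru.
  by move: px ru; rewrite ep mulr1 /root => ->; rewrite eqxx.
have du : p^`() = (u^`() * ('X - x%:P) + u *+ j.+1) * ('X - x%:P) ^+ j.
  by rewrite ep derivM deriv_exp derivXsubC mul1r /= mulrDl -mulrA -exprS mulrnAr mulrnAl.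
have cop : coprimep (('X - x%:P) ^+ s) (u^`() * ('X - x%:P) + u *+ j.+1).
  apply: coprimep_expl; rewrite coprimep_sym coprimep_XsubC /root hornerD hornerM hornerXsubC.
  by rewrite subrr mulr0 add0r hornerMn -mulr_natr mulf_eq0 pnatr_eq0 orbF.
rewrite du Gauss_dvdpr // dvdp_Pexp2l ?size_XsubC // => le_sj.
by rewrite ep dvdp_mull // dvdp_exp2l.
Qed.

Lemma dvdp_prod_exp_Xsub (T : eqType) (s : seq T) (x : T -> C) (n : T -> nat) p :
  uniq [seq x i | i <- s] ->
  (forall i, i \in s -> ('X - (x i)%:P) ^+ n i %| p) ->
  \prod_(i <- s) ('X - (x i)%:P) ^+ n i %| p.
Proof.
elim: s => [|i s IH] /=; first by rewrite big_nil dvd1p.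
case/andP=> xi us H; rewrite big_cons Gauss_dvdp; last first.
  rewrite coprimep_sym; apply/coprimep_expr; rewrite coprimep_XsubC.
  rewrite /root horner_prod prodf_seq_eq0 -all_predC; apply/allP=> j js /=.
  rewrite !hornerE expf_eq0 negb_and subr_eq0; apply/orP; right.
  by apply: contraNneq xi => ->; apply/map_f.
rewrite H ?mem_head // IH // => j js; apply: H; by rewrite in_cons js orbT.
Qed.

Lemma size_prod_exp_Xsub (T : eqType) (s : seq T) (x : T -> C) (n : T -> nat) :
  size (\prod_(i <- s) ('X - (x i)%:P) ^+ n i) = (\sum_(i <- s) n i).+1.
Proof.
elim: s => [|i s IH]; first by rewrite !big_nil size_poly1.
rewrite !big_cons size_proper_mul ?IH ?size_exp_XsubC ?addnS //.
rewrite (monicP _) ?monic_exp ?monicXsubC // mul1r (monicP _) ?oner_eq0 //.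
by apply: monic_prod => j _; rewrite monic_exp // monicXsubC.
Qed.

(** A field of characteristic zero is infinite. *)
Lemma avoid_seq (bad : seq C) : exists x, x \notin bad.
Proof.
pose s := [seq i%:R : C | i <- iota 0 (size bad).+1].
have us : uniq s by rewrite map_inj_uniq ?iota_uniq // => i j /eqP; rewrite eqr_nat => /eqP.
have [/hasP[x xs xb]|] := boolP (has (fun x => x \notin bad) s); first by exists x.
rewrite -all_predC => /allP sub.
have := uniq_leq_size us (fun x xs => negbNE (sub x xs)).
by rewrite size_map size_iota ltnn.
Qed.

Lemma poly_roots_seq p : p != 0 -> exists s : seq C, forall x, root p x -> x \in s.
Proof.
move=> nz; have [r def_p] := closed_field_poly_normal p; exists r => x.
by rewrite def_p rootZ ?lead_coef_eq0 // root_prod_XsubC.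
Qed.

End Univariate.

(** * Degrees of bivariate polynomials and of their resultants *)

Section Bivariate.
Variable C : numClosedFieldType.
Implicit Types (f g h : {poly {poly C}}) (Y : {poly C}) (D e : nat).

(** Total degree at most [D], read on the coefficients of the powers of y. *)
Definition tdeg D f := forall i, (size (f`_i)%R <= D.+1 - i)%N.

Lemma tdeg0 D : tdeg D 0.
Proof. by move=> i; rewrite coef0 size_poly0. Qed.

Lemma tdegD D f g : tdeg D f -> tdeg D g -> tdeg D (f + g).
Proof.
move=> Hf Hg i; rewrite coefD; apply: leq_trans (size_polyD _ _) _.
by rewrite geq_max Hf Hg.
Qed.

Lemma tdegN D f : tdeg D f -> tdeg D (- f).
Proof. by move=> Hf i; rewrite coefN size_polyN. Qed.

Lemma tdegB D f g : tdeg D f -> tdeg D g -> tdeg D (f - g).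
Proof. by move=> Hf Hg; apply/tdegD/tdegN. Qed.

Lemma tdegM D e f g : tdeg D f -> tdeg e g -> tdeg (D + e)%N (f * g).
Proof.
move=> Hf Hg i; rewrite coefM; apply: leq_trans (size_sum _ _ _) _.
apply/bigmax_leqP => -[j /= ltji] _.
have [->|fn0] := eqVneq f`_j 0; first by rewrite mul0r size_poly0.
have [->|gn0] := eqVneq g`_(i - j) 0; first by rewrite mulr0 size_poly0.
rewrite size_mul //; have := Hf j; have := Hg (i - j)%N.
move: fn0 gn0; rewrite -!size_poly_gt0.
move: (size (f`_j)%R) (size (g`_(i - j))%R) => a b; lia.
Qed.

Lemma tdegC (c : C) : tdeg 0%N c%:P%:P.
Proof.
case=> [|i]; rewrite coefC /= ?size_poly0 //; exact: size_polyC_leq1.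
Qed.

Lemma tdegCM D c f : tdeg D f -> tdeg D (c%:P%:P * f).
Proof. by rewrite -[D]add0n; apply: tdegM; apply: tdegC. Qed.

Lemma tdeg_prod (I : Type) (s : seq I) (e : I -> nat) (f : I -> {poly {poly C}}) :
  (forall i, tdeg (e i) (f i)) -> tdeg (\sum_(i <- s) e i)%N (\prod_(i <- s) f i).
Proof.
move=> H; elim: s => [|i s IH]; first by rewrite !big_nil; apply: tdegC.
by rewrite !big_cons; apply: tdegM.
Qed.

Lemma tdeg0P f : tdeg 0%N f -> exists c, f = c%:P%:P.
Proof.
move=> Hf; exists f`_0`_0; apply/polyP => -[|i]; rewrite coefC /=.
  by apply: size1_polyC; apply: Hf.
by apply/eqP; rewrite -size_poly_leq0; apply: leq_trans (Hf _) _.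
Qed.

Lemma size_horner_tdeg D f Y :
  tdeg D f -> (size Y <= 2)%N -> (size f.[Y] <= D.+1)%N.
Proof.
move=> Hf HY; rewrite horner_coef; apply: leq_trans (size_sum _ _ _) _.
apply/bigmax_leqP => -[i /= _] _.
have [->|fn0] := eqVneq f`_i 0; first by rewrite mul0r size_poly0.
apply: leq_trans (size_polyMleq _ _) _.
have := size_poly_exp_leq Y i; have := Hf i; move: fn0; rewrite -size_poly_gt0.
have : ((size Y).-1 * i <= i)%N by rewrite -[leqRHS]mul1n leq_mul2r; apply/orP; right; lia.
move: (size (f`_i)%R) (size (Y ^+ i)) => a b; lia.
Qed.

(** Since [g] is monic of full degree, the leading coefficient of [h * g] is that of [h]:
    peel off the leading term of [h] and induct. *)
Lemma tdeg_quotient D e g h : g \is monic -> size g = e.+1 -> tdeg e g ->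
  tdeg (D + e)%N (h * g) -> tdeg D h.
Proof.
move=> mg sg Hg; have [n] := ubnP (size h); elim: n h => // n IH h lt_hn H.
have [->|hn0] := eqVneq h 0; first exact: tdeg0.
set k := (size h).-1; have sh : size h = k.+1 by rewrite -polySpred.
have top : (h * g)`_(k + e) = h`_k.
  have := lead_coefM h g; rewrite (monicP mg) mulr1 /lead_coef size_Mmonic //.
  by rewrite sh sg addnS /= => <-.
have szk : (size (h`_k)%R <= D.+1 - k)%N by rewrite -top; apply: leq_trans (H _) _; lia.
pose a := h`_k *: 'X^k.
have Ha : tdeg D a.
  move=> i; rewrite coefZ coefXn; have [->|_] := eqVneq; first by rewrite mulr1.
  by rewrite mulr0 size_poly0.
have -> : h = a + (h - a) by rewrite addrC subrK.
apply: tdegD => //; apply: IH; last first.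
  by rewrite mulrBl; apply: tdegB => //; apply: tdegM.
apply: leq_trans (_ : k < n)%N; last by rewrite -sh -ltnS.
rewrite ltnS; apply/leq_sizeP => i; rewrite leq_eqVlt coefB coefZ coefXn.
case/predU1P => [<-|lt_ki]; first by rewrite eqxx mulr1 subrr.
by rewrite gtn_eqF // mulr0 subr0 nth_default // sh.
Qed.

(** Rows and columns carry weights that bound the degrees of the entries; in each term
    of the determinant every row and every column contributes its weight once. *)
Lemma size_det_weights n (M : 'M[{poly C}]_n) (r c : 'I_n -> nat) N :
  (forall i j, size (M i j) <= (r i).+1 - c j)%N ->
  (\sum_i r i <= N + \sum_j c j)%N -> (size (\det M) <= N.+1)%N.
Proof.
move=> HM Hs; rewrite /determinant; apply: leq_trans (size_sum _ _ _) _.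
apply/bigmax_leqP => s _.
have size_sign (b : bool) (u : {poly C}) : size ((-1) ^+ b * u) = size u.
  by case: b; rewrite ?expr1 ?expr0 ?mul1r // mulN1r size_polyN.
rewrite size_sign.
have [/existsP[i /eqP Mi]|] := boolP [exists i, M i (s i) == 0].
  by rewrite (bigD1 i) //= Mi mul0r size_poly0.
rewrite negb_exists => /forallP nz.
rewrite size_prod; last by move=> i _; apply: nz.
have : (\sum_i size (M i (s i)) + \sum_j c j <= \sum_i (r i).+1)%N.
  rewrite [X in (_ + X <= _)%N](reindex_inj (@perm_inj _ s)) -big_split /=.
  apply: leq_sum => i _; have := HM i (s i); have := nz i; rewrite -size_poly_gt0.
  by move: (size (M i (s i))) => a; lia.
have -> : (\sum_i (r i).+1 = \sum_i r i + #|'I_n|)%N.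
  by under eq_bigr do rewrite -addn1; rewrite big_split /= sum1_card.
have -> : #|(xpredT : pred (ordinal n))| = #|ordinal n| by apply: eq_card.
move: #|ordinal n| (\sum_i size _)%N Hs => a b; lia.
Qed.

(** In the Sylvester matrix the rows may be given the weights D + k and e + k, and the
    columns their index; what remains of the weights is Bezout's number. *)
Lemma size_resultant D e f g :
  tdeg D f -> tdeg e g -> size g = e.+1 -> (size (resultant f g) <= (e * D).+1)%N.
Proof.
move=> Hf Hg sg.
pose r (i : 'I_((size g).-1 + (size f).-1)) : nat :=
  match split i with inl k => (D + k)%N | inr k => (e + k)%N end.
apply: (@size_det_weights _ _ r (fun j => nat_of_ord j)).
  move=> i j; rewrite Sylvester_mxE /r /=; case: (split i) => k /=.
    case: (leqP k j) => kj; last by rewrite mulr0n size_poly0.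
    apply: leq_trans (Hf _) _; move: (nat_of_ord j) (nat_of_ord k) kj => a b; clear; lia.
  case: (leqP k j) => kj; last by rewrite mulr0n size_poly0.
  apply: leq_trans (Hg _) _; move: (nat_of_ord j) (nat_of_ord k) kj => a b; clear; lia.
rewrite /r !big_split_ord /=.
under eq_bigr do rewrite (unsplitK (inl _)).
under [X in (_ + X)%N]eq_bigr do rewrite (unsplitK (inr _)).
rewrite big_split /= sum_nat_const card_ord sg /=.
by rewrite addnA.
Qed.

(** Irreducibility over the field C(x), since [%|] is divisibility up to a factor in C[x].
    For polynomials monic in y this is irreducibility in C[x, y]. *)
Definition irr g := (1 < size g)%N /\
  forall h, h %| g -> (1 < size h)%N -> size h = size g.

Lemma irr_coprimep g f : irr g -> ~~ (g %| f) -> coprimep f g.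
Proof.
case=> g1 ig; apply: contraR; rewrite coprimep_def => ne1.
have nz : g != 0 by rewrite -size_poly_gt0; apply: ltnW.
have gt1 : (1 < size (gcdp f g))%N.
  by rewrite ltn_neqAle eq_sym ne1 size_poly_gt0 gcdp_eq0 negb_and nz orbT.
have /eqP := ig _ (dvdp_gcdr f g) gt1.
rewrite (dvdp_size_eqp (dvdp_gcdr f g)) => /eqp_dvdl <-.
exact: dvdp_gcdl.
Qed.

Lemma irr_dvdM g f h : irr g -> g %| f * h -> (g %| f) || (g %| h).
Proof.
move=> ig; have [//|/(irr_coprimep ig)] := boolP (g %| f).
by rewrite coprimep_sym => /Gauss_dvdpr ->.
Qed.

End Bivariate.

(** * Multiplicities and contact orders along arcs *)

Section Order.
Variable C : numClosedFieldType.
Implicit Types (f g h : {poly {poly C}}) (Y : {poly C}) (p : C * C).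

Definition ev f p : C := f.[p.2%:P].[p.1].

Lemma horner2E f Y x : f.[Y].[x] = ev f (x, Y.[x]).
Proof.
rewrite /ev /= (horner_coef f Y) (horner_coef f) !horner_sum; apply: eq_bigr => i _.
by rewrite !hornerM !horner_exp hornerC.
Qed.

Lemma ev_arc f Y p : Y.[p.1] = p.2 -> f.[Y].[p.1] = ev f p.
Proof. by rewrite horner2E => ->; case: p. Qed.

Lemma evM f g p : ev (f * g) p = ev f p * ev g p.
Proof. by rewrite /ev !hornerM. Qed.
Lemma evD f g p : ev (f + g) p = ev f p + ev g p.
Proof. by rewrite /ev !hornerD. Qed.
Lemma evN f p : ev (- f) p = - ev f p.
Proof. by rewrite /ev !hornerN. Qed.
Lemma evC c p : ev c%:P%:P p = c.
Proof. by rewrite /ev !hornerC. Qed.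
Lemma ev0 p : ev 0 p = 0.
Proof. by rewrite /ev !horner0. Qed.
Lemma ev1 p : ev 1 p = 1.
Proof. by rewrite -[X in ev X]/(1%:P%:P) evC. Qed.
Lemma ev_sum (I : Type) (s : seq I) (F : I -> {poly {poly C}}) p :
  ev (\sum_(i <- s) F i) p = \sum_(i <- s) ev (F i) p.
Proof. by elim: s => [|i s IH]; rewrite ?big_nil ?ev0 // !big_cons evD IH. Qed.
Lemma ev_prod (I : Type) (s : seq I) (F : I -> {poly {poly C}}) p :
  ev (\prod_(i <- s) F i) p = \prod_(i <- s) ev (F i) p.
Proof. by elim: s => [|i s IH]; rewrite ?big_nil ?ev1 // !big_cons evM IH. Qed.

(** Multiplicity at least [s] at [p], tested on the arcs y = Y(x) through [p]:
    these realise every tangent direction but the vertical one. *)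
Definition van s f p := forall Y, Y.[p.1] = p.2 -> ('X - p.1%:P) ^+ s %| f.[Y].

(** Order of contact at least [s] at [p] with the branch of [g] through [p],
    the branch being replaced by its polynomial approximations of order [s]. *)
Definition onb g s f p := forall Y, Y.[p.1] = p.2 ->
  ('X - p.1%:P) ^+ s %| g.[Y] -> ('X - p.1%:P) ^+ s %| f.[Y].

Lemma van_onb g s f p : van s f p -> onb g s f p.
Proof. by move=> H Y HY _; apply: H. Qed.

Lemma van_zero s p : van s 0 p.
Proof. by move=> Y _; rewrite horner0 dvdp0. Qed.

Lemma van0 f p : van 0%N f p.
Proof. by move=> Y _; rewrite expr0 dvd1p. Qed.

Lemma vanD s f g p : van s f p -> van s g p -> van s (f + g) p.
Proof. by move=> Hf Hg Y HY; rewrite hornerD dvdp_add ?Hf ?Hg. Qed.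

Lemma vanM s t f g p : van s f p -> van t g p -> van (s + t)%N (f * g) p.
Proof. by move=> Hf Hg Y HY; rewrite hornerM exprD dvdp_mul ?Hf ?Hg. Qed.

Lemma van_ev s f p : van s.+1 f p -> ev f p = 0.
Proof.
move=> /(_ p.2%:P); rewrite hornerC => /(_ erefl) H; apply/eqP.
rewrite -[_ == 0]/(root _ _) -dvdp_XsubCl; apply: dvdp_trans H.
by rewrite exprS dvdp_mulr.
Qed.

Lemma ev_van f p : ev f p = 0 -> van 1 f p.
Proof. by move=> H Y HY; rewrite expr1 dvdp_XsubCl /root ev_arc ?H. Qed.

Lemma vanX n f p : ev f p = 0 -> van n (f ^+ n) p.
Proof.
move=> H; elim: n => [|n IH]; first exact: van0.
by rewrite exprS -add1n; apply: vanM IH; apply: ev_van.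
Qed.

Lemma van_prod (I : Type) (s : seq I) (n : I -> nat) (F : I -> {poly {poly C}}) p :
  (forall i, van (n i) (F i) p) -> van (\sum_(i <- s) n i)%N (\prod_(i <- s) F i) p.
Proof.
move=> H; elim: s => [|i s IH]; rewrite ?big_nil; first exact: van0.
by rewrite !big_cons; apply: vanM.
Qed.

Lemma horner_taylor1 f (Y e : {poly C}) :
  exists r, f.[Y + e] = f.[Y] + e * f^`().[Y] + e ^+ 2 * r.
Proof.
elim/poly_ind: f => [|f c [r IH]].
  by exists 0; rewrite deriv0 !horner0 !mulr0 !addr0.
exists (r * (Y + e) + f^`().[Y]).
rewrite derivMXaddC !hornerMXaddC hornerD hornerMX IH; ring.
Qed.

(** Newton iteration along a smooth branch whose tangent is not vertical. *)
Lemma hensel_arc g p n : ev g p = 0 -> ev g^`() p != 0 ->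
  exists2 Y, Y.[p.1] = p.2 & ('X - p.1%:P) ^+ n %| g.[Y].
Proof.
move=> g0 g1; elim: n => [|[|n] IH].
- by exists p.2%:P; rewrite ?hornerC ?expr0 ?dvd1p.
- exists p.2%:P; rewrite ?hornerC //; apply: (ev_van g0); exact: hornerC.
case: IH => Y HY /dvdpP[u def_u].
pose c := - (u.[p.1] / ev g^`() p); pose e := c%:P * ('X - p.1%:P) ^+ n.+1.
have e0 : e.[p.1] = 0 by rewrite !hornerE subrr expr0n mulr0.
exists (Y + e); first by rewrite hornerD e0 addr0.
have [r ->] := horner_taylor1 g Y e.
have -> : g.[Y] + e * g^`().[Y] + e ^+ 2 * r =
  ('X - p.1%:P) ^+ n.+1 * (u + c%:P * g^`().[Y] + c%:P * ('X - p.1%:P) * ('X - p.1%:P) ^+ n * c%:P * r).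
  by rewrite def_u /e !exprS; ring.
rewrite exprSr dvdp_mul // dvdp_XsubCl /root !hornerE ev_arc //= subrr mulr0 !mul0r addr0.
by rewrite /c mulNr divfK // subrr.
Qed.

(** The remainder of T(c) modulo [b] is a polynomial in c with infinitely many roots;
    the induction divides out one of them. *)
Lemma dvdp_specialize (b : {poly C}) (T : {poly {poly C}}) (bad : seq C) :
  (forall c, c \notin bad -> b %| T.[c%:P]) -> forall c, b %| T.[c%:P].
Proof.
have [n] := ubnP (size T); elim: n T bad => // n IH T bad lt_n H c.
have [c1 Hc1] := avoid_seq bad.
have [T0|Tn0] := eqVneq T 0; first by rewrite T0 horner0 dvdp0.
have : root (T - T.[c1%:P]%:P) c1%:P by rewrite /root !hornerE subrr.
case/factor_theorem => Q /eqP; rewrite subr_eq => /eqP defT.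
have evT a : T.[a%:P] = Q.[a%:P] * (a - c1)%:P + T.[c1%:P].
  by rewrite {1}defT !hornerE polyCB.
rewrite evT dvdp_add ?H // dvdp_mulr //; move: c.
have szQ : (size Q < n)%N.
  have [->|Qn0] := eqVneq Q 0; first by rewrite size_poly0; case: (n) lt_n Tn0 => // ; rewrite ltnS size_poly_leq0 => ->.
  have : (size (Q * ('X - c1%:P%:P)%R)%R <= size T)%N.
    have -> : Q * ('X - c1%:P%:P) = T - T.[c1%:P]%:P by rewrite {1}defT addrK.
    apply: leq_trans (size_polyD _ _) _; rewrite size_polyN geq_max leqnn /=.
    by apply: leq_trans (size_polyC_leq1 _) _; rewrite size_poly_gt0.
  by rewrite size_Mmonic ?monicXsubC // size_XsubC addn2 /= => h; apply: leq_trans h _.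
apply: (IH Q (c1 :: bad) szQ) => a; rewrite in_cons negb_or => /andP[na nb].
have : b %| Q.[a%:P] * (a - c1)%:P.
  by rewrite -[_ * _](addrK T.[c1%:P]) -evT dvdp_sub ?H.
by rewrite mulrC mul_polyC dvdpZr // subr_eq0.
Qed.

(** For all but one value of c, the arc Y + c (x - p.1) is transversal to [g], hence
    detects the order of [h] exactly; [dvdp_specialize] then recovers c = 0. *)
Lemma van_div_simple g h s p : ev g p = 0 -> ev g^`() p != 0 ->
  van s.+1 (h * g) p -> van s h p.
Proof.
move=> g0 g1 H Y HY.
pose T := h \Po (Y%:P + ('X - p.1%:P)%:P * 'X).
have TE c : T.[c%:P] = h.[Y + ('X - p.1%:P) * c%:P].
  by rewrite /T horner_comp !hornerE.
have -> : h.[Y] = T.[0%:P] by rewrite TE mulr0 addr0.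
have /dvdpP[u def_u] : 'X - p.1%:P %| g.[Y].
  by rewrite -[_ - _]expr1; apply: (ev_van g0).
apply: (@dvdp_specialize _ _ [:: - (u.[p.1] / ev g^`() p)]) => c.
rewrite inE => nc; rewrite TE; set e := _ * c%:P.
have e0 : e.[p.1] = 0 by rewrite !hornerE subrr mul0r.
have := H (Y + e); rewrite hornerD e0 addr0 => /(_ HY); rewrite hornerM.
have [r ->] := horner_taylor1 g Y e; set w := u + c%:P * g^`().[Y] + ('X - p.1%:P) * c%:P ^+ 2 * r.
have -> : g.[Y] + e * g^`().[Y] + e ^+ 2 * r = ('X - p.1%:P) * w.
  by rewrite def_u /e /w; ring.
have cop : coprimep (('X - p.1%:P) ^+ s) w.
  apply/coprimep_expl; rewrite coprimep_sym coprimep_XsubC /root /w.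
  rewrite !(hornerXsubC, hornerD, hornerM, hornerC) subrr !mul0r addr0 ev_arc //.
  apply: contra nc; rewrite addrC addr_eq0 => /eqP def_c.
  by rewrite -mulNr -def_c mulfK.
rewrite exprS [h.[_] * _]mulrCA dvdp_mul2l ?polyXsubC_eq0 //.
by rewrite Gauss_dvdpl.
Qed.

Lemma van_div_unit g h s p : ev g p != 0 -> van s (h * g) p -> van s h p.
Proof.
move=> g0 H Y HY; have := H Y HY; rewrite hornerM Gauss_dvdpl //.
by apply/coprimep_expl; rewrite coprimep_sym coprimep_XsubC /root ev_arc.
Qed.

End Order.

(** * Bezout's theorem for curves monic in y *)

Section Bezout.
Variable C : numClosedFieldType.
Implicit Types (f g h : {poly {poly C}}) (Y : {poly C}) (p : C * C).

(** Being monic in y of full degree, such a curve is finite over the x-line, without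
    intersections at infinity in the vertical direction; this is why intersections with it
    can be counted by their abscissae. *)
Definition plane_curve e g := [/\ g \is monic, size g = e.+1, tdeg e g & irr g].

(** A smooth point with a tangent that is not vertical. *)
Definition smooth_at g p := (ev g p == 0) && (ev g^`() p != 0).

Lemma plane_curve_gt0 e g : plane_curve e g -> (0 < e)%N.
Proof. by case=> _ sg _ [g1 _]; rewrite sg in g1. Qed.

(** The eliminant is the resultant in y, except when [f] does not involve y. *)
Lemma eliminant e g D f : plane_curve e g -> tdeg D f -> ~~ (g %| f) ->
  exists r : {poly C}, exists u v,
    [/\ r != 0, (size r <= (e * D).+1)%N & r%:P = u * f + v * g].
Proof.
move=> cg Hf ndv; have e0 := plane_curve_gt0 cg; case: cg => mg sg Hg ig.
have f0 : f != 0 by apply: contraNneq ndv => ->; rewrite dvdp0.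
have [f1|f1] := leqP (size f) 1.
  have def_f := size1_polyC f1; exists f`_0, 1, 0; split.
  - by apply: contraNneq f0 => c0; rewrite def_f c0.
  - by apply: leq_trans (Hf _) _; rewrite subn0 ltnS leq_pmull.
  - by rewrite mul1r mul0r addr0 -def_f.
have g1 : (1 < size g)%N by case: ig.
have [[u v] _ def_r] := resultant_in_ideal f1 g1.
exists (resultant f g), u, v; split=> //; last exact: size_resultant.
rewrite resultant_eq0 -leqNgt.
by have := irr_coprimep ig ndv; rewrite coprimep_def => /eqP ->.
Qed.

(** An eliminant of [f] and [g] vanishes at each abscissa to the order of contact of [f]
    with the branch of [g], while its degree is at most e D. *)
Lemma bezout e g D f (T : eqType) (s : seq T) (pt : T -> C * C) (n : T -> nat) :
    plane_curve e g -> tdeg D f -> uniq [seq (pt i).1 | i <- s] ->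
    (forall i, i \in s -> smooth_at g (pt i) /\ onb g (n i) f (pt i)) ->
    (e * D < \sum_(i <- s) n i)%N ->
  g %| f.
Proof.
move=> cg Hf us Hp Hn; apply: contraLR Hn => ndv.
have [r [u [v [r0 sr def_r]]]] := eliminant cg Hf ndv.
rewrite -leqNgt -ltnS; apply: leq_trans sr.
rewrite -(size_prod_exp_Xsub s (fun i => (pt i).1)); apply: dvdp_leq r0 _.
apply: dvdp_prod_exp_Xsub => // i iin; have [/andP[/eqP p0 p1] onp] := Hp i iin.
have [Y HY dvY] := hensel_arc (n i) p0 p1.
have -> : r = u.[Y] * f.[Y] + v.[Y] * g.[Y].
  by rewrite -!hornerM -hornerD -def_r hornerC.
by rewrite dvdp_add // dvdp_mull // onp.
Qed.

Lemma plane_curve_ndvd_deriv e g : plane_curve e g -> ~~ (g %| g^`()).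
Proof.
move=> cg; have := plane_curve_gt0 cg; case: cg => mg sg _ _ e0.
have g'0 : g^`() != 0.
  apply/eqP => /(congr1 (fun h => h`_e.-1)); rewrite coef_deriv coef0 prednK //.
  have -> : g`_e = 1 by have := monicP mg; rewrite /lead_coef sg.
  by move/eqP; rewrite -polyC1 -polyCMn polyC_eq0 pnatr_eq0 gtn_eqF.
by apply: contraL (lt_size_deriv (monic_neq0 mg)) => /(dvdp_leq g'0); rewrite -leqNgt.
Qed.

Lemma tdeg_exists f : exists D, tdeg D f.
Proof.
exists (size f + \max_(i < size f) size (f`_i)%R)%N => i.
have [le|lt] := leqP (size f) i; first by rewrite nth_default ?size_poly0.
have := @leq_bigmax _ (fun i : 'I_(size f) => size (f`_i)%R) (Ordinal lt) => /= le.
suff aux a b : (i < a -> b <= (a + b).+1 - i)%N by apply: leq_trans le _; apply: aux.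
by clear; lia.
Qed.

(** Away from the roots of an eliminant of [g] and the product of [g^`()] and the [hs],
    every vertical line meets the curve at points that qualify. *)
Lemma plane_curve_point e g (hs : seq {poly {poly C}}) (bad : seq C) :
    plane_curve e g -> (forall h, h \in hs -> ~~ (g %| h)) ->
  exists p, [/\ p.1 \notin bad, smooth_at g p & forall h, h \in hs -> ev h p != 0].
Proof.
move=> cg Hh; have [mg sg Hg ig] := cg.
pose H : {poly {poly C}} := \prod_(h <- g^`() :: hs) h.
have ndv : ~~ (g %| H).
  have: forall h, h \in g^`() :: hs -> ~~ (g %| h).
    by move=> h; rewrite in_cons => /predU1P[->|/Hh //]; apply: plane_curve_ndvd_deriv cg.
  rewrite /H; elim: (_ :: hs) => [|h s IH] Hs.
    rewrite big_nil dvdp1 sg; apply/negP => /eqP[e0].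
    by have := plane_curve_gt0 cg; rewrite e0.
  rewrite big_cons; apply/negP => /(irr_dvdM ig)/orP[]; apply/negP; first exact/Hs/mem_head.
  by apply: IH => h' hin; apply: Hs; rewrite in_cons hin orbT.
have [D HD] := tdeg_exists H.
have [r [u [v [r0 _ def_r]]]] := eliminant cg HD ndv.
have [rs Hrs] := poly_roots_seq r0.
have [x] := avoid_seq (bad ++ rs); rewrite mem_cat negb_or => /andP[xb xr].
have rx : r.[x] != 0 by apply: contra xr => ?; apply: Hrs.
have /closed_rootP[y] : size (map_poly (horner_eval x) g) != 1%N.
  rewrite size_map_poly_id0 /horner_eval ?(monicP mg) ?hornerC ?oner_eq0 // sg eqSS.
  by rewrite -lt0n (plane_curve_gt0 cg).
move=> /rootP ry; have gp : ev g (x, y) = 0.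
  have := horner_map (horner_eval x) g y%:P; rewrite /= /horner_eval hornerC.
  by rewrite /ev /= => <-.
have Hp : ev H (x, y) != 0.
  apply: contraNneq rx => H0; have := congr1 (fun f => ev f (x, y)) def_r.
  by rewrite evD !evM gp H0 !mulr0 addr0 /ev /= hornerC => ->.
have Hall h : h \in g^`() :: hs -> ev h (x, y) != 0.
  by move=> hin; apply: contraNneq Hp => h0; rewrite ev_prod (big_rem h) //= h0 mul0r.
exists (x, y); split=> //; first by rewrite /smooth_at gp eqxx /= Hall ?mem_head.
by move=> h hin; apply: Hall; rewrite in_cons hin orbT.
Qed.

Lemma plane_curve_points e g (hs : seq {poly {poly C}}) (bad : seq C) K :
    plane_curve e g -> (forall h, h \in hs -> ~~ (g %| h)) ->
  exists pts : seq (C * C), [/\ size pts = K, uniq [seq p.1 | p <- pts] &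
    forall p, p \in pts ->
      [/\ p.1 \notin bad, smooth_at g p & forall h, h \in hs -> ev h p != 0]].
Proof.
move=> cg Hh; elim: K => [|K [s [ss us Hs]]]; first by exists [::].
have [p [pb ps ph]] := plane_curve_point (bad ++ [seq p.1 | p <- s]) cg Hh.
move: pb; rewrite mem_cat negb_or => /andP[pb pns].
exists (p :: s); split=> /=; rewrite ?ss ?pns //.
by move=> p'; rewrite in_cons => /predU1P[->|/Hs].
Qed.

Lemma dvdp_plane_curveP e g f : plane_curve e g ->
  reflect (exists h, f = h * g) (g %| f).
Proof. by case=> mg _ _ _; apply: (iffP (Pdiv.IdomainMonic.dvdpP mg f)). Qed.

Lemma plane_curve_dvd_eq e e' g g' :
  plane_curve e g -> plane_curve e' g' -> g %| g' -> g = g'.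
Proof.
move=> cg cg' dv; have [mg sg _ [g1 _]] := cg; have [mg' sg' _ ig'] := cg'.
have ss := ig'.2 _ dv g1; case/(dvdp_plane_curveP _ cg): dv => h def_g'.
have h1 : size h = 1%N.
  have h0 : h != 0 by apply: contraTneq mg' => h0; rewrite def_g' h0 mul0r monicE lead_coef0 eq_sym oner_eq0.
  move: ss; rewrite def_g' size_Mmonic // sg addnS /= => /eqP.
  by rewrite -[X in X == _]add1n eqn_add2r eq_sym => /eqP.
have := lead_coefM h g; rewrite -def_g' (monicP mg) (monicP mg') mulr1 => lh.
by rewrite def_g' (size1_polyC (eq_leq h1)) -[h`_0]/(h`_(1.-1)) -h1 -/(lead_coef h) -lh mul1r.
Qed.

End Bezout.

(** * Restriction to a component and dimension bounds *)

Section Components.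
Variable C : numClosedFieldType.
Variable q : nat -> C * C.
Hypothesis q_inj : forall i j, (i < 8)%N -> (j < 8)%N -> (q i).1 = (q j).1 -> i = j.
Implicit Types (f g h F G : {poly {poly C}}) (p : C * C) (m R : nat -> nat).

(** A component of the special curve; [mu i] tells whether it passes through [q i],
    always simply. *)
Record component := Component { eqn : {poly {poly C}}; dg : nat; mu : nat -> bool }.

Definition good_comp c := plane_curve (dg c) (eqn c) /\
  forall i, (i < 8)%N -> if mu c i then smooth_at (eqn c) (q i) else ev (eqn c) (q i) != 0.

Definition vanq m f := forall i, (i < 8)%N -> van (m i) f (q i).

Definition off_q p := forall i, (i < 8)%N -> p.1 != (q i).1.

(** The part of the intersection number of [c] with a curve of multiplicities [m] that is
    located at the points [q i]. *)
Definition inc c m : nat := \sum_(0 <= i < 8) mu c i * m i.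

Lemma vanqD m f g : vanq m f -> vanq m g -> vanq m (f + g).
Proof. by move=> Hf Hg i lti; apply: vanD; [apply: Hf|apply: Hg]. Qed.

Lemma vanqCM m c f : vanq m f -> vanq m (c%:P%:P * f).
Proof. by move=> Hf i lti; have := vanM (@van0 _ c%:P%:P (q i)) (Hf i lti); rewrite add0n. Qed.

Lemma vanq_sum (I : Type) (s : seq I) m (F : I -> {poly {poly C}}) :
  (forall i, vanq m (F i)) -> vanq m (\sum_(i <- s) F i).
Proof.
move=> H; elim: s => [|i s IH]; first by rewrite big_nil => j _; apply: van_zero.
by rewrite big_cons; apply: vanqD.
Qed.

Lemma vanq_eqn c : good_comp c -> vanq (mu c) (eqn c).
Proof.
case=> _ H i lti; have := H i lti; case: (mu c i); last by move=> _; apply: van0.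
by case/andP=> /eqP e0 _; apply: ev_van.
Qed.

Lemma vanq_div c m h : good_comp c ->
  vanq (fun i => mu c i + m i)%N (h * eqn c) -> vanq m h.
Proof.
case=> _ H Hv i lti; have := Hv i lti; have := H i lti.
case: (mu c i) => [/andP[/eqP e0 e1]|e0]; first by apply: van_div_simple.
by apply: van_div_unit.
Qed.

(** The points of [c] where zeros are prescribed: the [q i] on it and the list [s]. *)
Definition marks c (s : seq (C * C)) : seq (nat + C * C) :=
  [seq inl i | i <- iota 0 8 & mu c i] ++ [seq inr p | p <- s].

Definition mark_pt (t : nat + C * C) := match t with inl i => q i | inr p => p end.

Definition mark_mult R (n : C * C -> nat) (t : nat + C * C) :=
  match t with inl i => R i | inr p => n p end.

Lemma marks_uniq c s : uniq [seq p.1 | p <- s] -> (forall p, p \in s -> off_q p) ->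
  uniq [seq (mark_pt t).1 | t <- marks c s].
Proof.
move=> us Hs; rewrite map_cat cat_uniq -!map_comp; apply/and3P; split=> //.
  rewrite map_inj_in_uniq ?filter_uniq ?iota_uniq // => i j.
  rewrite !mem_filter !mem_iota => /andP[_ /= lti] /andP[_ /= ltj] /=; exact: q_inj.
apply/hasPn => x /mapP[p pin ->]; apply/mapP => -[t].
rewrite mem_filter mem_iota => /andP[_ /= ltt] /= e.
by have /(_ t ltt) := Hs p pin; rewrite e eqxx.
Qed.

Lemma marksP c s t : t \in marks c s ->
  (exists2 i, t = inl i & (i < 8)%N && mu c i) \/ (exists2 p, t = inr p & p \in s).
Proof.
rewrite mem_cat => /orP[/mapP[j]|/mapP[p pin ->]]; last by right; exists p.
by rewrite mem_filter mem_iota => /andP[mj /= ltj] ->; left; exists j; rewrite // ltj.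
Qed.

Lemma sum_mark_mult c s R n :
  (\sum_(t <- marks c s) mark_mult R n t = inc c R + \sum_(p <- s) n p)%N.
Proof.
rewrite big_cat !big_map big_filter /inc /index_iota subn0; congr (_ + _)%N.
by rewrite big_mkcond; apply: eq_bigr => i _; case: (mu c i); rewrite ?mul1n ?mul0n.
Qed.

Lemma comp_bezout c D f R (s : seq (C * C)) (n : C * C -> nat) :
    good_comp c -> tdeg D f -> vanq R f -> uniq [seq p.1 | p <- s] ->
    (forall p, p \in s -> [/\ off_q p, smooth_at (eqn c) p & onb (eqn c) (n p) f p]) ->
    (dg c * D < inc c R + \sum_(p <- s) n p)%N ->
  eqn c %| f.
Proof.
move=> [cg cq] Hf HR us Hs Hn.
apply: (@bezout C (dg c) (eqn c) D f _ (marks c s) mark_pt (mark_mult R n)) => //.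
- by apply: marks_uniq => // p pin; case: (Hs p pin).
- move=> t /marksP[[i -> /andP[lti mi]]|[p -> pin]] /=; last by have [_] := Hs p pin.
  by split; [have := cq i lti; rewrite mi | apply/van_onb/HR].
- by rewrite sum_mark_mult.
Qed.

Definition comb n (u : 'rV[C]_n) (Gs : 'I_n -> {poly {poly C}}) :=
  \sum_a (u 0 a)%:P%:P * Gs a.

Lemma vanq_comb m n (u : 'rV_n) Gs : (forall a, vanq m (Gs a)) -> vanq m (comb u Gs).
Proof. by move=> H; apply: vanq_sum => a; apply: vanqCM. Qed.

Lemma tdeg_comb D n (u : 'rV_n) Gs : (forall a, tdeg D (Gs a)) -> tdeg D (comb u Gs).
Proof.
move=> H; rewrite /comb; elim/big_ind: _ => [|x y|a _]; [exact: tdeg0|exact: tdegD|].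
exact: tdegCM.
Qed.

Lemma comb_comb n k (B : 'M[C]_(k, n)) (u : 'rV_k) Gs :
  comb u (fun b => comb (row b B) Gs) = comb (u *m B) Gs.
Proof.
rewrite /comb; under eq_bigr do rewrite mulr_sumr.
rewrite exchange_big; apply: eq_bigr => a _; rewrite mxE !rmorph_sum mulr_suml /=.
by apply: eq_bigr => b _; rewrite mxE mulrA -!rmorphM.
Qed.

Lemma comb_mulr n (u : 'rV_n) hs g : comb u (fun a => hs a * g) = comb u hs * g.
Proof. by rewrite /comb mulr_suml; apply: eq_bigr => a _; rewrite mulrA. Qed.

Lemma ev_comb n (u : 'rV_n) Gs p : ev (comb u Gs) p = \sum_a u 0 a * ev (Gs a) p.
Proof. by rewrite /comb ev_sum; apply: eq_bigr => a _; rewrite evM evC. Qed.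

(** The forms of degree [e] with multiplicities [R] at the [q i] span a space of dimension
    at most [N]; said through linear dependences, so that the space need not be built. *)
Definition dim_le e R N := forall Gs : 'I_N.+1 -> {poly {poly C}},
  (forall a, tdeg e (Gs a) /\ vanq R (Gs a)) ->
  exists2 u : 'rV_N.+1, u != 0 & comb u Gs = 0.

Lemma dim_le0 : dim_le 0 (fun=> 0%N) 1.
Proof.
move=> Gs HG.
have [c0 e0] := tdeg0P (proj1 (HG 0)); have [c1 e1] := tdeg0P (proj1 (HG 1)).
have [z|nz] := eqVneq c1 0.
  exists (delta_mx 0 1).
    by apply/eqP => /matrixP/(_ 0 1); rewrite !mxE !eqxx => /eqP; rewrite oner_eq0.
  by rewrite /comb !big_ord_recl big_ord0 !mxE /= mul0r add0r addr0 (_ : lift _ _ = 1) ?e1 ?z ?mulr0 //; apply: val_inj.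
exists (\row_a if a == 0 then c1 else - c0).
  apply/eqP => /matrixP/(_ 0 0); rewrite !mxE eqxx => /eqP; exact/negP.
rewrite /comb !big_ord_recl big_ord0 !mxE /= addr0 (_ : lift _ _ = 1); last exact: val_inj.
by rewrite e0 e1 -!rmorphM -!rmorphD /= mulNr [c0 * _]mulrC subrr.
Qed.

Lemma dim_le_ext e e' R R' N : e = e' -> (forall i, (i < 8)%N -> R i = R' i) ->
  dim_le e R N -> dim_le e' R' N.
Proof.
move=> <- eR H Gs HG; apply: H => a; have [Ge GR] := HG a; split=> // i lti.
by rewrite eR //; apply: GR.
Qed.

(** Restriction to [c]: vanishing at [K] general points of [c] costs [K] dimensions, and
    then forces divisibility by the equation of [c], by Bezout. *)
Lemma dim_le_add c e R N K : good_comp c -> dim_le e R N ->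
  (dg c * (e + dg c) < inc c (fun i => mu c i + R i)%N + K)%N ->
  dim_le (e + dg c)%N (fun i => mu c i + R i)%N (N + K)%N.
Proof.
move=> gc HN HK Gs HG; have [cg _] := gc.
have nohs (h : {poly {poly C}}) : h \in [::] -> ~~ (eqn c %| h) by [].
have [s [ss us Hs]] := plane_curve_points [seq (q i).1 | i <- iota 0 8] K cg nohs.
(* The rows of B give N + 1 independent combinations of the Gs that vanish at the
   chosen points of c. *)
pose A := \matrix_(a < (N + K).+1, b < K) ev (Gs a) (nth (0, 0) s b).
pose B := pid_mx N.+1 *m row_base (kermx A) : 'M_(N.+1, (N + K).+1).
have le_rk : (N.+1 <= \rank (kermx A))%N.
  by rewrite mxrank_ker; have := rank_leq_col A; lia.
have BA : B *m A = 0.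
  by rewrite -mulmxA (_ : row_base _ *m A = 0) ?mulmx0 //; apply/sub_kermxP; rewrite eq_row_base.
have Bfree : row_free B.
  rewrite /B; apply/row_freeP.
  have /row_freeP[D HD] := row_base_free (kermx A).
  exists (D *m pid_mx N.+1); rewrite -mulmxA (mulmxA (row_base _)) HD mul1mx mul_pid_mx.
  by rewrite minnn (minn_idPr le_rk) pid_mx_1.
pose Hs' b := comb (row b B) Gs.
have HHs b : tdeg (e + dg c)%N (Hs' b) /\ vanq (fun i => mu c i + R i)%N (Hs' b).
  by split; [apply: tdeg_comb|apply: vanq_comb] => a; case: (HG a).
have dvH b : eqn c %| Hs' b.
  have [Hd Hv] := HHs b.
  apply: (comp_bezout (s := s) (n := fun=> 1%N) gc Hd Hv) => // [p pin|].
    have [pb ps _] := Hs p pin; split=> //.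
      by move=> i lti; apply: contraNneq pb => ->; apply/mapP; exists i; rewrite ?mem_iota.
    apply/van_onb/ev_van; rewrite /Hs' ev_comb.
    have pi := index_mem p s; rewrite pin ss in pi.
    have := congr1 (fun X : 'M_(_, _) => X b (Ordinal pi)) BA; rewrite [LHS]mxE [RHS]mxE => BA0; rewrite -[RHS]BA0.
    by apply: eq_bigr => a _; rewrite !mxE /= nth_index.
  by rewrite sum1_size ss.
have /choice[hs Ehs] : forall b, exists h, Hs' b = h * eqn c.
  by move=> b; apply/(dvdp_plane_curveP _ cg).
have [|u u0 Hu] := HN hs.
  move=> b; have [Hd Hv] := HHs b; rewrite Ehs in Hd Hv; split; last exact: vanq_div Hv.
  by case: cg => mg sg tg _; apply: tdeg_quotient mg sg tg Hd.
exists (u *m B).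
  by apply: contra u0 => /eqP uB; rewrite -(mulmx1 u); have /row_freeP[D <-] := Bfree; rewrite mulmxA uB mul0mx.
have <- : comb u Hs' = comb (u *m B) Gs by apply: comb_comb.
have -> : Hs' = fun b => hs b * eqn c by apply: funext.
by rewrite comb_mulr Hu mul0r.
Qed.

(** A linear map to a space of dimension [M], from a space of dimension at most [M], is not
    onto when its kernel contains the nonzero [F]. *)
Lemma unattained_values e R (ps : nat -> C * C) M F :
    dim_le e R M -> tdeg e F -> vanq R F -> F != 0 ->
    (forall b, (b < M)%N -> ev F (ps b) = 0) ->
  exists t : nat -> C, forall G, tdeg e G -> vanq R G ->
    ~ (forall b, (b < M)%N -> ev G (ps b) = t b).
Proof.
move=> HM Fe FR F0 Fp; apply: contrapT => /forallNP all_t.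
have /choice[Gs HGs] : forall a : 'I_M, exists G, [/\ tdeg e G, vanq R G &
    forall b, (b < M)%N -> ev G (ps b) = (b == a)%:R].
  move=> a; have /existsNP[G] := all_t (fun b => (b == a)%:R).
  by move=> /not_implyP[Ge] /not_implyP[GR] /contrapT Gp; exists G.
(* Together with F, forms separating the M points would be M + 1 independent forms. *)
pose Hs a := if unlift ord_max a is Some a' then Gs a' else F.
have [a|u u0 Hu] := HM Hs.
  by rewrite /Hs; case: unliftP => [a' _|_] //; case: (HGs a').
have uM b : u 0 (lift ord_max b) = 0.
  have := congr1 (fun f => ev f (ps b)) Hu; rewrite ev_comb ev0 (bigD1 (lift ord_max b)) //=.
  rewrite {1}/Hs liftK; have [_ _ ->] := HGs b; rewrite // eqxx mulr1 big1 ?addr0 // => a ne.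
  rewrite /Hs; case: unliftP ne => [a' ->|-> _]; last by rewrite Fp // mulr0.
  rewrite (inj_eq lift_inj) => ne; have [_ _ ->] := HGs a'; rewrite // eq_sym.
  by move/negbTE: ne; rewrite -val_eqE => ->; rewrite mulr0.
have u_max : u 0 ord_max != 0.
  apply: contra u0 => /eqP um; apply/eqP/rowP => a; rewrite mxE.
  by case: (unliftP ord_max a) => [a' ->|->].
move: Hu; rewrite /comb (bigD1 ord_max) //= big1 ?addr0 => [|a]; last first.
  by case: (unliftP ord_max a) => [a' ->|->]; rewrite ?eqxx // uM !rmorph0 mul0r.
rewrite /Hs unlift_none => /eqP; rewrite mulf_eq0 !polyC_eq0 (negbTE u_max) /=.
exact/negP.
Qed.

End Components.

(** * Rigidity of a curve with a triangle of degree zero *)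

(** Transporting the constants once around the triangle multiplies [c0] by the quotient of
    the two products. *)
Lemma triangle_cycle (K : fieldType) (A01 A02 A11 A12 A20 A21 c0 c1 c2 : K) :
    A01 != 0 -> A11 != 0 -> A20 != 0 ->
    c0 * A01 = c1 * A11 -> c0 * A02 = c2 * A20 -> c1 * A12 = c2 * A21 ->
    A01 * A12 * A20 != A11 * A21 * A02 ->
  [/\ c0 = 0, c1 = 0 & c2 = 0].
Proof.
move=> n01 n11 n20 E01 E02 E12 ne.
have c00 : c0 = 0.
  apply/eqP; apply: contraNT ne => c0n; apply/eqP/(mulfI c0n).
  transitivity (c0 * A01 * A12 * A20); first by ring.
  rewrite E01; transitivity (c1 * A12 * (A11 * A20)); first by ring.
  rewrite E12; transitivity (c2 * A20 * (A21 * A11)); first by ring.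
  by rewrite -E02; ring.
split=> //; first by move/esym/eqP: E01; rewrite c00 mul0r mulf_eq0 (negbTE n11) orbF => /eqP.
by move/esym/eqP: E02; rewrite c00 mul0r mulf_eq0 (negbTE n20) orbF => /eqP.
Qed.

Section Position.
Variable C : numClosedFieldType.
Variable q : nat -> C * C.
Hypothesis q_inj : forall i j, (i < 8)%N -> (j < 8)%N -> (q i).1 = (q j).1 -> i = j.
(* The curve with components cc i, of class (d; m); the first three are the sides
   y = a i of the triangle, whose vertices have abscissae v01, v02, v12. The points pp i
   on cc i are so many that the class (d; m) minus these points has degree zero on cc i. *)
Variables (n d k : nat) (m : nat -> nat) (cc : nat -> component C) (pp : nat -> seq (C * C)).
Variables (a : nat -> {poly C}) (v01 v02 v12 : C).

Definition total_eqn : {poly {poly C}} := \prod_(i < n) eqn (cc i).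

Local Notation F := total_eqn.

(** On a side, degree zero leaves room for the prescribed zeros only. *)
Definition side_poly i : {poly C} :=
  \prod_(t <- marks (cc i) (pp i)) ('X - (mark_pt q t).1%:P) ^+ mark_mult m (fun=> 1%N) t.

Hypothesis cc_good : forall i, (i < n)%N -> good_comp q (cc i).
Hypothesis cc_inj : forall i j, (i < n)%N -> (j < n)%N -> eqn (cc i) = eqn (cc j) -> i = j.
Hypothesis n_ge3 : (3 <= n)%N.
Hypothesis side_eqn : forall i, (i < 3)%N -> eqn (cc i) = 'X - (a i)%:P.
Hypothesis side_dg : forall i, (i < 3)%N -> dg (cc i) = 1%N.
Hypothesis side_size : forall i, (i < 3)%N -> (size (a i) <= 2)%N.
Hypothesis pp_size : forall i, (i < n)%N -> (size (pp i) + inc (cc i) m = dg (cc i) * d)%N.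
Hypothesis pp_uniq : forall i, (i < n)%N -> uniq [seq p.1 | p <- pp i].
Hypothesis pp_off : forall i p, (i < n)%N -> p \in pp i ->
  [/\ off_q q p, smooth_at (eqn (cc i)) p & smooth_at F p].
Hypothesis extra : forall i, (3 <= i)%N -> (i < n)%N -> exists s, [/\ off_q q s,
  smooth_at (eqn (cc i)) s, s.1 \notin [seq p.1 | p <- pp i] &
  exists2 t, (t < 3)%N & ev (eqn (cc t)) s = 0].
Hypothesis sum_dg : (\sum_(i < n) dg (cc i) = d)%N.
Hypothesis sum_mu : forall j, (j < 8)%N -> (\sum_(i < n) mu (cc i) j = m j)%N.
Hypothesis vertex01 : (a 0%N).[v01] = (a 1%N).[v01].
Hypothesis vertex02 : (a 0%N).[v02] = (a 2).[v02].
Hypothesis vertex12 : (a 1%N).[v12] = (a 2).[v12].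
Hypothesis side_vertex : [&& (side_poly 0).[v01] != 0, (side_poly 0).[v02] != 0,
  (side_poly 1).[v01] != 0, (side_poly 1).[v12] != 0,
  (side_poly 2).[v02] != 0 & (side_poly 2).[v12] != 0].
(* The line bundle of degree zero that (d; m) minus the marked points induces on the
   triangle has no trivial power of positive exponent at most k. *)
Hypothesis carnot : forall j, (0 < j)%N -> (j <= k)%N ->
  ((side_poly 0).[v01] * (side_poly 1).[v12] * (side_poly 2).[v02]) ^+ j !=
  ((side_poly 1).[v01] * (side_poly 2).[v12] * (side_poly 0).[v02]) ^+ j.

Lemma plane_cc i : (i < n)%N -> plane_curve (dg (cc i)) (eqn (cc i)).
Proof. by case/cc_good. Qed.

Lemma F_monic : F \is monic.
Proof. by apply: monic_prod => i _; case: (plane_cc (ltn_ord i)). Qed.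

Lemma F_tdeg : tdeg d F.
Proof. by rewrite -sum_dg; apply: tdeg_prod => i; case: (plane_cc (ltn_ord i)). Qed.

Lemma F_size : size F = d.+1.
Proof.
rewrite -sum_dg size_prod => [|i _]; last by apply: monic_neq0; case: (plane_cc (ltn_ord i)).
under eq_bigr => i _ do (have [_ -> _ _] := plane_cc (ltn_ord i); rewrite -addn1).
by rewrite big_split /= sum1_card -addSn addnK.
Qed.

Lemma F_vanq : vanq q m F.
Proof.
move=> j ltj; rewrite -(sum_mu ltj); apply: van_prod => i.
exact: vanq_eqn (cc_good (ltn_ord i)) j ltj.
Qed.

Lemma dvdF f : (forall i, (i < n)%N -> eqn (cc i) %| f) -> exists h, f = h * F.
Proof.
move=> H; suff : F %| f by move/(Pdiv.IdomainMonic.dvdpP F_monic).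
rewrite /total_eqn -(big_mkord xpredT (fun i => eqn (cc i))).
have: (n <= n)%N by []. move: {1 3}n => N; elim: N => [|N IH] leN.
  by rewrite big_geq // dvd1p.
rewrite big_nat_recr //= Gauss_dvdp ?H // ?IH ?(ltnW leN) //.
have igN : irr (eqn (cc N)) by case: (plane_cc leN).
apply: irr_coprimep => //; rewrite big_nat.
elim/big_rec: _ => [|i x /andP[_ ltiN] IHx].
  by rewrite dvdp1; case: igN => /gtn_eqF; rewrite eq_sym => ->.
apply/negP => /(irr_dvdM igN)/orP[|]; last exact/negP.
have ltin : (i < n)%N := ltn_trans ltiN leN.
move/(plane_curve_dvd_eq (plane_cc leN) (plane_cc ltin))/(cc_inj leN ltin) => e.
by rewrite e ltnn in ltiN.
Qed.

(** The prescribed zeros of the restriction exhaust its degree j d. *)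
Lemma side_restrict i j f : (i < 3)%N -> tdeg (j * d)%N f ->
    vanq q (fun t => j * m t)%N f ->
    (forall p, p \in pp i -> onb (eqn (cc i)) j f p) ->
  exists c, f.[a i] = c *: side_poly i ^+ j.
Proof.
move=> lti3 Hd Hv Ho; have ltin := leq_trans lti3 n_ge3.
have Ea p : ev (eqn (cc i)) p = 0 -> (a i).[p.1] = p.2.
  by rewrite side_eqn // /ev !hornerE => /eqP; rewrite subr_eq0 => /eqP <-.
have dv : side_poly i ^+ j %| f.[a i].
  rewrite /side_poly -prodrXl.
  under eq_bigr do rewrite -exprM.
  apply: dvdp_prod_exp_Xsub => [|t].
    by apply: marks_uniq => [//||p pin]; [exact: pp_uniq|case: (pp_off ltin pin)].
  case/marksP => [[l -> /andP[ltl ml]]|[p -> pin]] /=.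
    rewrite mulnC; apply: Hv => //; apply: Ea.
    by have [_ /(_ l ltl)] := cc_good ltin; rewrite ml => /andP[/eqP].
  rewrite mul1n; apply: Ho => //; last by rewrite side_eqn // !hornerE subrr dvdp0.
  by apply: Ea; have [_ /andP[/eqP]] := pp_off ltin pin.
have sz : size (side_poly i ^+ j) = (j * d).+1.
  rewrite /side_poly -prodrXl; under eq_bigr do rewrite -exprM.
  rewrite size_prod_exp_Xsub -big_distrl /= sum_mark_mult sum1_size addnC pp_size //.
  by rewrite side_dg // mul1n mulnC.
have [->|fn0] := eqVneq f.[a i] 0; first by exists 0; rewrite scale0r.
have se : size (side_poly i ^+ j) == size f.[a i].
  by rewrite eqn_leq dvdp_leq // sz size_horner_tdeg // side_size.
move: se; rewrite (dvdp_size_eqp dv) => /eqpf_eq[c c0 e].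
by exists c^-1; rewrite e scalerA mulVf // scale1r.
Qed.

(** Carnot's argument: the restrictions of [f] to the three sides are known up to
    constants, which would have to match at the vertices. *)
Lemma sides_dvd j f : (0 < j)%N -> (j <= k)%N -> tdeg (j * d)%N f ->
    vanq q (fun t => j * m t)%N f ->
    (forall i, (i < n)%N -> forall p, p \in pp i -> onb (eqn (cc i)) j f p) ->
  forall i, (i < 3)%N -> f.[a i] = 0.
Proof.
move=> j0 jk Hd Hv Ho.
have res i : (i < 3)%N -> exists c, f.[a i] = c *: side_poly i ^+ j.
  by move=> lti; apply: side_restrict => //; apply: Ho; apply: leq_trans n_ge3.
have [c0 e0] := res 0%N isT; have [c1 e1] := res 1%N isT; have [c2 e2] := res 2%N isT.
have mt i l v : (a i).[v] = (a l).[v] -> f.[a i].[v] = f.[a l].[v].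
  by rewrite !horner2E => ->.
have := mt _ _ _ vertex01; have := mt _ _ _ vertex02; have := mt _ _ _ vertex12.
rewrite e0 e1 e2 !hornerZ !horner_exp.
have := carnot j0 jk.
case/and5P: side_vertex => + + + + /andP[].
move=> n01 n02 n11 n12 n20 n21 ne E12 E02 E01.
have [|c00 c10 c20] := triangle_cycle (expf_neq0 j n01) (expf_neq0 j n11)
  (expf_neq0 j n20) E01 E02 E12; first by rewrite -!exprMn in ne *.
by case=> [|[|[|i]]] // _; rewrite ?e0 ?e1 ?e2 ?c00 ?c10 ?c20 scale0r.
Qed.

(** A component other than the sides meets the triangle outside the [q i]; there [f] has
    one zero more than its degree on the component allows. *)
Lemma total_eqn_dvd j f : (0 < j)%N -> (j <= k)%N -> tdeg (j * d)%N f ->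
    vanq q (fun t => j * m t)%N f ->
    (forall i, (i < n)%N -> forall p, p \in pp i -> onb (eqn (cc i)) j f p) ->
  exists h, f = h * F.
Proof.
move=> j0 jk Hd Hv Ho; have sd := sides_dvd j0 jk Hd Hv Ho.
apply: dvdF => i ltin; have [lti3|gei3] := ltnP i 3.
  rewrite side_eqn // dvdp_XsubCl; apply/eqP; exact: sd.
have [s [so ss sn [t lt3 tev]]] := extra gei3 ltin.
have fs : ev f s = 0.
  rewrite -(@ev_arc _ f (a t) s) ?sd ?horner0 //.
  by move: tev; rewrite side_eqn // /ev !hornerE => /eqP; rewrite subr_eq0 => /eqP <-.
apply: (@comp_bezout C q q_inj (cc i) _ f _ (s :: pp i)
  (fun p => if p == s then 1%N else j) (cc_good ltin) Hd Hv) => [|p|].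
- by rewrite /= sn pp_uniq.
- rewrite in_cons; case: eqP => [-> _|_ /= pin].
    by split=> //; apply/van_onb/ev_van.
  by have [po ps _] := pp_off ltin pin; split=> //; apply: Ho.
- rewrite big_cons eqxx.
  have -> : (\sum_(p <- pp i) (if p == s then 1 else j) = size (pp i) * j)%N.
    transitivity (\sum_(p <- pp i) j)%N; last first.
      by rewrite big_const_seq count_predT iter_addn_0 mulnC.
    apply: eq_big_seq => p pin; case: eqP => // e.
    by case/negP: sn; rewrite -e; apply/mapP; exists p.
  have -> : inc (cc i) (fun t => j * m t)%N = (inc (cc i) m * j)%N.
    by rewrite /inc big_distrl; apply: eq_bigr => l _; rewrite /= -mulnA [(m l * j)%N]mulnC.
  rewrite addnCA add1n ltnS -mulnDl addnC pp_size // mulnAC -mulnA.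
  by rewrite leq_mul2l [(j * d)%N]mulnC leqnn orbT.
Qed.

Lemma vanq_divF R h : vanq q (fun t => m t + R t)%N (h * F) -> vanq q R h.
Proof.
suff aux N g R' : (N <= n)%N ->
    vanq q (fun t => \sum_(0 <= i < N) mu (cc i) t + R' t)%N
      (g * \prod_(0 <= i < N) eqn (cc i)) -> vanq q R' g.
  move=> H; apply: (aux n) => // t ltt; have := H t ltt.
  by rewrite -(sum_mu ltt) /total_eqn !big_mkord.
elim: N g R' => [|N IH] g R' leN H.
  by move=> t ltt; have := H t ltt; rewrite !big_geq // mulr1.
apply: (vanq_div (cc_good leN)); apply: (IH _ _ (ltnW leN)) => t ltt.
have := H t ltt; rewrite !big_nat_recr //= -addnA.
by rewrite [_ * eqn _]mulrC mulrA mulrAC.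
Qed.

Definition all_pts := flatten [seq pp i | i <- iota 0 n].

Definition pt b := nth (0, 0) all_pts b.

Lemma all_ptsP i p : (i < n)%N -> p \in pp i -> exists2 b, (b < size all_pts)%N & p = pt b.
Proof.
move=> ltin pin; have pa : p \in all_pts.
  by apply/flattenP; exists (pp i) => //; apply/mapP; exists i; rewrite ?mem_iota.
by exists (index p all_pts); rewrite ?index_mem // /pt nth_index.
Qed.

Lemma pt_smooth b : (b < size all_pts)%N -> smooth_at F (pt b).
Proof.
move=> ltb; have /flattenP[s /mapP[i + ->] pin] := mem_nth (0, 0) ltb.
by rewrite mem_iota => /= ltin; case: (pp_off ltin pin).
Qed.

(** The systems based at the special configuration have a single member: divide by the
    total equation and induct. *)
Lemma special_member j f : (j <= k)%N -> tdeg (j * d)%N f ->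
    vanq q (fun t => j * m t)%N f ->
    (forall b, (b < size all_pts)%N -> van j f (pt b)) ->
  exists c, f = c%:P%:P * F ^+ j.
Proof.
elim: j f => [|j IH] f jk Hd Hv Ho.
  by rewrite mul0n in Hd; have [c ->] := tdeg0P Hd; exists c; rewrite mulr1.
have [h def_f] : exists h, f = h * F.
  apply: (total_eqn_dvd _ jk Hd Hv) => // i ltin p pin.
  by have [b ltb ->] := all_ptsP ltin pin; apply/van_onb/Ho.
have [||||c def_h] := IH h; last by exists c; rewrite def_f def_h exprSr mulrA.
- exact: ltnW.
- by apply: (tdeg_quotient F_monic F_size F_tdeg); rewrite -def_f addnC -mulSn.
- by apply: vanq_divF; rewrite -def_f => t ltt; have := Hv t ltt; rewrite mulSn.
- move=> b ltb; have /andP[/eqP F0 F1] := pt_smooth ltb.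
  by apply: (van_div_simple F0 F1); rewrite -def_f; apply: Ho.
Qed.

(** Here [f] is the first-order term of a deformation of a multiple of [F ^+ j.+1]. It has
    order [j] along [F] at the marked points, which [total_eqn_dvd] needs, so [F] can be
    divided out [j] times; the weights [W] are carried along. *)
Lemma first_order_values j f (W : nat -> C) : (j < k)%N -> tdeg (j.+1 * d)%N f ->
    vanq q (fun t => j.+1 * m t)%N f ->
    (forall b, (b < size all_pts)%N -> van j.+1 (f + (W b)%:P%:P * F ^+ j) (pt b)) ->
  exists G, [/\ tdeg d G, vanq q m G &
    forall b, (b < size all_pts)%N -> ev G (pt b) = - W b].
Proof.
elim: j f => [|j IH] f jk Hd Hv Ho.
  exists f; split=> [||b ltb]; first by rewrite mul1n in Hd.
    by move=> t ltt; have := Hv t ltt; rewrite mul1n.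
  by have /van_ev/eqP := Ho b ltb; rewrite evD evM ev1 evC mulr1 addr_eq0 => /eqP.
have [h def_f] : exists h, f = h * F.
  apply: (total_eqn_dvd _ jk Hd Hv) => // i ltin p pin Y HY dvY.
  have [b ltb def_p] := all_ptsP ltin pin; rewrite def_p in HY dvY *.
  have := Ho b ltb Y HY; rewrite hornerD hornerM => dv.
  rewrite -(dvdp_addl _ (_ : _ %| (W b)%:P%:P.[Y] * (F ^+ j.+1).[Y])) //.
  apply: dvdp_mull; rewrite [F ^+ _]exprS hornerM; apply: dvdp_mulr.
  by rewrite /total_eqn (bigD1 (Ordinal ltin)) //= hornerM; apply: dvdp_mulr.
have [||||G HG] := IH h; last by exists G.
- exact: ltnW.
- by apply: (tdeg_quotient F_monic F_size F_tdeg); rewrite -def_f addnC -mulSn.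
- by apply: vanq_divF; rewrite -def_f => t ltt; have := Hv t ltt; rewrite mulSn.
- move=> b ltb; have /andP[/eqP F0 F1] := pt_smooth ltb.
  apply: (van_div_simple F0 F1); rewrite mulrDl -def_f -mulrA -exprSr.
  exact: Ho.
Qed.

(** Move [pt b] to (x, y + t v b): the family f0 + t f1 keeps multiplicity [k] there, to
    first order in t, when f1 + v b * df0/dy has multiplicity [k] at [pt b]. The
    direction [v] is rigid when such families have f0 = 0. *)
Definition rigid_by (v : nat -> C) := forall f0 f1,
  [/\ tdeg (k * d)%N f0, tdeg (k * d)%N f1,
      vanq q (fun t => k * m t)%N f0 & vanq q (fun t => k * m t)%N f1] ->
  (forall b, (b < size all_pts)%N -> van k f0 (pt b)) ->
  (forall b, (b < size all_pts)%N -> van k (f1 + (v b)%:P%:P * f0^`()) (pt b)) ->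
  f0 = 0.

(** Here f0 = c F^k, and its y-derivative is k c F^(k-1) dF/dy. By [first_order_values] the
    numbers k c v b (dF/dy)(pt b) would be, up to sign, the values at the [pt b] of a form of
    class (d; m): [v] is chosen to exclude this for c <> 0. *)
Lemma rigid_direction : (0 < k)%N -> dim_le q d m (size all_pts) -> exists v, rigid_by v.
Proof.
move=> k0 HM; have F0 : F != 0 by apply: monic_neq0 F_monic.
have F_pt b : (b < size all_pts)%N -> ev F (pt b) = 0.
  by move=> ltb; have /andP[/eqP] := pt_smooth ltb.
have [t Ht] := unattained_values HM F_tdeg F_vanq F0 F_pt.
exists (fun b => - (t b / ev F^`() (pt b))) => f0 f1 [d0 d1 v0 v1] p0 p1.
have [c def_f0] := special_member (leqnn k) d0 v0 p0.
have [c0|cn0] := eqVneq c 0; first by rewrite def_f0 c0 mul0r.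
pose K : C := c * k%:R; have Kn0 : K != 0 by rewrite mulf_neq0 // pnatr_eq0 -lt0n.
have [||||G [Gd Gv Gp]] := @first_order_values k.-1 f1 (fun b => - (K * t b)); rewrite ?prednK //.
  move=> b ltb; have /andP[_ nF'] := pt_smooth ltb.
  (* Up to terms of multiplicity k at pt b, the factor dF/dy may be replaced by its value
     there. *)
  pose E := (- (t b / ev F^`() (pt b)) * K)%:P%:P : {poly {poly C}}.
  have -> : f1 + (- (K * t b))%:P%:P * F ^+ k.-1 =
     f1 + (- (t b / ev F^`() (pt b)))%:P%:P * f0^`() +
     E * (F ^+ k.-1 * ((ev F^`() (pt b))%:P%:P - F^`())).
    rewrite def_f0 derivM derivC mul0r add0r deriv_exp -mulr_natr.
    have -> : k%:R = k%:R%:P%:P :> {poly {poly C}} by rewrite !rmorph_nat.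
    have -> : (- (K * t b))%:P%:P = E * (ev F^`() (pt b))%:P%:P :> {poly {poly C}}.
      by rewrite /E -!rmorphM /=; congr (_%:P%:P); field.
    rewrite /E /K !rmorphM /= !rmorphN /=; ring.
  apply: vanD; first exact: p1.
  have := @vanM _ 0 (k.-1 + 1) E (F ^+ k.-1 * ((ev F^`() (pt b))%:P%:P - F^`())) (pt b).
  rewrite add0n addn1 prednK //; apply; first exact: van0.
  rewrite -{1}(prednK k0) -addn1; apply: vanM; first by apply/vanX/F_pt.
  by apply: ev_van; rewrite evD evN evC subrr.
case: (Ht (K^-1%:P%:P * G)); first exact: tdegCM.
  exact: vanqCM.
by move=> b ltb; rewrite evM evC Gp // opprK mulKf.
Qed.

End Position.

(** * Lines and pencils of cubics *)

Section Pencils.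
Variable C : numClosedFieldType.
Implicit Types (P Q : C -> Prop) (l : C * C) (f g : {poly {poly C}}).

Definition cofinite P := exists bad : seq C, forall x, x \notin bad -> P x.

Lemma cofiniteT P : (forall x, P x) -> cofinite P.
Proof. by move=> H; exists [::]. Qed.

Lemma cofiniteI P Q : cofinite P -> cofinite Q -> cofinite (fun x => P x /\ Q x).
Proof.
move=> [b1 H1] [b2 H2]; exists (b1 ++ b2) => x.
by rewrite mem_cat negb_or => /andP[/H1 ? /H2 ?].
Qed.

Lemma cofiniteW P Q : (forall x, P x -> Q x) -> cofinite P -> cofinite Q.
Proof. by move=> PQ [b H]; exists b => x /H/PQ. Qed.

Lemma cofinite_neq a : cofinite (fun x => x != a).
Proof. by exists [:: a] => x; rewrite inE. Qed.

Lemma cofinite_all (T : eqType) (s : seq T) (P : T -> C -> Prop) :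
  (forall i, i \in s -> cofinite (P i)) -> cofinite (fun x => forall i, i \in s -> P i x).
Proof.
elim: s => [|i s IH] H; first by apply: cofiniteT.
have [||b Hb] := @cofiniteI (P i) (fun x => forall i, i \in s -> P i x).
- exact/H/mem_head.
- by apply: IH => j js; apply: H; rewrite in_cons js orbT.
by exists b => x /Hb[Hi Hs] j; rewrite in_cons => /predU1P[->|/Hs].
Qed.

Lemma cofinite_affine a b : (a != 0) || (b != 0) -> cofinite (fun x => a + x * b != 0).
Proof.
have [->|b0] := eqVneq b 0.
  by rewrite orbF => a0; apply: cofiniteT => x; rewrite mulr0 addr0.
move=> _; apply: cofiniteW (cofinite_neq (- a / b)) => x; apply: contra.
by rewrite addr_eq0 => /eqP ->; rewrite opprK mulfK.
Qed.

Definition aff l : {poly C} := l.1%:P * 'X + l.2%:P.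

Definition lin l : {poly {poly C}} := 'X - (aff l)%:P.

Lemma size_aff l : (size (aff l) <= 2)%N.
Proof.
rewrite /aff mul_polyC; apply: leq_trans (size_polyD _ _) _.
rewrite geq_max (leq_trans (size_polyC_leq1 _)) // andbT.
by apply: leq_trans (size_scale_leq _ _) _; rewrite size_polyX.
Qed.

Lemma aff_horner l x : (aff l).[x] = l.1 * x + l.2.
Proof. by rewrite /aff !hornerE. Qed.

Lemma ev_lin l p : ev (lin l) p = p.2 - (l.1 * p.1 + l.2).
Proof. by rewrite /ev /lin hornerXsubC hornerD hornerN hornerC aff_horner. Qed.

Lemma lin_monic l : lin l \is monic. Proof. exact: monicXsubC. Qed.
Lemma size_lin l : size (lin l) = 2%N. Proof. exact: size_XsubC. Qed.

Lemma deriv_lin l : (lin l)^`() = 1. Proof. exact: derivXsubC. Qed.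

Lemma tdeg_lin l : tdeg 1 (lin l).
Proof.
move=> [|[|i]]; rewrite /lin coefB coefX coefC /=.
- by rewrite sub0r size_polyN size_aff.
- by rewrite subr0 size_poly1.
- by rewrite subr0 size_poly0.
Qed.

Lemma plane_curve_lin l : plane_curve 1 (lin l).
Proof.
split; rewrite ?lin_monic ?size_lin //; first exact: tdeg_lin.
rewrite /irr size_lin; split=> // h /(dvdp_leq (monic_neq0 (lin_monic l))).
by rewrite size_lin => le gt; apply/eqP; rewrite eqn_leq le.
Qed.

Definition tri (ls : seq (C * C)) : {poly {poly C}} := \prod_(l <- ls) lin l.

Lemma tri_monic ls : tri ls \is monic.
Proof. by apply: monic_prod => l _; apply: lin_monic. Qed.

Lemma size_tri ls : size (tri ls) = (size ls).+1.
Proof.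
rewrite /tri; elim: ls => [|l ls IH]; first by rewrite big_nil size_poly1.
by rewrite big_cons size_monicM ?lin_monic ?(monic_neq0 (tri_monic ls)) // IH size_lin.
Qed.

Lemma tdeg_tri ls : tdeg (size ls) (tri ls).
Proof.
rewrite /tri; elim: ls => [|l ls IH]; first by rewrite big_nil; apply: tdegC.
by rewrite big_cons -[size _]/(1 + size ls)%N; apply: tdegM => //; apply: tdeg_lin.
Qed.

Variables (ns ts : seq (C * C)).
Hypotheses (sz_ns : size ns = 3%N) (sz_ts : size ts = 3%N).

Definition pencil (x : C) := tri ns + x%:P%:P * (tri ts - tri ns).

Lemma pencilE x : pencil x = (1 - x)%:P%:P * tri ns + x%:P%:P * tri ts.
Proof. by rewrite /pencil polyCB polyCB polyC1; ring. Qed.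

Lemma ev_pencil x p : ev (pencil x) p = (1 - x) * ev (tri ns) p + x * ev (tri ts) p.
Proof. by rewrite pencilE evD !evM !evC. Qed.

Lemma size_pencil_tail x : (size (x%:P%:P * (tri ts - tri ns))%R < size (tri ns))%N.
Proof.
rewrite mul_polyC; apply: leq_ltn_trans (size_scale_leq _ _) _.
rewrite size_tri sz_ns ltnS; apply/leq_sizeP => i; rewrite leq_eqVlt coefB => /predU1P[<-|lti].
  have := monicP (tri_monic ts); have := monicP (tri_monic ns).
  by rewrite /lead_coef !size_tri sz_ns sz_ts /= => -> ->; rewrite subrr.
by rewrite !nth_default ?subrr // size_tri ?sz_ns ?sz_ts.
Qed.

Lemma size_pencil x : size (pencil x) = 4%N.
Proof. by rewrite /pencil size_polyDl ?size_pencil_tail // size_tri sz_ns. Qed.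

Lemma pencil_monic x : pencil x \is monic.
Proof. by rewrite monicE /pencil lead_coefDl ?size_pencil_tail // -monicE tri_monic. Qed.

Lemma tdeg_pencil x : tdeg 3 (pencil x).
Proof.
rewrite -sz_ns; apply: tdegD; first exact: tdeg_tri.
by apply/tdegCM/tdegB; [rewrite sz_ns -sz_ts|]; apply: tdeg_tri.
Qed.

End Pencils.

Section Irreducible.
Variable C : numClosedFieldType.
Implicit Types (f g : {poly {poly C}}) (l : C * C).

(** A reducible monic cubic has a factor of degree one in y, whose root is a
    rational function of x, integral over C[x], hence a polynomial; for degree
    reasons it is a line. *)
Lemma cubic_reducible g : g \is monic -> size g = 4%N -> tdeg 3 g -> ~ irr g ->
  exists l, g.[aff l] = 0.
Proof.
move=> mg sg Hg nirr.
have [h [c [u [hg c0 def_g]]]] : exists (h : {poly {poly C}}) (c : {poly C}) (u : {poly {poly C}}),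
    [/\ (1 < size h < 4)%N, c != 0 & c *: g = u * h].
  apply: contrapT => H; apply: nirr; split; rewrite ?sg // => h.
  case/Pdiv.Idomain.dvdpP => -[c u] /= c0 def_g h1; apply: contrapT => /eqP ne; apply: H.
  exists h, c, u; split=> //; rewrite h1 ltn_neqAle ne -sg.
  by apply: dvdp_leq; rewrite ?monic_neq0 //; apply/Pdiv.Idomain.dvdpP; exists (c, u).
have [l [w [sl defg]]] : exists l w : {poly {poly C}}, size l = 2%N /\ c *: g = l * w.
  have szM : (size u + size h = 5)%N.
    have : size (c *: g) = 4%N by rewrite size_scale.
    have : c *: g != 0 by rewrite scale_poly_eq0 negb_or c0 monic_neq0.
    rewrite def_g mulf_eq0 negb_or => /andP[u0 h0]; rewrite size_mul //.
    by case: (size u + size h)%N => [|[|n]] // [->].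
  have [h2|h3] : size h = 2%N \/ size h = 3%N by move: hg; lia.
    by exists h, u; rewrite def_g mulrC.
  by exists u, h; split=> //; move: szM; rewrite h3 => /eqP; rewrite -[5%N]/(2 + 3)%N eqn_add2r => /eqP.
have sw : (size w <= 3)%N.
  have [->|w0] := eqVneq w 0; first by rewrite size_poly0.
  have : size (l * w) = 4%N by rewrite -defg size_scale.
  by rewrite size_mul // -?size_poly_gt0 ?sl //= => -[]; rewrite add0n => ->.
have [b0 [b1 [b1n def_l]]] : exists b0 b1 : {poly C}, b1 != 0 /\ l = b1 *: 'X + b0%:P.
  exists l`_0, l`_1; split; first by have := lead_coef_eq0 l; rewrite /lead_coef sl /= => ->; rewrite -size_poly_gt0 sl.
  apply/polyP => -[|[|i]]; rewrite coefD coefZ coefX coefC /= ?mulr0 ?add0r ?mulr1 ?addr0 //.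
  by rewrite nth_default // sl.
have cg i : c * g`_i = b1 * (if i is i'.+1 then w`_i' else 0) + b0 * w`_i.
  have := congr1 (fun f => f`_i) defg; rewrite coefZ => ->.
  rewrite def_l mulrDl coefD -scalerAl coefZ mul_polyC coefZ coefXM.
  by case: i.
have g3 : g`_3 = 1 by have := monicP mg; rewrite /lead_coef sg.
have w3 : w`_3 = 0 by rewrite nth_default.
have E0 := cg 0%N; have E1 := cg 1%N; have E2 := cg 2%N; have E3 := cg 3%N.
rewrite /= g3 w3 in E0 E1 E2 E3.
(* Write the root - b0 / b1 in lowest terms - r0 / r1; then r1 divides r0 ^ 3. *)
set e := gcdp b0 b1; have e0 : e != 0 by rewrite gcdp_eq0 negb_and b1n orbT.
have /Pdiv.Field.dvdpP[r0 d0] : e %| b0 by apply: dvdp_gcdl.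
have /Pdiv.Field.dvdpP[r1 d1] : e %| b1 by apply: dvdp_gcdr.
have cop : coprimep r0 r1.
  have : coprimep (b0 %/ e) (b1 %/ e) by apply: coprimep_div_gcd; rewrite b1n orbT.
  by rewrite d0 d1 !Pdiv.Field.mulpK.
have r1n : r1 != 0 by apply: contraNneq b1n => z; rewrite d1 z mul0r.
have Hr : r0 ^+ 3 = r1 * (g`_2 * r0 ^+ 2 - g`_1 * r0 * r1 + g`_0 * r1 ^+ 2).
  apply: (mulfI (mulf_neq0 c0 (expf_neq0 3 e0))).
  transitivity (c * b0 ^+ 3); first by rewrite d0; ring.
  transitivity (b1 * (c * g`_2 * b0 ^+ 2 - c * g`_1 * b0 * b1 + c * g`_0 * b1 ^+ 2)); last by rewrite d0 d1; ring.
  by rewrite E2 E1 E0 -[c]mulr1 E3; ring.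
have sr1 : size r1 = 1%N.
  apply/eqP; rewrite -coprimepp; apply: (@coprimep_dvdr _ (r0 ^+ 3) r1 r1).
    by rewrite Hr dvdp_mulr.
  by apply: coprimep_expl.
have [k k0 def_r1] : exists2 k, k != 0 & r1 = k%:P by apply/size_poly1P/eqP.
pose Y := - (k^-1)%:P * r0.
have gE (Z : {poly C}) : g.[Z] = Z ^+ 3 + g`_2 * Z ^+ 2 + g`_1 * Z + g`_0.
  by rewrite (horner_coef_wide _ (eq_leq sg)) !big_ord_recl big_ord0 /= g3 expr0 expr1 /bump /=; ring.
have gY : g.[Y] = 0.
  have kk : k^-1%:P * k%:P = 1 :> {poly C} by rewrite -polyCM mulVf.
  rewrite gE /Y; transitivity (- (k^-1)%:P ^+ 3 * (r0 ^+ 3 - r1 * (g`_2 * r0 ^+ 2 - g`_1 * r0 * r1 + g`_0 * r1 ^+ 2))).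
    rewrite def_r1; set v := k^-1%:P in kk *; set kp := k%:P in kk *.
    have -> : - v ^+ 3 * (r0 ^+ 3 - kp * (g`_2 * r0 ^+ 2 - g`_1 * r0 * kp + g`_0 * kp ^+ 2)) =
      - v ^+ 3 * r0 ^+ 3 + (v * kp) * g`_2 * v ^+ 2 * r0 ^+ 2 - (v * kp) ^+ 2 * g`_1 * v * r0 + (v * kp) ^+ 3 * g`_0 by ring.
    by rewrite kk; ring.
  by rewrite Hr subrr mulr0.
(* If Y had degree at least 2, the cube of Y would dominate the other terms of g(Y). *)
have sY : (size Y <= 2)%N.
  rewrite leqNgt; apply/negP => gt2.
  have Yn : Y != 0 by rewrite -size_poly_gt0; apply: leq_trans gt2.
  have : size (Y ^+ 3) = size (- (g`_2 * Y ^+ 2 + g`_1 * Y + g`_0)).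
    by congr (size (polyseq _)); move/eqP: gY; rewrite gE -!addrA addr_eq0 => /eqP ->; rewrite !addrA.
  rewrite size_polyN; apply/eqP; rewrite eqn_leq negb_and -!ltnNge; apply/orP; left.
  have s3 := size_exp Y 3; have s2 := size_exp Y 2.
  have [Y3 Y2] : size (Y ^+ 3) != 0%N /\ size (Y ^+ 2) != 0%N by rewrite !size_poly_eq0 !expf_neq0.
  have a2 := size_polyMleq g`_2 (Y ^+ 2); have a1 := size_polyMleq g`_1 Y.
  have h2 := Hg 2; have h1 := Hg 1%N; have h0 := Hg 0%N.
  apply: leq_ltn_trans (size_polyD _ _) _; rewrite gtn_max; apply/andP; split; last first.
    by apply: leq_ltn_trans h0 _; clear -s3 gt2 Y3; move: (size (Y ^+ 3)) (size Y) s3 gt2 Y3 => A B; lia.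
  apply: leq_ltn_trans (size_polyD _ _) _; rewrite gtn_max; apply/andP; split.
    apply: leq_ltn_trans a2 _; clear -s3 s2 gt2 Y3 Y2 h2.
    move: (size (Y ^+ 3)) (size (Y ^+ 2)) (size Y) (size (g`_2)%R) s3 s2 gt2 Y3 Y2 h2 => A B D E; lia.
  apply: leq_ltn_trans a1 _; clear -s3 gt2 Y3 h1.
  move: (size (Y ^+ 3)) (size Y) (size (g`_1)%R) s3 gt2 Y3 h1 => A B D; lia.
exists (Y`_1, Y`_0); rewrite (_ : aff _ = Y) //; apply/polyP => i.
rewrite /aff coefD coefCM coefX coefC; case: i => [|[|i]] /=; rewrite ?mulr0 ?add0r ?mulr1 ?addr0 //.
by rewrite nth_default //; apply: leq_trans sY _.
Qed.

End Irreducible.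

Section PencilIrreducible.
Variable C : numClosedFieldType.
Implicit Types (l n t : C * C).
Variables (ns ts : seq (C * C)).
Hypotheses (sz_ns : size ns = 3%N) (sz_ts : size ts = 3%N).

(** Concurrence of the lines [l], [t] and [n], parallel lines included. *)
Definition concurrent t n l := (l.1 - t.1) * (l.2 - n.2) = (l.2 - t.2) * (l.1 - n.1).

(** The determinant of the two linear equations on [l] that express its concurrence with
    [t], [n] and with [t'], [n']. *)
Definition sep t t' n n' :=
  (t.2 - n.2) * (n'.1 - t'.1) - (t'.2 - n'.2) * (n.1 - t.1).

Lemma affB l n : aff l - aff n = aff (l.1 - n.1, l.2 - n.2).
Proof. by rewrite /aff !polyCB; ring. Qed.

Lemma tri_aff ls l : (tri ls).[aff l] = \prod_(n <- ls) (aff l - aff n).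
Proof. by rewrite /tri horner_prod; apply: eq_bigr => n _; rewrite /lin hornerXsubC. Qed.

Lemma aff_eq0 a b : (aff (a, b) == 0 :> {poly C}) = (a == 0) && (b == 0).
Proof.
apply/eqP/andP => [e|[/eqP-> /eqP->]]; last by rewrite /aff mul0r addr0.
have := congr1 (fun f : {poly C} => f`_1) e; have := congr1 (fun f : {poly C} => f`_0) e.
rewrite /aff !coefD !coefCM !coefX !coefC /= mulr0 mulr1 add0r addr0.
by move=> -> ->.
Qed.

Lemma tri_aff_eq0 ls l : ((tri ls).[aff l] == 0) = (l \in ls).
Proof.
rewrite tri_aff; apply/idP/idP => [|lin].
  rewrite prodf_seq_eq0 => /hasP[n nin /=].
  rewrite affB aff_eq0 !subr_eq0 => /andP[/eqP e1 /eqP e2].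
  by rewrite (surjective_pairing l) e1 e2 -surjective_pairing.
by rewrite (big_rem l) //= subrr mul0r.
Qed.

(** Where [l] meets [t] the product of the lines of [ts] vanishes, hence so does the
    product of the lines of [ns]. *)
Lemma line_in_pencil l x t : t \in ts -> x != 1 -> (pencil ns ts x).[aff l] = 0 ->
  exists2 n, n \in ns & concurrent t n l.
Proof.
move=> tin x1; rewrite pencilE hornerD !hornerM !hornerC => H.
have [e|nt] := eqVneq l t.
  case: (ns) sz_ns => // n0 s _; exists n0; rewrite ?mem_head //.
  by rewrite /concurrent e !subrr !mul0r.
have H' : (1 - x)%:P * (tri ns).[aff l] = - (x%:P * (tri ts).[aff l]).
  by apply/eqP; rewrite -addr_eq0 H.
have cn0 : (1 - x)%:P != 0 :> {poly C} by rewrite polyC_eq0 subr_eq0 eq_sym.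
have [e1|n1] := eqVneq l.1 t.1.
  have [/hasP[n nin /eqP e]|] := boolP (has (fun n => l.1 == n.1) ns).
    by exists n; rewrite // /concurrent -e -e1 !subrr mul0r mulr0.
  rewrite -all_predC => /allP alln.
  (* Here l is parallel to t. If it were parallel to no line of ns, the two products
     would have degrees 3 and at most 2 on l. *)
  have sz4 : size ((1 - x)%:P * (tri ns).[aff l]) = 4%N.
    rewrite mul_polyC size_scale ?subr_eq0 1?eq_sym // tri_aff.
    have -> : 4%N = (size ns).+1 by rewrite sz_ns.
    elim: (ns) alln => [|n s IH] alln; first by rewrite big_nil size_poly1.
    have ne : l.1 - n.1 != 0 by rewrite subr_eq0; apply: alln (mem_head _ _).
    have sn : size (aff l - aff n) = 2%N.
      rewrite affB /aff /= mul_polyC size_polyDl size_scale ?size_polyX //.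
      by apply: leq_ltn_trans (size_polyC_leq1 _) _.
    rewrite big_cons size_mul ?sn ?IH //.
    - by move=> n' n'in; apply: alln; rewrite in_cons n'in orbT.
    - by rewrite -size_poly_gt0 sn.
    - by rewrite -size_poly_gt0 IH // => n' n'in; apply: alln; rewrite in_cons n'in orbT.
  have: (size ((1 - x)%:P * (tri ns).[aff l])%R <= 3)%N.
    rewrite H' size_polyN mul_polyC; apply: leq_trans (size_scale_leq _ _) _.
    rewrite tri_aff (big_rem t) //=; apply: leq_trans (size_polyMleq _ _) _.
    have s1 : (size (aff l - aff t)%R <= 1)%N.
      by rewrite affB e1 subrr /aff /= mul0r add0r size_polyC_leq1.
    have s2 : (size (\prod_(n <- rem t ts) (aff l - aff n))%R <= (size (rem t ts)).+1)%N.
      elim: (rem t ts) => [|n s IH]; first by rewrite big_nil size_poly1.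
      rewrite big_cons; apply: leq_trans (size_polyMleq _ _) _.
      have := size_aff (l.1 - n.1, l.2 - n.2); rewrite -affB /= => s2.
      by rewrite -subn1 leq_subLR; apply: leq_trans (leq_add s2 IH) _.
    rewrite size_rem // sz_ts in s2.
    by rewrite -subn1 leq_subLR; apply: leq_trans (leq_add s1 s2) _.
  by rewrite sz4.
pose x1' := - ((l.2 - t.2) / (l.1 - t.1)).
have d0 : l.1 - t.1 != 0 by rewrite subr_eq0.
have root_t : (l.1 - t.1) * x1' + (l.2 - t.2) = 0.
  by rewrite /x1' mulrN mulrCA mulfV // mulr1 addNr.
have : ((1 - x)%:P * (tri ns).[aff l]).[x1'] = 0.
  rewrite H' hornerN hornerM tri_aff (big_rem t) //= hornerM affB aff_horner root_t.
  by rewrite mul0r mulr0 oppr0.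
move/eqP; rewrite hornerM hornerC mulf_eq0 subr_eq0 eq_sym (negbTE x1) /= tri_aff.
rewrite horner_prod prodf_seq_eq0 => /hasP[n nin /=].
rewrite affB aff_horner /= => /eqP root_n; exists n => //; rewrite /concurrent.
have -> : l.2 - n.2 = - ((l.1 - n.1) * x1') by apply/eqP; rewrite -addr_eq0 addrC root_n.
have -> : l.2 - t.2 = - ((l.1 - t.1) * x1') by apply/eqP; rewrite -addr_eq0 addrC root_t.
by ring.
Qed.

Lemma concurrent_unique t t' n n' l l' : sep t t' n n' != 0 ->
  concurrent t n l -> concurrent t' n' l -> concurrent t n l' -> concurrent t' n' l' ->
  l = l'.
Proof.
rewrite /concurrent => ne /eqP; rewrite -subr_eq0 => /eqP e1 /eqP; rewrite -subr_eq0 => /eqP e2.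
move=> /eqP; rewrite -subr_eq0 => /eqP e3 /eqP; rewrite -subr_eq0 => /eqP e4.
have E1 : sep t t' n n' * (l.1 - l'.1) = 0.
  transitivity (((l.1 - t.1) * (l.2 - n.2) - (l.2 - t.2) * (l.1 - n.1)
     - ((l'.1 - t.1) * (l'.2 - n.2) - (l'.2 - t.2) * (l'.1 - n.1))) * (n'.1 - t'.1)
    - ((l.1 - t'.1) * (l.2 - n'.2) - (l.2 - t'.2) * (l.1 - n'.1)
     - ((l'.1 - t'.1) * (l'.2 - n'.2) - (l'.2 - t'.2) * (l'.1 - n'.1))) * (n.1 - t.1)).
    by rewrite /sep; ring.
  by rewrite e1 e2 e3 e4; ring.
have E2 : sep t t' n n' * (l.2 - l'.2) = 0.
  transitivity (((l.1 - t'.1) * (l.2 - n'.2) - (l.2 - t'.2) * (l.1 - n'.1)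
     - ((l'.1 - t'.1) * (l'.2 - n'.2) - (l'.2 - t'.2) * (l'.1 - n'.1))) * (t.2 - n.2)
    - ((l.1 - t.1) * (l.2 - n.2) - (l.2 - t.2) * (l.1 - n.1)
     - ((l'.1 - t.1) * (l'.2 - n.2) - (l'.2 - t.2) * (l'.1 - n.1))) * (t'.2 - n'.2)).
    by rewrite /sep; ring.
  by rewrite e1 e2 e3 e4; ring.
move/eqP: E1; rewrite mulf_eq0 (negbTE ne) subr_eq0 => /eqP d1.
move/eqP: E2; rewrite mulf_eq0 (negbTE ne) subr_eq0 => /eqP d2.
by rewrite (surjective_pairing l) d1 d2 -surjective_pairing.
Qed.

(** A line contained in a member of the pencil is concurrent with [t] and a line of [ns],
    and with [t'] and another such line: this leaves finitely many lines, each of which lies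
    in at most one member. *)
Lemma pencil_plane_curve t t' : t \in ts -> t' \in ts ->
    (forall n n', n \in ns -> n' \in ns -> sep t t' n n' != 0) ->
    (forall n, n \in ns -> n \notin ts) ->
  cofinite (fun x => plane_curve 3 (pencil ns ts x)).
Proof.
move=> tin t'in Hsep Hdisj.
pose Q n n' x := x != 1 -> forall l, concurrent t n l -> concurrent t' n' l ->
  (pencil ns ts x).[aff l] <> 0.
have Qcof n : n \in ns -> cofinite (fun x => forall n', n' \in ns -> Q n n' x).
  move=> nin; apply: cofinite_all => n' n'in.
  have [ex|nex] := pselect (exists x0, ~ Q n n' x0); last first.
    by apply: cofiniteT => x; apply: contrapT => nQ; apply: nex; exists x.
  case: ex => x0 /not_implyP[x01] /existsNP[l0] /not_implyP[c0] /not_implyP[c0'] /contrapT p0.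
  apply: cofiniteW (cofinite_neq x0) => x xx0 x1 l cl cl' pl.
  have e := concurrent_unique (Hsep _ _ nin n'in) cl cl' c0 c0'; rewrite -{l0 c0 c0'}e in p0.
  have pB : (tri ts).[aff l] - (tri ns).[aff l] = 0.
    have d0 : (x - x0)%:P != 0 :> {poly C} by rewrite polyC_eq0 subr_eq0.
    have : (x - x0)%:P * ((tri ts).[aff l] - (tri ns).[aff l]) = 0.
      transitivity ((pencil ns ts x).[aff l] - (pencil ns ts x0).[aff l]).
        by rewrite /pencil !hornerE polyCB; ring.
      by rewrite pl p0 subrr.
    by move/eqP; rewrite mulf_eq0 (negbTE d0) => /eqP.
  have z : (tri ns).[aff l] = 0.
    move: pl; rewrite /pencil hornerD hornerM hornerC hornerD hornerN pB mulr0 addr0.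
    by [].
  have lns : l \in ns by rewrite -tri_aff_eq0 z.
  have lts : l \in ts by rewrite -tri_aff_eq0; move/eqP: pB; rewrite subr_eq0 z.
  by have := Hdisj _ lns; rewrite lts.
have := cofiniteI (cofinite_neq 1) (cofinite_all Qcof); apply: cofiniteW => x [x1 HQ].
split; [exact: pencil_monic|exact: size_pencil|exact: tdeg_pencil|].
apply: contrapT => /(cubic_reducible (pencil_monic sz_ns sz_ts x) (size_pencil sz_ns sz_ts x)
  (tdeg_pencil sz_ns sz_ts x)) [l pl].
have [n nin cn] := line_in_pencil tin x1 pl; have [n' n'in cn'] := line_in_pencil t'in x1 pl.
exact: HQ nin n' n'in x1 l cn cn' pl.
Qed.

End PencilIrreducible.

(** * An explicit special position *)

(** A point (x, y), or the line y = a x + b written (a, b). The special position has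
    integral data, so that its incidences and non-incidences are checked by computation. *)
Definition ipair := (int * int)%type.

Definition sides_z : seq ipair := [:: (0, 1); (-1, -7); (1, 1)].

(** Point number i lies on the side of index i modulo 3. *)
Definition q_z (i : nat) : ipair := nth (0, 0)
  [:: (4, 1); (1, -8); (6, 7); (-5, 1); (-6, -1); (-10, -9); (-3, 1); (2, -9)] i.

(** For 3 <= r <= 8, three lines that meet the triangle in the first [r] of the eight points
    and in none of the others: with the triangle they span a pencil of cubics, whose general
    member is smooth at these points. *)
Definition lines_z (r : nat) : seq ipair := nth [::]
  [:: [:: (3, -11); (0, -10); (0, -12)];
      [:: (3, -11); (-4, -19); (0, -12)];
      [:: (3, -11); (-4, -19); (0, -1)];
      [:: (3, -11); (2, 11); (0, -12)];
      [:: (3, -11); (2, 11); (4, 13)];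
      [:: (3, -11); (2, 11); (-2, -5)]] (r - 3).

(** A base point of the same pencil, other than the eight points, on the side y = x + 1. *)
Definition extra_z (r : nat) : ipair := nth (0, 0)
  [:: (-13, -12); (-13, -12); (-2, -1); (-13, -12); (-4, -3); (-2, -1)] (r - 3).

(** Base points of the pencils of lines of kinds 0, 1, 2: a point of the side y = x + 1,
    then the first two of the eight points. *)
Definition base_z (r : nat) : ipair := nth (0, 0) [:: (-2, -1); (4, 1); (1, -8)] r.

Definition ev_z (l p : ipair) : int := p.2 - (l.1 * p.1 + l.2).

Fixpoint tri_z (ls : seq ipair) p : int :=
  if ls is l :: ls' then ev_z l p * tri_z ls' p else 1.

Fixpoint dtri_z (ls : seq ipair) p : int :=
  if ls is l :: ls' then tri_z ls' p + ev_z l p * dtri_z ls' p else 0.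

Definition sep_z (t t' n n' : ipair) : int :=
  (t.2 - n.2) * (n'.1 - t'.1) - (t'.2 - n'.2) * (n.1 - t.1).

(** Besides the sides there are nine kinds of components: lines through none of the eight
    points (kind 0), through the first (kind 1) or the second (kind 2), and cubics through
    exactly the first r (kinds 3 to 8). *)
Definition kmu (r i : nat) : bool :=
  if r is r'.+1 then if (r <= 2)%N then i == r' else (i < r)%N else false.

Definition kdg (r : nat) : nat := if (r < 3)%N then 1 else 3.

Definition smu (t i : nat) : bool := (i %% 3 == t)%N.

Section Explicit.
Variable C : numClosedFieldType.

Definition toC (p : ipair) : C * C := (p.1%:~R, p.2%:~R).

Definition base_q (i : nat) : C * C := toC (q_z i).

Local Notation q := base_q.

Definition side (t : nat) : C * C := toC (nth (0, 0) sides_z t).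

Definition side_comp t := Component (lin (side t)) 1 (smu t).

(** Kinds 0, 1, 2 are parametrized by the slope of the line, the others by the member of
    the pencil. *)
Definition kind_eqn r (x : C) : {poly {poly C}} :=
  if (r < 3)%N then lin (x, (toC (base_z r)).2 - x * (toC (base_z r)).1)
  else pencil (map toC (lines_z r)) (map toC sides_z) x.

Definition kind_comp r x := Component (kind_eqn r x) (kdg r) (kmu r).

Lemma toC_inj : injective toC.
Proof. by move=> [a b] [a' b'] [] /intr_inj -> /intr_inj ->. Qed.

Lemma ev_lin_z l p : ev (lin (toC l)) (toC p) = (ev_z l p)%:~R.
Proof. by rewrite ev_lin /ev_z /= intrB intrD intrM. Qed.

Lemma ev_tri_z ls p : ev (tri (map toC ls)) (toC p) = (tri_z ls p)%:~R.
Proof.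
rewrite /tri; elim: ls => [|l ls IH] /=; first by rewrite big_nil ev1.
by rewrite big_cons evM ev_lin_z IH intrM.
Qed.

Lemma ev_dtri_z ls p : ev (tri (map toC ls))^`() (toC p) = (dtri_z ls p)%:~R.
Proof.
rewrite /tri; elim: ls => [|l ls IH] /=; first by rewrite big_nil derivC ev0.
rewrite big_cons derivM deriv_lin mul1r evD evM ev_lin_z IH -/(tri _) ev_tri_z.
by rewrite intrD intrM.
Qed.

Lemma sep_toC t t' n n' : sep (toC t) (toC t') (toC n) (toC n') = (sep_z t t' n n')%:~R.
Proof. by rewrite /sep /sep_z /= !(rmorphB, rmorphM). Qed.

Lemma forall_lt N (P : pred nat) : all P (iota 0 N) -> forall i, (i < N)%N -> P i.
Proof. by move=> /allP H i lti; apply: H; rewrite mem_iota. Qed.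

Lemma base_q_inj i j : (i < 8)%N -> (j < 8)%N -> (q i).1 = (q j).1 -> i = j.
Proof.
move=> lti ltj /intr_inj e; apply/eqP; move/eqP: e; apply/implyP.
have H : all (fun i => all (fun j => ((q_z i).1 == (q_z j).1) ==> (i == j)) (iota 0 8)) (iota 0 8) by [].
by have := forall_lt (forall_lt H lti) ltj.
Qed.

Lemma side_comp_good t : (t < 3)%N -> good_comp q (side_comp t).
Proof.
move=> ltt; split=> [|i lti /=]; first exact: plane_curve_lin.
rewrite /smooth_at deriv_lin ev1 oner_eq0 andbT /side /base_q ev_lin_z intr_eq0.
have H : all (fun t => all (fun i => if smu t i then ev_z (nth (0, 0) sides_z t) (q_z i) == 0
  else ev_z (nth (0, 0) sides_z t) (q_z i) != 0) (iota 0 8)) (iota 0 3) by [].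
by have := forall_lt (forall_lt H ltt) lti.
Qed.

(** A point of the triangle on [c] besides the [q i], as required by [total_eqn_dvd]. *)
Definition has_extra (c : component C) := exists s, [/\ off_q q s, smooth_at (eqn c) s &
  exists2 t, (t < 3)%N & ev (eqn (side_comp t)) s = 0].

Lemma off_q_z p : all (fun i => p.1 != (q_z i).1) (iota 0 8) -> off_q q (toC p).
Proof. by move=> H i lti; rewrite /= eqr_int; have := forall_lt H lti. Qed.

Lemma cofinite_ev_line (r : nat) p : p.1 != (toC (base_z r)).1 ->
  cofinite (fun x => ev (lin (x, (toC (base_z r)).2 - x * (toC (base_z r)).1)) p != 0).
Proof.
move=> ne; have : cofinite (fun x => p.2 - (toC (base_z r)).2 + x * ((toC (base_z r)).1 - p.1) != 0).
  by apply/cofinite_affine/orP; right; rewrite subr_eq0 eq_sym.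
by apply: cofiniteW => x; rewrite ev_lin (_ : _ + _ * _ = p.2 - (x * p.1 + ((toC (base_z r)).2 - x * (toC (base_z r)).1))) //; ring.
Qed.

Lemma line_kind_good r : (r < 3)%N ->
  cofinite (fun x => good_comp q (kind_comp r x) /\ has_extra (kind_comp r x)).
Proof.
move=> ltr; rewrite /kind_comp /kind_eqn /kdg ltr; apply: cofiniteI.
  have : cofinite (fun x => forall i, i \in iota 0 8 -> ~~ kmu r i ->
      ev (lin (x, (toC (base_z r)).2 - x * (toC (base_z r)).1)) (q i) != 0).
    apply: cofinite_all => i; rewrite mem_iota => /= lti.
    have [m|nm] := boolP (kmu r i); first exact: cofiniteT.
    apply: cofiniteW (cofinite_ev_line (r := r) (p := q i) _) => //.
    rewrite /= eqr_int; apply: contra nm; apply/implyP.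
    have H : all (fun r => all (fun i => ((q_z i).1 == (base_z r).1) ==> kmu r i) (iota 0 8)) (iota 0 3) by [].
    by have := forall_lt (forall_lt H ltr) lti.
  apply: cofiniteW => x Hx; split=> [|i lti /=]; first exact: plane_curve_lin.
  have [m|nm] := boolP (kmu r i); last by apply: Hx; rewrite ?mem_iota.
  have -> : q i = toC (base_z r).
    congr toC; apply/eqP; move: m; apply/implyP.
    have H : all (fun r => all (fun i => kmu r i ==> (q_z i == base_z r)) (iota 0 8)) (iota 0 3) by [].
    by have := forall_lt (forall_lt H ltr) lti.
  by rewrite /smooth_at deriv_lin ev1 oner_eq0 ev_lin /= [x * _ + _]addrC subrK subrr eqxx.
have [r0|rn0] := posnP r.
  apply: cofiniteT => x; exists (toC (base_z r)); rewrite r0 /=; split.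
  - exact: off_q_z.
  - by rewrite /smooth_at deriv_lin ev1 oner_eq0 ev_lin /= [x * _ + _]addrC subrK subrr eqxx.
  - by exists 2%N; rewrite // /side ev_lin_z.
pose b := toC (base_z r).
have : cofinite (fun x => x != 1 /\ forall i, i \in iota 0 8 ->
   (b.2 - 1 - (q i).1) + x * ((q i).1 - b.1) != 0).
  apply: cofiniteI; first exact: cofinite_neq.
  apply: cofinite_all => i; rewrite mem_iota => /= lti; apply: cofinite_affine.
  have -> : (b.2 - 1 - (q i).1 = ((base_z r).2 - 1 - (q_z i).1)%:~R :> C) by rewrite !rmorphB.
  have -> : ((q i).1 - b.1 = ((q_z i).1 - (base_z r).1)%:~R :> C) by rewrite rmorphB.
  rewrite !intr_eq0.
  have H : all (fun r => all (fun i => ((base_z r.+1).2 - 1 - (q_z i).1 != 0) || ((q_z i).1 - (base_z r.+1).1 != 0)) (iota 0 8)) (iota 0 2) by [].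
  by case: (r) rn0 ltr => // r' _ ltr'; have := forall_lt (forall_lt H (ltr' : (r' < 2)%N)) lti.
apply: cofiniteW => x [x1 Hx].
have nx : 1 - x != 0 by rewrite subr_eq0 eq_sym.
(* sx is the abscissa of the point where the line of slope x through b meets the side
   y = x + 1. *)
pose sx := (b.2 - 1 - x * b.1) / (1 - x); exists (sx, sx + 1); split.
- move=> i lti /=; have := Hx i; rewrite mem_iota => /(_ lti); apply: contra => /eqP e.
  have : sx * (1 - x) = b.2 - 1 - x * b.1 by rewrite divfK.
  rewrite e => e'.
  have -> : b.2 - 1 - (q i).1 + x * ((q i).1 - b.1) =
    b.2 - 1 - x * b.1 - (q i).1 * (1 - x) by ring.
  by rewrite e' subrr.
- rewrite /smooth_at deriv_lin ev1 oner_eq0 ev_lin andbT; apply/eqP.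
  change (sx + 1 - (x * sx + (b.2 - x * b.1)) = 0).
  have e : sx * (1 - x) = b.2 - 1 - x * b.1 by rewrite divfK.
  by transitivity (sx * (1 - x) - (b.2 - 1 - x * b.1)); [ring|rewrite e subrr].
- by exists 2%N; rewrite // /side ev_lin /= mul1r subrr.
Qed.

Lemma cofinite_pencil_smooth ns ts p : size ns = 3%N -> size ts = 3%N ->
  ev (tri ns) p = 0 -> ev (tri ts) p = 0 -> ev (tri ns)^`() p != 0 ->
  cofinite (fun x : C => smooth_at (pencil ns ts x) p).
Proof.
move=> sn st n0 t0 dn.
have := @cofinite_affine C (ev (tri ns)^`() p) (ev (tri ts)^`() p - ev (tri ns)^`() p).
rewrite dn => /(_ isT); apply: cofiniteW => x Hx.
rewrite /smooth_at ev_pencil n0 t0 !mulr0 addr0 eqxx /= /pencil derivD derivM derivC.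
by rewrite mul0r add0r evD evM evC derivB evD evN.
Qed.

Lemma cubic_kind_good r : (3 <= r)%N -> (r < 9)%N ->
  cofinite (fun x => good_comp q (kind_comp r x) /\ has_extra (kind_comp r x)).
Proof.
move=> ger ltr; have nr3 : (r < 3)%N = false by rewrite ltnNge ger.
rewrite /kind_comp /kind_eqn /kdg nr3.
have chk (P : pred nat) : all P (iota 3 6) -> P r.
  by move/allP; apply; rewrite mem_iota ger.
have szn : size (map toC (lines_z r)) = 3%N.
  by rewrite size_map; apply/eqP; apply: (chk (fun r => size (lines_z r) == 3%N)).
have szt : size (map toC sides_z) = 3%N by rewrite size_map.
have c_plane : cofinite (fun x => plane_curve 3 (pencil (map toC (lines_z r)) (map toC sides_z) x)).
  apply: (@pencil_plane_curve _ _ _ szn szt (toC (0, 1)) (toC (-1, -7))).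
  - by apply: map_f.
  - by apply: map_f.
  - move=> n n' /mapP[z zin ->] /mapP[z' zin' ->]; rewrite sep_toC intr_eq0.
    have := chk (fun r => all (fun z => all (fun z' => sep_z (0, 1) (-1, -7) z z' != 0) (lines_z r)) (lines_z r)) isT.
    by move/allP/(_ z zin)/allP/(_ z' zin').
  - move=> n /mapP[z zin ->]; rewrite mem_map; last exact: toC_inj.
    by have := chk (fun r => all (fun z => z \notin sides_z) (lines_z r)) isT => /allP/(_ z zin).
have c_q : cofinite (fun x => forall i, i \in iota 0 8 ->
    if kmu r i then smooth_at (pencil (map toC (lines_z r)) (map toC sides_z) x) (q i)
    else ev (pencil (map toC (lines_z r)) (map toC sides_z) x) (q i) != 0).
  apply: cofinite_all => i iin; have [m|nm] := boolP (kmu r i).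
    have : [&& tri_z (lines_z r) (q_z i) == 0, tri_z sides_z (q_z i) == 0 & dtri_z (lines_z r) (q_z i) != 0].
      move: m; apply/implyP.
      have := chk (fun r => all (fun i => kmu r i ==> [&& tri_z (lines_z r) (q_z i) == 0, tri_z sides_z (q_z i) == 0 & dtri_z (lines_z r) (q_z i) != 0]) (iota 0 8)) isT.
      by move/allP/(_ i iin).
    case/and3P=> /eqP h1 /eqP h2 h3; apply: cofinite_pencil_smooth => //.
    - by rewrite ev_tri_z h1.
    - by rewrite ev_tri_z h2.
    - by rewrite ev_dtri_z intr_eq0.
  have h : tri_z (lines_z r) (q_z i) != 0.
    move: nm; apply/implyP.
    have := chk (fun r => all (fun i => ~~ kmu r i ==> (tri_z (lines_z r) (q_z i) != 0)) (iota 0 8)) isT.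
    by move/allP/(_ i iin).
  have := @cofinite_affine C (ev (tri (map toC (lines_z r))) (q i))
    (ev (tri (map toC sides_z)) (q i) - ev (tri (map toC (lines_z r))) (q i)).
  rewrite {1}ev_tri_z intr_eq0 h => /(_ isT); apply: cofiniteW => x.
  by rewrite /pencil evD evM evC evD evN.
have c_s : cofinite (fun x => smooth_at (pencil (map toC (lines_z r)) (map toC sides_z) x) (toC (extra_z r))).
  have /and3P[/eqP h1 /eqP h2 h3] := chk (fun r => [&& tri_z (lines_z r) (extra_z r) == 0, tri_z sides_z (extra_z r) == 0 & dtri_z (lines_z r) (extra_z r) != 0]) isT.
  by apply: cofinite_pencil_smooth; rewrite // ?ev_tri_z ?h1 ?h2 // ev_dtri_z intr_eq0.
apply: cofiniteW (cofiniteI c_plane (cofiniteI c_q c_s)) => x [Hp [Hq Hs]]; split.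
  by split=> // i lti; apply: Hq; rewrite mem_iota.
exists (toC (extra_z r)); split=> //.
  by apply: off_q_z; apply: (chk (fun r => all (fun i => (extra_z r).1 != (q_z i).1) (iota 0 8))).
exists 2%N; rewrite // /side /= ev_lin_z.
by have /eqP -> := chk (fun r => ev_z (1, 1) (extra_z r) == 0) isT.
Qed.

Lemma kinds_good : exists bad : seq C, forall r x, (r < 9)%N -> x \notin bad ->
  good_comp q (kind_comp r x) /\ has_extra (kind_comp r x).
Proof.
have [bad H] : cofinite (fun x => forall r, r \in iota 0 9 ->
    good_comp q (kind_comp r x) /\ has_extra (kind_comp r x)).
  apply: cofinite_all => r; rewrite mem_iota => /= ltr.
  by have [lt3|ge3] := ltnP r 3; [apply: line_kind_good|apply: cubic_kind_good].
by exists bad => r x ltr /H; apply; rewrite mem_iota.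
Qed.

Lemma good_comp_mu (c : component C) i : good_comp q c -> (i < 8)%N -> mu c i = (ev (eqn c) (q i) == 0).
Proof. by case=> _ H /H; case: (mu c i) => [/andP[->]|/negbTE->]. Qed.

Lemma same_eqn_mu (c c' : component C) : good_comp q c -> good_comp q c' -> eqn c = eqn c' ->
  all (fun i => mu c i == mu c' i) (iota 0 8).
Proof.
move=> gc gc' e; apply/allP => i; rewrite mem_iota => /= lti.
by rewrite !good_comp_mu // e.
Qed.

(** The kind is recovered from the points [q i] on the curve, then the parameter from the
    equation. *)
Lemma kind_comp_inj r r' x x' : (r < 9)%N -> (r' < 9)%N ->
    good_comp q (kind_comp r x) -> good_comp q (kind_comp r' x') ->
  kind_eqn r x = kind_eqn r' x' -> r = r' /\ x = x'.
Proof.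
move=> ltr ltr' g g' e; have /= := same_eqn_mu g g' e => Hmu.
have er : r = r'.
  have H : all (fun r => all (fun r' => all (fun i => kmu r i == kmu r' i) (iota 0 8) ==> (r == r')) (iota 0 9)) (iota 0 9) by [].
  by apply/eqP; have := forall_lt (forall_lt H ltr) ltr' => /implyP; apply.
split=> //; rewrite -er in e; move: e; rewrite /kind_eqn; case: ltnP => ger.
  by move=> /(congr1 (fun f => - f + 'X)); rewrite /lin !opprB !subrK => /polyC_inj/(congr1 (fun f : {poly C} => f`_1)); rewrite /aff /= !coefD !coefCM !coefX !coefC /= !mulr1 !addr0.
(* (-8, 1) is a vertex of the triangle, on none of the lines of lines_z r: the value at
   this point determines the member of the pencil. *)
move=> e; have := congr1 (fun f => ev f (toC (-8, 1))) e.
rewrite /pencil !evD !evM !evC !evD !evN !ev_tri_z => /addrI/eqP.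
have H : tri_z sides_z (-8, 1) = 0 by [].
rewrite H sub0r -subr_eq0 -mulrBl mulf_eq0 oppr_eq0 intr_eq0 subr_eq0.
have /negbTE -> : tri_z (lines_z r) (-8, 1) != 0.
  have := allP (isT : all (fun r => tri_z (lines_z r) (-8, 1) != 0) (iota 3 6)) r.
  by apply; rewrite mem_iota ger.
by rewrite orbF => /eqP.
Qed.

Lemma side_kind_neq t r x : (t < 3)%N -> (r < 9)%N -> good_comp q (kind_comp r x) ->
  eqn (side_comp t) <> kind_eqn r x.
Proof.
move=> ltt ltr g e; have /= := same_eqn_mu (side_comp_good ltt) g e.
have H : all (fun t => all (fun r => ~~ all (fun i => smu t i == kmu r i) (iota 0 8)) (iota 0 9)) (iota 0 3) by [].
by apply/negP; have := forall_lt (forall_lt H ltt) ltr.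
Qed.

Lemma side_comp_inj t t' : (t < 3)%N -> (t' < 3)%N ->
  eqn (side_comp t) = eqn (side_comp t') -> t = t'.
Proof.
move=> ltt ltt' e; have /= := same_eqn_mu (side_comp_good ltt) (side_comp_good ltt') e.
have H : all (fun t => all (fun t' => all (fun i => smu t i == smu t' i) (iota 0 8) ==> (t == t')) (iota 0 3)) (iota 0 3) by [].
by have /implyP h := forall_lt (forall_lt H ltt) ltt' => /h/eqP.
Qed.

End Explicit.

(** * Dimension of the classes in special position *)

Section Dimension.
Variable C : numClosedFieldType.

Lemma dim_le_le (q : nat -> C * C) e R N N' : (N <= N')%N -> dim_le q e R N -> dim_le q e R N'.
Proof.
move=> le HN Gs HG.
have [|u u0 Hu] := HN (fun a => Gs (widen_ord (le : (N.+1 <= N'.+1)%N) a)); first by move=> a; apply: HG.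
exists (u *m pid_mx N.+1).
  have free : row_free (pid_mx N.+1 : 'M[C]_(N.+1, N'.+1)).
    by rewrite /row_free rank_pid_mx.
  by apply: contra u0; rewrite -(inj_eq (row_free_inj free)) mul0mx.
rewrite -comb_comb -[RHS]Hu; apply: eq_bigr => b _; congr (_ * _).
rewrite /comb (bigD1 (widen_ord (le : (N.+1 <= N'.+1)%N) b)) //= !mxE /= eqxx ltn_ord /=.
rewrite mul1r big1 ?addr0 // => a ne; rewrite !mxE.
have -> : (b == a :> nat) = false by apply: contraNF ne => /eqP e'; apply/eqP/val_inj.
by rewrite mul0r.
Qed.

Definition kinds_dg (ks : seq nat) : nat := \sum_(r <- ks) kdg r.
Definition kinds_mu (ks : seq nat) (i : nat) : nat := \sum_(r <- ks) kmu r i.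

(** By additivity two kinds are compared at a time, which is a finite table. *)
Lemma kinds_nef ks r : (r < 9)%N -> all (fun r => (r < 9)%N) ks ->
  (\sum_(0 <= i < 8) kmu r i * kinds_mu ks i <= kdg r * kinds_dg ks)%N.
Proof.
move=> ltr /allP Hks; rewrite /kinds_mu /kinds_dg.
under eq_bigr do rewrite big_distrr; rewrite exchange_big big_distrr /=.
rewrite big_seq [leqRHS]big_seq; apply: leq_sum => s sin.
have H : all (fun r => all (fun s => \sum_(0 <= i < 8) kmu r i * kmu s i <= kdg r * kdg s)%N (iota 0 9)) (iota 0 9).
  by rewrite unlock.
by have := forall_lt (forall_lt H ltr) (Hks s sin).
Qed.

Lemma sum8 (f : nat -> nat) : (\sum_(0 <= i < 8) f i =
  f 0 + f 1 + f 2 + f 3 + f 4 + f 5 + f 6 + f 7)%N.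
Proof. by rewrite unlock /= addn0 !addnA. Qed.

Lemma dim_le_step c e e' R R' N N' K : good_comp (@base_q C) c -> dim_le (@base_q C) e R N ->
    e' = (e + dg c)%N -> (forall i, R' i = (mu c i + R i)%N) ->
    (dg c * e' < inc c R' + K)%N -> (N + K <= N')%N ->
  dim_le (@base_q C) e' R' N'.
Proof.
move=> gc HN -> eR HK le; apply: (dim_le_le le).
apply: (@dim_le_ext C (@base_q C) _ _ (fun i => mu c i + R i)%N _ _ erefl (fun i _ => esym (eR i))).
apply: (dim_le_add (@base_q_inj C) gc HN); move: HK; rewrite /inc.
by under eq_bigr do rewrite eR.
Qed.

(** The triangle is peeled off one side after the other; each adds one plus the degree of
    the class on that side at that stage. *)
Lemma dim_le_sides e R N : (R 2 + R 5 <= e)%N -> (R 1 + R 4 + R 7 <= e)%N ->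
    (R 0 + R 3 + R 6 <= e.+1)%N -> dim_le (@base_q C) e R N ->
  dim_le (@base_q C) (e + 3) (fun i => (R i).+1)
    (N + (e - (R 2 + R 5)) + (e - (R 1 + R 4 + R 7)) + (e.+1 - (R 0 + R 3 + R 6)))%N.
Proof.
move=> h2 h1 h0 HN.
have s2 : dim_le (@base_q C) (e + 1) (fun i => smu 2 i + R i)%N (N + (e - (R 2 + R 5)))%N.
  apply: (dim_le_step (side_comp_good C (isT : (2 < 3)%N)) HN) => //.
  by rewrite /inc sum8 /=; lia.
have s1 : dim_le (@base_q C) (e + 2) (fun i => smu 1 i + (smu 2 i + R i))%N
    (N + (e - (R 2 + R 5)) + (e - (R 1 + R 4 + R 7)))%N.
  apply: (dim_le_step (side_comp_good C (isT : (1 < 3)%N)) s2) => //; first by rewrite -addnA.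
  by rewrite /inc sum8 /=; lia.
apply: (dim_le_step (side_comp_good C (isT : (0 < 3)%N)) s1 _ _ _ (leqnn _)).
- by rewrite -addnA.
- move=> i /=; rewrite /smu; have := ltn_pmod i (isT : (0 < 3)%N).
  by case: (i %% 3)%N => [|[|[|]]].
- by rewrite /inc sum8 /=; lia.
Qed.

(** The bound is R.R + R.T, for R the class of the sum and T the triangle. Adding a
    component A increases it by 2 A.R + A.A + A.T, and the dimension by at most
    1 + A.R + A.A; the difference is nonnegative because A.R >= 0 and A.T >= 1. *)
Lemma dim_kinds (bad : seq C) ks :
    (forall r x, (r < 9)%N -> x \notin bad -> good_comp (@base_q C) (kind_comp r x)) ->
    (0 < size ks)%N -> all (fun r => (r < 9)%N) ks ->
  exists N, dim_le (@base_q C) (kinds_dg ks) (kinds_mu ks) N /\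
    (N + \sum_(0 <= i < 8) kinds_mu ks i ^ 2 + \sum_(0 <= i < 8) kinds_mu ks i
     <= kinds_dg ks ^ 2 + 3 * kinds_dg ks)%N.
Proof.
move=> gk; have [x xb] := avoid_seq bad.
elim: ks => // r ks IH _ /= /andP[ltr Hks].
have gr := gk r x ltr xb.
have dgE : kinds_dg (r :: ks) = (kinds_dg ks + kdg r)%N by rewrite /kinds_dg big_cons addnC.
have muE i : kinds_mu (r :: ks) i = (kmu r i + kinds_mu ks i)%N.
  by rewrite /kinds_mu big_cons.
have mu0 i : kinds_mu [::] i = 0%N by rewrite /kinds_mu big_nil.
have dg0 : kinds_dg [::] = 0%N by rewrite /kinds_dg big_nil.
have z1 : dim_le (@base_q C) (kinds_dg [::]) (kinds_mu [::]) 1.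
  by apply: (@dim_le_ext C (@base_q C) 0 _ (fun=> 0%N) _ _ (esym dg0)) => [i _|]; [rewrite mu0|apply: dim_le0].
case: ks IH Hks dgE muE => [_ _|r' ks IH Hks] dgE muE.
  have mu1 i : kinds_mu [:: r] i = kmu r i by rewrite muE mu0 addn0.
  have dg1 : kinds_dg [:: r] = kdg r by rewrite dgE dg0.
  (* For the cubics through all eight points the restriction to a component gives 3, one
     too many, since a plane cubic carries a single section of degree one. Peeling off
     the sides of the triangle gives 2, the dimension of the pencil. *)
  have [r8|rn8] := eqVneq r 8%N.
    exists 2%N; split; last by rewrite !sum8 dg1 !mu1 r8.
    have := @dim_le_sides _ (kinds_mu [::]) 1 _ _ _ z1; rewrite !mu0 dg0 => /(_ isT isT isT).
    apply: dim_le_ext => [|i lti]; first by rewrite dg1 r8.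
    by rewrite mu0 mu1 r8 /= lti.
  exists (1 + (kdg r * kdg r + 1 - \sum_(0 <= i < 8) kmu r i))%N; split.
    apply: (dim_le_step gr z1 dgE muE _ (leqnn _)); rewrite dg1 /inc /=.
    under eq_bigr do rewrite mu1.
    have H : all (fun r => kdg r * kdg r < \sum_(0 <= i < 8) kmu r i * kmu r i + (kdg r * kdg r + 1 - \sum_(0 <= i < 8) kmu r i))%N (iota 0 9).
      by rewrite unlock.
    exact: (forall_lt H ltr).
  rewrite dg1 !sum8 !mu1.
  have H : all (fun r => (r != 8) ==> (1 + (kdg r * kdg r + 1 - \sum_(0 <= i < 8) kmu r i) + \sum_(0 <= i < 8) kmu r i ^ 2 + \sum_(0 <= i < 8) kmu r i <= kdg r ^ 2 + 3 * kdg r))%N (iota 0 9).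
    by rewrite unlock.
  by have := forall_lt H ltr; rewrite rn8 /= !sum8.
have [//|N [HN leN]] := IH isT.
set e := kinds_dg (r' :: ks) in dgE HN leN *; set R := kinds_mu (r' :: ks) in muE HN leN *.
have nef : (\sum_(0 <= i < 8) kmu r i * R i <= kdg r * e)%N by apply: kinds_nef.
have cR : (\sum_(0 <= i < 8) kmu r i + 1 <= 3 * kdg r)%N.
  have H : all (fun r => \sum_(0 <= i < 8) kmu r i + 1 <= 3 * kdg r)%N (iota 0 9) by rewrite unlock.
  exact: (forall_lt H ltr).
have cR' : (\sum_(0 <= i < 8) kmu r i <= kdg r * kdg r + 1)%N.
  have H : all (fun r => \sum_(0 <= i < 8) kmu r i <= kdg r * kdg r + 1)%N (iota 0 9) by rewrite unlock.
  exact: (forall_lt H ltr).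
have incE : inc (kind_comp r x) (kinds_mu [:: r, r' & ks]) =
    (\sum_(0 <= i < 8) kmu r i + \sum_(0 <= i < 8) kmu r i * R i)%N.
  rewrite /inc -big_split; apply: eq_bigr => i _ /=; rewrite muE mulnDr.
  by congr (_ + _)%N; case: (kmu r i).
pose K := (kdg r * (e + kdg r) + 1 - inc (kind_comp r x) (kinds_mu [:: r, r' & ks]))%N.
exists (N + K)%N; split.
  apply: (dim_le_step gr HN dgE muE _ (leqnn _)); rewrite dgE /K /=.
  by move: (inc _ _) (kdg r * (e + kdg r))%N => a b; clear; lia.
have sqE : (\sum_(0 <= i < 8) kinds_mu [:: r, r' & ks] i ^ 2 =
   \sum_(0 <= i < 8) kmu r i + 2 * (\sum_(0 <= i < 8) kmu r i * R i) + \sum_(0 <= i < 8) R i ^ 2)%N.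
  rewrite big_distrr -!big_split; apply: eq_bigr => i _ /=; rewrite muE.
  by case: (kmu r i); rewrite sqrnD ?mul1n ?mul0n //; lia.
have lnE : (\sum_(0 <= i < 8) kinds_mu [:: r, r' & ks] i =
   \sum_(0 <= i < 8) kmu r i + \sum_(0 <= i < 8) R i)%N.
  by rewrite -big_split; apply: eq_bigr => i _ /=; rewrite muE.
rewrite sqE lnE dgE /K incE.
move: nef cR cR' leN; move: (\sum_(0 <= i < 8) kmu r i)%N (\sum_(0 <= i < 8) _ * _)%N (\sum_(0 <= i < 8) R i)%N (\sum_(0 <= i < 8) _ ^ 2)%N => a b c f.
move: (kdg r) => g; clear; nia.
Qed.

End Dimension.

(** * The special curve and its marked points *)

Section Multiset.
Variables (d : nat) (m : nat -> nat).

(** The coefficients of the class (d; m) minus the triangle on the nine kinds. *)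
Definition kind_count (r : nat) : nat := nth 0%N
  [:: d - (m 0 + m 1 + m 2); m 0 - m 2; m 1 - m 2; m 2 - m 3; m 3 - m 4; m 4 - m 5;
      m 5 - m 6; m 6 - m 7; (m 7).-1]%N r.

Definition kinds : seq nat := flatten [seq nseq (kind_count r) r | r <- iota 0 9].

Lemma sum_kinds (f : nat -> nat) :
  (\sum_(r <- kinds) f r = \sum_(0 <= r < 9) kind_count r * f r)%N.
Proof.
rewrite /kinds big_flatten big_map /index_iota subn0; apply: eq_bigr => r _.
by rewrite big_nseq iter_addn_0 mulnC.
Qed.

Lemma kinds_lt9 : all (fun r => (r < 9)%N) kinds.
Proof.
apply/allP => r /flattenP[s /mapP[r' + ->]]; rewrite mem_iota => /= lt.
by rewrite mem_nseq => /andP[_ /eqP->].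
Qed.

Hypothesis m_noninc : forall i j, (i <= j)%N -> (j < 8)%N -> (m j <= m i)%N.
Hypothesis m7 : (0 < m 7)%N.
Hypothesis cremona : (m 0 + m 1 + m 2 <= d)%N.

Lemma m_chain : [/\ (m 1 <= m 0)%N, (m 2 <= m 1)%N, (m 3 <= m 2)%N, (m 4 <= m 3)%N
  & [/\ (m 5 <= m 4)%N, (m 6 <= m 5)%N & (m 7 <= m 6)%N]].
Proof. by do ![split]; apply: m_noninc. Qed.

Lemma kinds_dgE : (kinds_dg kinds + 3 = d)%N.
Proof.
rewrite /kinds_dg sum_kinds unlock /= /kind_count /kdg /=.
by have [h1 h2 h3 h4 [h5 h6 h7]] := m_chain; move: m7 cremona; lia.
Qed.

Lemma kinds_muE i : (i < 8)%N -> (kinds_mu kinds i).+1 = m i.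
Proof.
have [h1 h2 h3 h4 [h5 h6 h7]] := m_chain; move: m7.
rewrite /kinds_mu sum_kinds unlock /= /kind_count.
by case: i => [|[|[|[|[|[|[|[|//]]]]]]]] _ /=; lia.
Qed.

Lemma kinds_nonempty : (3 < d)%N -> (0 < size kinds)%N.
Proof.
have := kinds_dgE; rewrite /kinds_dg; case: (kinds) => //.
by rewrite big_nil => <-.
Qed.

Lemma kind_inc_le (C : numClosedFieldType) r (x : C) : (r < 9)%N ->
  (inc (kind_comp r x) m <= kdg r * d)%N.
Proof.
have [h1 h2 h3 h4 [h5 h6 h7]] := m_chain; move: cremona.
rewrite /inc sum8 /kdg.
by case: r => [|[|[|[|[|[|[|[|[|//]]]]]]]]] + _ /=; lia.
Qed.

Lemma side_inc_le (C : numClosedFieldType) t : (t < 3)%N ->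
  (inc (side_comp C t) m <= 1 * d)%N /\ (inc (side_comp C 2) m < d)%N.
Proof.
have [h1 h2 h3 h4 [h5 h6 h7]] := m_chain; move: cremona m7.
rewrite /inc !sum8; case: t => [|[|[|//]]] + _ /=; lia.
Qed.

End Multiset.

Section Special.
Variable C : numClosedFieldType.
Variables (d k : nat) (m : nat -> nat).
Hypothesis m_noninc : forall i j, (i <= j)%N -> (j < 8)%N -> (m j <= m i)%N.
Hypothesis m7 : (0 < m 7)%N.
Hypothesis cremona : (m 0 + m 1 + m 2 <= d)%N.
Hypothesis d_gt3 : (3 < d)%N.

Local Notation ks := (kinds d m).
Local Notation q := (@base_q C).

Lemma distinct_avoiding (bad : seq C) N : exists xs : seq C,
  [/\ size xs = N, uniq xs & forall x, x \in xs -> x \notin bad].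
Proof.
elim: N => [|N [xs [sx ux Hx]]]; first by exists [::].
have [x] := avoid_seq (xs ++ bad); rewrite mem_cat negb_or => /andP[xn xb].
exists (x :: xs); split=> /=; rewrite ?sx ?xn // => y.
by rewrite in_cons => /predU1P[->|/Hx].
Qed.

(** The parameters are pairwise distinct, so that no component is repeated. *)
Lemma components : exists (n : nat) (cc : nat -> component C),
  [/\ n = (size ks + 3)%N,
      forall i, (i < n)%N -> good_comp q (cc i),
      forall i j, (i < n)%N -> (j < n)%N -> eqn (cc i) = eqn (cc j) -> i = j,
      forall t, (t < 3)%N -> cc t = side_comp C t &
    [/\ forall i, (i < size ks)%N -> has_extra (cc (i + 3)%N),
        forall i, (i < n)%N -> (inc (cc i) m <= dg (cc i) * d)%N,
        (\sum_(i < n) dg (cc i) = d)%N &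
        forall j, (j < 8)%N -> (\sum_(i < n) mu (cc i) j = m j)%N]].
Proof.
have [bad Hbad] := kinds_good C.
have [xs [sx ux Hx]] := distinct_avoiding bad (size ks).
pose kc i := kind_comp (nth 0%N ks i) (nth 0 xs i).
have kr i : (i < size ks)%N -> (nth 0%N ks i < 9)%N.
  by move=> lt; apply: (allP (kinds_lt9 d m)); apply: mem_nth.
have kg i : (i < size ks)%N -> good_comp q (kc i) /\ has_extra (kc i).
  by move=> lt; apply: Hbad; [apply: kr|apply/Hx/mem_nth; rewrite sx].
pose cc i := if (i < 3)%N then side_comp C i else kc (i - 3)%N.
have ccS i : cc (i + 3)%N = kc i by rewrite /cc ltnNge leq_addl addnK.
have sum_cc (f : component C -> nat) : (\sum_(i < size ks + 3) f (cc i) =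
    f (side_comp C 0) + f (side_comp C 1) + f (side_comp C 2) + \sum_(i < size ks) f (kc i))%N.
  rewrite addnC big_split_ord /= !big_ord_recl big_ord0 /= addn0 !addnA; congr (_ + _)%N.
  by apply: eq_bigr => i _; rewrite addnC ccS.
have sum_kc (f : nat -> nat) : (\sum_(i < size ks) f (nth 0%N ks i) = \sum_(r <- ks) f r)%N.
  by rewrite (big_nth 0%N) big_mkord.
exists (size ks + 3)%N, cc; split=> //.
- move=> i lti; rewrite /cc; case: ltnP => [lt3|ge3]; first exact: side_comp_good.
  by case: (kg (i - 3)%N) => //; lia.
- move=> i j lti ltj; rewrite /cc; case: (ltnP i 3) => [i3|i3]; case: (ltnP j 3) => [j3|j3].
  + exact: side_comp_inj.
  + have lj : (j - 3 < size ks)%N by lia.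
    by move/(side_kind_neq i3 (kr _ lj) (kg _ lj).1).
  + have li : (i - 3 < size ks)%N by lia.
    by move/esym/(side_kind_neq j3 (kr _ li) (kg _ li).1).
  + have li : (i - 3 < size ks)%N by lia.
    have lj : (j - 3 < size ks)%N by lia.
    move/(kind_comp_inj (kr _ li) (kr _ lj) (kg _ li).1 (kg _ lj).1) => [_ /eqP].
    by rewrite nth_uniq ?sx // => /eqP; lia.
- by move=> t t3; rewrite /cc t3.
split.
- by move=> i lti; rewrite ccS; case: (kg i lti).
- move=> i lti; rewrite /cc; case: ltnP => [lt3|ge3]; first by case: (side_inc_le m_noninc m7 cremona C lt3).
  by apply: kind_inc_le => //; apply: kr; lia.
- by rewrite (sum_cc (@dg C)) /= (sum_kc kdg) addnC -[RHS](kinds_dgE m_noninc m7 cremona).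
- move=> j ltj; rewrite (sum_cc (fun c => mu c j)) /= (sum_kc (fun r => kmu r j)) -(kinds_muE m_noninc m7 cremona ltj).
  rewrite -[RHS]add1n /kinds_mu; congr (_ + _)%N; rewrite /smu.
  by have := ltn_pmod j (isT : (0 < 3)%N); case: (j %% 3)%N => [|[|[|]]].
Qed.

(** With R the class (d; m) minus the triangle T, [dim_kinds] and [dim_le_sides] add up to
    R.R + 2 R.T + 1, which is (R + T).(R + T) because T.T = 9 - 8. *)
Lemma dim_class M : (M + \sum_(0 <= i < 8) m i ^ 2 = d ^ 2)%N -> dim_le q d m M.
Proof.
move=> HM; have [bad Hbad] := kinds_good C.
have [N [HN leN]] := dim_kinds (bad := bad) (fun r x ltr xb => proj1 (Hbad r x ltr xb))
  (kinds_nonempty m_noninc m7 cremona d_gt3) (kinds_lt9 d m).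
set R := kinds_mu ks in HN leN; have dE := kinds_dgE m_noninc m7 cremona; set e := kinds_dg ks in HN leN dE.
have mE i : (i < 8)%N -> m i = (R i).+1 by move=> lti; rewrite kinds_muE.
have [h1 h2 h3 h4 [h5 h6 h7]] := m_chain m_noninc.
have [le2 le1 le0] : [/\ (R 2 + R 5 <= e)%N, (R 1 + R 4 + R 7 <= e)%N & (R 0 + R 3 + R 6 <= e.+1)%N].
  by move: h1 h2 h3 h4 h5 h6 h7 cremona m7; rewrite !mE //; split; lia.
have H := dim_le_sides le2 le1 le0 HN.
apply: (dim_le_le (N := N + (e - (R 2 + R 5)) + (e - (R 1 + R 4 + R 7)) + (e.+1 - (R 0 + R 3 + R 6)))%N).
  move: HM leN; rewrite !sum8 !mE // -dE => HM leN.
  move: h1 h2 h3 h4 h5 h6 h7 cremona m7; rewrite !mE // -dE => h1 h2 h3 h4 h5 h6 h7 cr _.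
  clear -HM leN h1 h2 h3 h4 h5 h6 h7 cr.
  move: (R 0) (R 1) (R 2) (R 3) (R 4) (R 5) (R 6) (R 7) HM leN h1 h2 h3 h4 h5 h6 h7 cr.
  move=> r0 r1 r2 r3 r4 r5 r6 r7.
  have sqS r : (r.+1 ^ 2 = r ^ 2 + 2 * r + 1)%N by rewrite -addn1 sqrnD muln1 addnAC.
  rewrite !sqS sqrnD; move: (r0 ^ 2)%N (r1 ^ 2)%N (r2 ^ 2)%N (r3 ^ 2)%N (r4 ^ 2)%N
    (r5 ^ 2)%N (r6 ^ 2)%N (r7 ^ 2)%N (e ^ 2)%N => *; lia.
by apply: dim_le_ext H => // i lti; rewrite mE.
Qed.

End Special.

Section Special.
Variable C : numClosedFieldType.
Variables (d k : nat) (m : nat -> nat).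
Hypothesis m_noninc : forall i j, (i <= j)%N -> (j < 8)%N -> (m j <= m i)%N.
Hypothesis m7 : (0 < m 7)%N.
Hypothesis cremona : (m 0 + m 1 + m 2 <= d)%N.
Hypothesis d_gt3 : (3 < d)%N.

Local Notation ks := (kinds d m).
Local Notation q := (@base_q C).

(** The abscissae of the vertices of the triangle. *)
Definition vertices : seq C := [:: (-8)%:~R; 0; (-4)%:~R].

Lemma vertex_off_q v i : v \in vertices -> (i < 8)%N -> v != (q i).1.
Proof.
have H : all (fun z : int => all (fun i => z != (q_z i).1) (iota 0 8)) [:: -8; 0; -4] by [].
rewrite !inE => vin lti.
have [z zin ->] : exists2 z : int, z \in [:: -8; 0; -4] & v = z%:~R.
  by case/or3P: vin => /eqP ->; [exists (-8)|exists 0|exists (-4)].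
by rewrite /= eqr_int; have := forall_lt (allP H z zin) lti.
Qed.

Lemma smooth_at_mul (f g : {poly {poly C}}) p : smooth_at f p -> ev g p != 0 ->
  smooth_at (f * g) p.
Proof.
move=> /andP[/eqP f0 f1] g0; rewrite /smooth_at derivM evD !evM f0 !mul0r eqxx addr0.
by rewrite mulf_neq0.
Qed.

Lemma side_poly_cons (cc : nat -> component C) (pp pp' : nat -> seq (C * C)) i p :
  pp' i = p :: pp i -> side_poly q m cc pp' i = side_poly q m cc pp i * ('X - p.1%:P).
Proof.
move=> e; rewrite /side_poly /marks e !big_cat !big_map big_cons /= expr1 -!mulrA.
by congr (_ * _); rewrite mulrC.
Qed.

Lemma side_poly_neq0 (cc : nat -> component C) (pp : nat -> seq (C * C)) i v :
  v \in vertices -> (forall p, p \in pp i -> v != p.1) -> (side_poly q m cc pp i).[v] != 0.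
Proof.
move=> vin Hp; rewrite /side_poly horner_prod prodf_seq_neq0; apply/allP => t tin /=.
rewrite horner_exp expf_neq0 // hornerXsubC subr_eq0.
have [[j -> /andP[ltj _]]|[p -> pin]] := marksP tin; first exact: vertex_off_q.
exact: Hp.
Qed.

(** All marked points but one are general on their component. The last one, on the side
    y = x + 1, also avoids the finitely many abscissae for which Carnot's products have
    equal j-th powers for some j <= k. *)
Lemma special_position M : (0 < k)%N -> (M + \sum_(0 <= i < 8) m i ^ 2 = d ^ 2)%N ->
  exists (pt : nat -> C * C) (v : nat -> C), forall f0 f1,
    [/\ tdeg (k * d)%N f0, tdeg (k * d)%N f1,
      vanq q (fun t => k * m t)%N f0 & vanq q (fun t => k * m t)%N f1] ->
    (forall b, (b < M)%N -> van k f0 (pt b)) ->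
    (forall b, (b < M)%N -> van k (f1 + (v b)%:P%:P * f0^`()) (pt b)) ->
  f0 = 0.
Proof.
move=> k0 HM; have [n [cc [nE gcc icc sidecc [excc inccc dgcc mucc]]]] := components C m_noninc m7 cremona d_gt3.
have pcc i : (i < n)%N -> plane_curve (dg (cc i)) (eqn (cc i)) by case/gcc.
have /choice[es Hes] : forall i, exists s, (3 <= i)%N -> (i < n)%N -> [/\ off_q q s, smooth_at (eqn (cc i)) s &
    exists2 t, (t < 3)%N & ev (eqn (cc t)) s = 0].
  move=> i; have [/andP[ge3 lti]|] := boolP ((3 <= i) && (i < n))%N; last first.
    by move=> h; exists (0, 0) => h1 h2; rewrite h1 h2 in h.
  have [|s [s1 s2 [t t3 ts]]] := excc (i - 3)%N; first by lia.
  rewrite subnK // in s2; exists s => _ _; split=> //.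
  by exists t; rewrite // sidecc.
pose bad := [seq (q i).1 | i <- iota 0 8] ++ [seq (es i).1 | i <- iota 0 n] ++ vertices.
pose others i := [seq eqn (cc j) | j <- iota 0 n & j != i].
have Hothers i : (i < n)%N -> forall h, h \in others i -> ~~ (eqn (cc i) %| h).
  move=> lti h /mapP[j]; rewrite mem_filter mem_iota => /andP[ne /= ltj] ->.
  apply/negP => /(plane_curve_dvd_eq (pcc i lti) (pcc j ltj)) /(icc i j lti ltj) e.
  by rewrite e eqxx in ne.
(* One point of the side of index 2 is left for later. *)
pose cnt i := (dg (cc i) * d - inc (cc i) m - (i == 2))%N.
have /choice[pp0 Hpp0] : forall i, exists s : seq (C * C), (i < n)%N -> [/\ size s = cnt i,
    uniq [seq p.1 | p <- s] & forall p, p \in s -> [/\ p.1 \notin bad,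
      smooth_at (eqn (cc i)) p & forall h, h \in others i -> ev h p != 0]].
  move=> i; have [lti|gei] := ltnP i n; last by exists [::].
  by have [s Hs] := plane_curve_points bad (cnt i) (pcc i lti) (Hothers i lti); exists s.
have n3 : (3 <= n)%N by rewrite nE leq_addl.
have n2 : (2 < n)%N by [].
pose sp := side_poly q m cc pp0.
have vin : [/\ (-8)%:~R \in vertices, 0 \in vertices & (-4)%:~R \in vertices].
  by rewrite !inE !eqxx !orbT.
case: vin => v8 v0 v4.
have offbad p : p.1 \notin bad -> off_q q p /\ forall v, v \in vertices -> v != p.1.
  rewrite mem_cat negb_or mem_cat negb_or => /and3P[b1 b2 b3]; split=> [i lti|v vi].
    by apply/eqP => e; case/negP: b1; rewrite e; apply/mapP; exists i; rewrite ?mem_iota.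
  by apply/eqP => e; rewrite -e vi in b3.
have sp0 i v : (i < n)%N -> v \in vertices -> (sp i).[v] != 0.
  move=> lti vi; apply: side_poly_neq0 => // p pin.
  have [_ _ /(_ p pin)[pb _ _]] := Hpp0 i lti; exact: (offbad p pb).2.
pose A := (sp 0%N).[(-8)%:~R] * (sp 1%N).[(-4)%:~R] * (sp 2%N).[0].
pose B := (sp 1%N).[(-8)%:~R] * (sp 2%N).[(-4)%:~R] * (sp 0%N).[0].
have An0 : A != 0 by rewrite !mulf_neq0 ?sp0 // (leq_trans _ n3).
(* The equality of the j-th powers of Carnot's products, as an equation in the abscissa
   of that last point; 0 and -4 are the vertices on its side. *)
pose E (j : nat) : {poly C} := (A%:P * (0%:P - 'X)) ^+ j - (B%:P * ((-4)%:~R%:P - 'X)) ^+ j.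
have En0 j : (0 < j)%N -> E j != 0.
  move=> j0; apply/eqP => /(congr1 (fun f : {poly C} => f.[(-4)%:~R])).
  rewrite /E horner0 hornerD hornerN !horner_exp !hornerM !hornerD !hornerN !hornerC hornerX.
  rewrite subrr mulr0 expr0n gtn_eqF // subr0 sub0r => /eqP.
  by rewrite expf_eq0 j0 mulf_eq0 (negbTE An0) oppr_eq0 intr_eq0.
have [bad2 Hbad2] : exists bad2 : seq C, forall j x, (0 < j)%N -> (j <= k)%N -> root (E j) x -> x \in bad2.
  have nz : \prod_(j < k) E j.+1 != 0 by apply/prodf_neq0 => j _; apply: En0.
  have [s Hs] := poly_roots_seq nz; exists s => j x j0 jk rx; apply: Hs.
  have ltj : (j.-1 < k)%N by rewrite prednK.
  by rewrite (bigD1 (Ordinal ltj)) //= prednK // rootM rx.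
have [p2 [p2b p2s p2o]] := plane_curve_point (bad ++ bad2 ++ [seq p.1 | p <- pp0 2]) (pcc 2%N n2) (Hothers 2%N n2).
move: p2b; rewrite mem_cat negb_or => /andP[p2b]; rewrite mem_cat negb_or => /andP[p2b2 p2n].
pose pp i := if i == 2%N then p2 :: pp0 2%N else pp0 i.
have Hpp i : (i < n)%N -> [/\ (size (pp i) + inc (cc i) m = dg (cc i) * d)%N,
    uniq [seq p.1 | p <- pp i] & forall p, p \in pp i -> [/\ p.1 \notin bad,
      smooth_at (eqn (cc i)) p & forall h, h \in others i -> ev h p != 0]].
  move=> lti; have := inccc i lti; rewrite /pp; case: (eqVneq i 2%N) => [e|ne] le.
    have [s1 s2 s3] := Hpp0 2%N n2; rewrite {i lti}e in le *; split.
    - rewrite /= s1 /cnt eqxx sidecc //=.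
      by have [_] := side_inc_le m_noninc m7 cremona C (isT : (2 < 3)%N); lia.
    - by rewrite /= p2n s2.
    - by move=> p; rewrite in_cons => /predU1P[->|/s3].
  have [s1 s2 s3] := Hpp0 i lti; split=> //.
  by rewrite s1 /cnt (negbTE ne) subn0 subnK.
have ppF i p : (i < n)%N -> p \in pp i ->
    [/\ off_q q p, smooth_at (eqn (cc i)) p & smooth_at (total_eqn n cc) p].
  move=> lti pin; have [_ _ /(_ p pin)[pb ps po]] := Hpp i lti; split=> //.
    exact: (offbad p pb).1.
  rewrite /total_eqn (bigD1 (Ordinal lti)) //=; apply: smooth_at_mul => //.
  rewrite -big_filter ev_prod prodf_seq_neq0; apply/allP => j; rewrite mem_filter => /andP[ne _] /=.
  by apply: po; apply/mapP; exists (val j); rewrite // mem_filter mem_iota ltn_ord !andbT.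
have sp_eq i : i != 2%N -> side_poly q m cc pp i = sp i.
  by move=> ne; rewrite /sp /side_poly /pp (negbTE ne).
have sp_2 : side_poly q m cc pp 2 = sp 2%N * ('X - p2.1%:P) by apply: side_poly_cons; rewrite /pp.
(* The degrees of (d; m) on the components add up to its self-intersection with the
   eight points, d^2 - sum m_i^2. *)
have szM : size (all_pts n pp) = M.
  have : (size (all_pts n pp) + \sum_(i < n) inc (cc i) m = d * d)%N.
    have -> : size (all_pts n pp) = (\sum_(i < n) size (pp i))%N.
      rewrite /all_pts size_flatten /shape -map_comp sumnE big_map.
      by rewrite -(big_mkord xpredT (fun i => size (pp i))) /index_iota subn0.
    rewrite -big_split /=.
    rewrite -{1}dgcc big_distrl /=; apply: eq_bigr => i _.
    by have [-> _ _] := Hpp i (ltn_ord i).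
  have -> : (\sum_(i < n) inc (cc i) m = \sum_(0 <= j < 8) m j ^ 2)%N.
    rewrite /inc exchange_big /= big_nat [RHS]big_nat; apply: eq_bigr => j /= ltj.
    by rewrite -big_distrl /= mucc // mulnn.
  by rewrite mulnn -HM => /eqP; rewrite eqn_add2r => /eqP.
have sp_n0 i v : (i < 3)%N -> v \in vertices -> (side_poly q m cc pp i).[v] != 0.
  move=> lti vi; have ltn : (i < n)%N := leq_trans lti n3; apply: side_poly_neq0 => // p pin.
  by have [_ _ /(_ p pin)[pb _ _]] := Hpp i ltn; apply: (offbad p pb).2.
have [v Hv] : exists v, rigid_by q n d k m pp v.
  apply: (@rigid_direction C q (@base_q_inj C) n d k m cc pp (fun t => aff (side C t)) (-8)%:~R 0 (-4)%:~R) => //.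
  - by move=> i lti; rewrite sidecc.
  - by move=> i lti; rewrite sidecc.
  - by move=> i lti; apply: size_aff.
  - by move=> i lti; case: (Hpp i lti).
  - by move=> i lti; case: (Hpp i lti).
  - move=> i ge3 lti; have [s1 s2 s3] := Hes i ge3 lti; exists (es i); split=> //.
    apply/mapP => -[p pin e]; have [_ _ /(_ p pin)[pb _ _]] := Hpp i lti.
    move: pb; rewrite -e mem_cat negb_or mem_cat negb_or => /and3P[_ nb _].
    by case/negP: nb; apply/mapP; exists i => //; rewrite mem_iota add0n.
  - by rewrite !aff_horner -!intrM -!intrD.
  - by rewrite !aff_horner !mulr0 !add0r.
  - by rewrite !aff_horner -!intrM -!intrD.
  - by rewrite !sp_n0.
  - move=> j j0 jk; rewrite sp_2 !sp_eq // !hornerM !hornerXsubC -subr_eq0.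
    apply: contra p2b2 => H; apply: (Hbad2 j) => //; move: H; rewrite /root /E.
    rewrite hornerD hornerN !horner_exp !hornerM !hornerD !hornerN !hornerC hornerX.
    by rewrite /A /B !mulrA => /eqP H; apply/eqP; rewrite -[RHS]H; congr (_ ^+ _ - _ ^+ _); ring.
  - by rewrite szM; apply: (dim_class m_noninc m7 cremona d_gt3).
exists (pt n pp), v => f0 f1 Hf H0 H1; apply: (Hv f0 f1 Hf) => b; rewrite szM; [exact: H0|exact: H1].
Qed.

End Special.

(** * Kernels of polynomial matrices *)

Section Kernel.
Local Open Scope quotient_scope.

Local Notation "x %:F" := (@FracField.tofrac _ x).

Lemma fraction_rep (R : idomainType) (x : {fraction R}) :
  exists n d : R, d != 0 /\ x * d%:F = n%:F.
Proof.
pose r := repr x; exists (val r).1, (val r).2; split; first exact: denom_ratioP.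
have rn : (val r).2 != 0 by apply: denom_ratioP.
rewrite -[x]reprK -/r; unlock FracField.tofrac; rewrite -[LHS]FracField.pi_mul.
apply/eqmodP; rewrite /= FracField.equivfE /FracField.mulf /=.
by rewrite !numden_Ratio ?oner_eq0 ?mulr1 //; apply/eqP; rewrite mulrC.
Qed.

Lemma common_denominator (R : idomainType) n (w : 'rV[{fraction R}]_n) :
  exists (c : R) (u : 'rV[R]_n), c != 0 /\ c%:F *: w = map_mx (fun x => x%:F) u.
Proof.
elim: n w => [|n IH] w.
  by exists 1, 0; rewrite oner_eq0; split=> //; apply/rowP => -[].
have [c [u [c0 Hu]]] := IH (\row_i w 0 (lift ord0 i)).
have [a [b [b0 Hb]]] := fraction_rep (w 0 ord0).
exists (c * b), (\row_i if unlift ord0 i is Some j then b * u 0 j else c * a).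
split; first by rewrite mulf_neq0.
apply/rowP => i; rewrite !mxE rmorphM /=; case: unliftP => [j ->|->] /=.
  have := congr1 (fun A : 'rV__ => A 0 j) Hu; rewrite !mxE => h.
  by rewrite rmorphM mulrAC h /= mulrC.
by rewrite rmorphM -mulrA [b%:F * _]mulrC Hb.
Qed.

Variable C : numClosedFieldType.

Lemma poly_row_primitive n (u : 'rV[{poly C}]_n) : u != 0 ->
  exists j (w : 'rV[{poly C}]_n), u = 'X^j *: w /\ exists i, (w 0 i).[0] != 0.
Proof.
have [N] := ubnP (\sum_i size (u ord0 i))%N; elim: N u => // N IH u ltN u0.
have [[i Hi]|allz] := pselect (exists i, (u 0 i).[0] != 0).
  by exists 0%N, u; rewrite expr0 scale1r; split=> //; exists i.
have /choice[h Hh] : forall i, exists h, u 0 i = h * 'X.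
  move=> i; have : root (u 0 i) 0.
    by rewrite /root; apply/negPn/negP => nz; apply: allz; exists i.
  by case/factor_theorem => h ->; exists h; rewrite subr0.
pose w := \row_i h i.
have uw : u = 'X *: w by apply/rowP => i; rewrite !mxE Hh mulrC.
have w0 : w != 0 by apply: contraNneq u0 => w0; rewrite uw w0 scaler0.
have ul l : u ord0 l = w ord0 l * 'X by rewrite [w _ _]mxE Hh.
have [i wi] : exists i, w 0 i != 0.
  apply: contrapT => nz; case/negP: w0; apply/eqP/rowP => i; rewrite [RHS]mxE.
  by apply/eqP/negPn/negP => ni; apply: nz; exists i.
have [|//|j [w' [ww' H]]] := IH w.
  rewrite ltnS in ltN; apply: leq_trans ltN; rewrite (bigD1 i) //= [leqRHS](bigD1 i) //=.
  have sz l : (size (w ord0 l) <= size (u ord0 l))%N.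
    rewrite ul; have [->|nz] := eqVneq (w ord0 l) 0; first by rewrite mul0r.
    by rewrite size_mulX // leqW.
  rewrite -addSn leq_add //; last by apply: leq_sum.
  by rewrite ul size_mulX.
by exists j.+1, w'; rewrite uw ww' scalerA -exprS.
Qed.

(** If the rows are dependent over C(t), clear the denominators of a relation and divide it
    by the largest power of t. *)
Lemma kernel_or_minor n c (B : 'M[{poly C}]_(n, c)) :
  (exists f : 'I_n -> 'I_c, \det (colsub f B) != 0) \/
  exists2 u : 'rV[{poly C}]_n, u *m B = 0 & exists i, (u 0 i).[0] != 0.
Proof.
pose BF := map_mx (fun x : {poly C} => x%:F) B.
have [free|] := boolP (row_free BF).
  left; have full : row_full BF^T by rewrite /row_full mxrank_tr.
  exists (fullrankfun full); have := fullrowsub_unit full.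
  rewrite unitmxE unitfE; set f := fullrankfun full.
  have -> : rowsub f BF^T = (map_mx (fun x : {poly C} => x%:F) (colsub f B))^T.
    by apply/matrixP => i j; rewrite !mxE.
  by rewrite det_tr det_map_mx tofrac_eq0.
rewrite -kermx_eq0 => kn0.
have /rowV0Pn[w /sub_kermxP wB wn0] := kn0.
have [d [u [d0 Hu]]] := common_denominator w.
right; have u0 : u != 0.
  apply: contraNneq wn0 => u0; have : d%:F *: w == 0 by rewrite Hu u0 map_mx0.
  by rewrite scalemx_eq0 tofrac_eq0 (negbTE d0).
have uB : u *m B = 0.
  have H0 : map_mx (fun x : {poly C} => x%:F) (u *m B) = 0.
    by rewrite map_mxM -Hu -scalemxAl wB scaler0.
  apply/matrixP => i l; apply/eqP; rewrite [X in _ == X]mxE -tofrac_eq0.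
  by have := congr1 (fun A : 'M_(_, _) => A i l) H0; rewrite [LHS]mxE [RHS]mxE => ->.
have [j [w' [def_u Hw]]] := poly_row_primitive u0; exists w' => //.
have : 'X^j *: (w' *m B) = 0 by rewrite scalemxAl -def_u.
by move/eqP; rewrite scalemx_eq0 -size_poly_eq0 size_polyXn => /eqP.
Qed.

End Kernel.

(** * Forms in an affine chart *)

Section Dehomogenize.
Variable C : numClosedFieldType.
Implicit Types (G : {mpoly C[3]}) (Y : {poly C}).

Definition i0 : 'I_3 := @Ordinal 3 0 isT.
Definition i1 : 'I_3 := @Ordinal 3 1 isT.
Definition i2 : 'I_3 := @Ordinal 3 2 isT.

Lemma ord3P (j : 'I_3) : [\/ j = i0, j = i1 | j = i2].
Proof.
by case: j => -[|[|[|//]]] lt; [apply: Or31|apply: Or32|apply: Or33]; apply: val_inj.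
Qed.

Lemma sum_ord3 (V : nmodType) (f : 'I_3 -> V) : \sum_(j < 3) f j = f i0 + f i1 + f i2.
Proof.
rewrite !big_ord_recl big_ord0 addr0 addrA.
by congr (f _ + f _ + f _); apply: val_inj.
Qed.

Lemma prod_ord3 (V : comNzRingType) (f : 'I_3 -> V) : \prod_(j < 3) f j = f i0 * f i1 * f i2.
Proof.
rewrite !big_ord_recl big_ord0 mulr1 mulrA.
by congr (f _ * f _ * f _); apply: val_inj.
Qed.

(** Substitution of the parametrized arc [h]. *)
Definition along (h : 'I_3 -> {poly C}) (G : {mpoly C[3]}) : {poly C} := mmap (@polyC C) h G.

Lemma alongD h : {morph along h : F G / F + G}. Proof. exact: rmorphD. Qed.
Lemma alongZ h c G : along h (c *: G) = c%:P * along h G.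
Proof. by rewrite /along mmapZ. Qed.

Lemma along_deriv h G :
  (along h G)^`() = \sum_(j < 3) along h (mderiv j G) * (h j)^`().
Proof.
elim/mpolyind: G => [|c m G _ _ IH].
  rewrite /along rmorph0 deriv0 big1 // => j _.
  by rewrite mderiv0 rmorph0 mul0r.
rewrite alongD derivD IH alongZ derivM derivC mul0r add0r.
under [RHS]eq_bigr do rewrite mderivD alongD mulrDl mderivZ alongZ -mulrA.
rewrite big_split -mulr_sumr /=; congr (_ * _ + _).
rewrite sum_ord3 /along mmapX /mmap1 !mderivX !mmapZ !mmapX /mmap1 !prod_ord3.
rewrite !derivM !deriv_exp !mnmBE !mnm1E /= !subn0 !subn1.
rewrite -!(mulr_natl (_ * _)) !polyCMn polyC1.
move: (1 *+ m i0) (1 *+ m i1) (1 *+ m i2) => k0 k1 k2; ring.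
Qed.

Lemma along_horner h G x : (along h G).[x] = G.@[fun j => (h j).[x]].
Proof.
rewrite /along /meval /mmap horner_sum; apply: eq_bigr => m _.
rewrite hornerM hornerC /mmap1 horner_prod; congr (_ * _).
by apply: eq_bigr => j _; rewrite horner_exp.
Qed.

(** The chart z = 1, with y as outer and x as inner variable. *)
Definition dehom (G : {mpoly C[3]}) : {poly {poly C}} :=
  mmap (polyC \o @polyC C) (fun j : 'I_3 => nth 1 [:: 'X%:P; 'X] j) G.

Definition graph Y (j : 'I_3) : {poly C} := nth 1 [:: 'X; Y] j.

Lemma dehom_horner G Y : (dehom G).[Y] = along (graph Y) G.
Proof.
rewrite /dehom /along /mmap horner_sum; apply: eq_bigr => m _.
rewrite hornerM /= hornerC /mmap1 horner_prod; congr (_ * _).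
apply: eq_bigr => -[[|[|[|//]]] lt] _; rewrite horner_exp /graph /=.
- by rewrite hornerC.
- by rewrite hornerX.
- by rewrite hornerC.
Qed.

Lemma dehomD : {morph dehom : F G / F + G}. Proof. exact: rmorphD. Qed.

Lemma dehomZ c G : dehom (c *: G) = c%:P%:P * dehom G.
Proof. by rewrite /dehom mmapZ. Qed.

Lemma dehomX m : dehom 'X_[m] = ('X ^+ m i0)%:P * 'X ^+ m i1.
Proof. by rewrite /dehom mmapX /mmap1 prod_ord3 /= expr1n mulr1 polyC_exp. Qed.

Lemma dehom_deriv G : (dehom G)^`() = dehom (mderiv i1 G).
Proof.
elim/mpolyind: G => [|c m G _ _ IH]; first by rewrite mderiv0 /dehom rmorph0 deriv0.
rewrite dehomD derivD IH mderivD dehomD; congr (_ + _).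
rewrite mderivZ !dehomZ derivM derivC mul0r add0r mderivX dehomZ !dehomX.
rewrite derivM derivC mul0r add0r derivXn !mnmBE !mnm1E /= subn0 subn1.
congr (_ * _); rewrite !polyCMn !polyC1 mulrnAr -mulr_natl mulrA; congr (_ * _); ring.
Qed.

(** Induction on [s]: along an arc, a function whose first partial derivatives vanish to
    order s - 1 has a derivative that vanishes to order s - 1. *)
Lemma van_dehom s G (P : 'rV[C]_3) : P 0 i2 = 1 ->
  (forall a : 'X_{1..3}, (mdeg a < s)%N -> (mderivm a G).@[fun j => P 0 j] = 0) ->
  van s (dehom G) (P 0 i0, P 0 i1).
Proof.
move=> P2; elim: s G => [|s IH] G H Y /= HY; first by rewrite expr0 dvd1p.
apply: dvdp_exp_Xsub_deriv.
  rewrite dehom_horner along_horner.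
  have := H 0%MM; rewrite mdeg0 mderivm0m => /(_ isT) <-; apply: meval_eq => j.
  case: j => -[|[|[|//]]] lt; rewrite /graph /=.
  - by rewrite hornerX; congr (P _ _); apply: val_inj.
  - by rewrite HY; congr (P _ _); apply: val_inj.
  - by rewrite hornerC -P2; congr (P _ _); apply: val_inj.
rewrite dehom_horner along_deriv sum_ord3 /graph /= derivX derivC mulr1 mulr0 addr0.
have IHj j : ('X - (P 0 i0)%:P) ^+ s %| (dehom (mderiv j G)).[Y].
  apply: IH => // a lta; rewrite -mderivmU1m -mderivmDm; apply: H.
  by rewrite mdegD mdeg1 add1n.
by rewrite dvdp_add // ?dvdp_mulr // -dehom_horner.
Qed.

Lemma dehom_sum G :
  dehom G = \sum_(m <- msupp G) (G@_m)%:P%:P * (('X ^+ m i0)%:P * 'X ^+ m i1).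
Proof. by rewrite {1}(mpolyE G) (big_morph _ dehomD (rmorph0 _)); apply: eq_bigr => m _; rewrite dehomZ dehomX. Qed.

Lemma tdeg_dehom D G : G \is D.-homog -> tdeg D (dehom G).
Proof.
move=> /dhomogP HG; rewrite dehom_sum big_seq.
elim/big_ind: _ => [|x y|m min]; [exact: tdeg0|exact: tdegD|].
apply: tdegCM => i.
rewrite coefCM coefXn; case: eqP => [->|_]; last by rewrite mulr0 size_poly0.
rewrite mulr1 size_polyXn -(HG m min) /= mdegE sum_ord3; lia.
Qed.

(** The exponent of z in a monomial is determined by the other two and the degree. *)
Lemma dehom_eq0 D G : G \is D.-homog -> dehom G = 0 -> G = 0.
Proof.
move=> /dhomogP HG G0; apply/mpolyP => m; rewrite mcoeff0.
apply/eqP/negPn/negP => nm; have min : m \in msupp G by rewrite mcoeff_msupp.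
have : ((dehom G)`_(m i1))`_(m i0) = G@_m.
  rewrite dehom_sum coef_sum coef_sum (bigD1_seq m) ?msupp_uniq //=.
  rewrite !coefCM coefXn eqxx mulr1 coefXn eqxx mulr1.
  rewrite big_seq_cond big1 ?addr0 // => m' /andP[m'in ne].
  rewrite !coefCM coefXn; case: eqP => [e1|_]; last by rewrite mulr0 coef0 mulr0.
  rewrite mulr1 coefXn; case: eqP => [e0|_]; last by rewrite mulr0.
  case/negP: ne; apply/eqP/mnmP => j.
  have : mdeg m' = mdeg m by rewrite (HG _ m'in) (HG _ min).
  rewrite !mdegE !sum_ord3 e0 e1 => /eqP; rewrite eqn_add2l => /eqP e2.
  by case: (ord3P j) => ->.
by rewrite G0 !coef0 => e; rewrite -e eqxx in nm.
Qed.

End Dehomogenize.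

(** * Multihomogeneous minors *)

Lemma mmap_mmap (K S : comNzRingType) N k (f : {rmorphism K -> S}) (v : 'I_N -> S)
    (h : 'I_k -> {mpoly K[N]}) (G : {mpoly K[k]}) :
  mmap f v (mmap (@mpolyC N K) h G) = mmap f (fun j => mmap f v (h j)) G.
Proof.
rewrite {2}/mmap rmorph_sum; apply: eq_bigr => m _.
rewrite rmorphM /= mmapC; congr (_ * _).
by rewrite /mmap1 rmorph_prod; apply: eq_bigr => j _; rewrite rmorphXn.
Qed.

Section Multihomogeneous.
Variables (K : comNzRingType) (n : nat).
Implicit Types (G H : {mpoly K[n * 3]}) (e : 'I_n -> nat).

(** Multihomogeneity with an explicit multidegree, so that degrees can be added. *)
Definition multihom e G := forall a, a \in msupp G ->
  forall i, (\sum_(j < 3) a (mxvec_index i j))%N = e i.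

Lemma multihom0 e : multihom e 0.
Proof. by move=> a; rewrite msupp0. Qed.

Lemma multihom_eq e e' G : e =1 e' -> multihom e G -> multihom e' G.
Proof. by move=> ee H a /H Ha i; rewrite Ha. Qed.

Lemma multihomD e G H : multihom e G -> multihom e H -> multihom e (G + H).
Proof. by move=> HG HH a /msuppD_le; rewrite mem_cat => /orP[/HG|/HH]. Qed.

Lemma multihomZ e c G : multihom e G -> multihom e (c *: G).
Proof. by move=> HG a /msuppZ_le/HG. Qed.

Lemma multihomM e e' G H : multihom e G -> multihom e' H ->
  multihom (fun i => e i + e' i)%N (G * H).
Proof.
move=> HG HH a /msuppM_le/allpairsP[[b c] /= [/HG Hb /HH Hc ->]] i.
by rewrite -Hb -Hc -big_split; apply: eq_bigr => j _; rewrite mnmDE.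
Qed.

Lemma multihom1 : multihom (fun=> 0%N) 1.
Proof.
move=> a; rewrite msupp1 inE => /eqP-> i.
by rewrite big1 // => j _; rewrite mnm0E.
Qed.

Lemma multihom_sum (I : Type) (s : seq I) (P : pred I) e (G : I -> {mpoly K[n * 3]}) :
  (forall x, P x -> multihom e (G x)) -> multihom e (\sum_(x <- s | P x) G x).
Proof.
by move=> H; elim/big_ind: _ => //; [exact: multihom0|exact: multihomD].
Qed.

Lemma multihom_prod (I : Type) (s : seq I) (e : I -> 'I_n -> nat) (G : I -> {mpoly K[n * 3]}) :
  (forall x, multihom (e x) (G x)) ->
  multihom (fun i => \sum_(x <- s) e x i)%N (\prod_(x <- s) G x).
Proof.
move=> H; elim: s => [|x s IH].
  by rewrite big_nil; apply: multihom_eq multihom1 => i; rewrite big_nil.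
rewrite big_cons; apply: multihom_eq (multihomM (H x) IH) => i.
by rewrite big_cons.
Qed.

(** In each term of the determinant every column contributes once. *)
Lemma multihom_det k (M : 'M[{mpoly K[n * 3]}]_k) (e : 'I_k -> 'I_n -> nat) :
  (forall l j, multihom (e j) (M l j)) -> multihom (fun i => \sum_j e j i)%N (\det M).
Proof.
move=> H; apply: multihom_sum => s _.
have sgn (b : bool) G : (-1) ^+ b * G = ((-1) ^+ b : K) *: G.
  by case: b; rewrite ?expr1 ?expr0 ?mulN1r ?scaleN1r ?mul1r ?scale1r.
rewrite sgn; apply: multihomZ.
have Hp := @multihom_prod _ (index_enum _) _ _ (fun l => H l (s l)).
by apply: multihom_eq Hp => i; rewrite [RHS](reindex_inj (@perm_inj _ s)).
Qed.

Lemma mxvec_index_eq (i i' : 'I_n) (j j' : 'I_3) :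
  (mxvec_index i j == mxvec_index i' j') = (i == i') && (j == j').
Proof.
apply/eqP/andP => [e|[/eqP-> /eqP->] //].
have := congr1 (fun k => mxvec (delta_mx i j : 'M[int]_(n, 3)) 0 k) e.
rewrite /= !mxvecE !mxE !eqxx /= [i' == i]eq_sym [j' == j]eq_sym.
by case: (i == i'); case: (j == j').
Qed.

Lemma multihom_var i j :
  multihom (fun i' => nat_of_bool (i' == i)) ('X_(mxvec_index i j) : {mpoly K[n * 3]}).
Proof.
move=> a; rewrite msuppX inE => /eqP -> i'.
rewrite (bigD1 j) //= mnm1E mxvec_index_eq eqxx andbT eq_sym big1 ?addn0 // => j' ne.
by rewrite mnm1E mxvec_index_eq [j == j']eq_sym (negbTE ne) andbF.
Qed.

Lemma multihomX e G k : multihom e G -> multihom (fun i => k * e i)%N (G ^+ k).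
Proof.
move=> H; elim: k => [|k IH]; first by rewrite expr0; apply: multihom1.
by rewrite exprS; apply: multihom_eq (multihomM H IH) => i; rewrite mulSn.
Qed.

Lemma multihom_subst i (b : 'X_{1..3}) :
  multihom (fun i' => if i' == i then mdeg b else 0%N)
    (mmap (@mpolyC (n * 3) K) (fun j => 'X_(mxvec_index i j)) 'X_[b]).
Proof.
have Hp := @multihom_prod _ (index_enum _) _ _ (fun j => multihomX (k := b j) (@multihom_var i j)).
rewrite mmapX /mmap1; apply: multihom_eq Hp => i'; rewrite mdegE; case: eqP => _; first by under eq_bigr do rewrite muln1.
by under eq_bigr do rewrite muln0; rewrite big1.
Qed.

End Multihomogeneous.

Section Forms.
Variables (K : comNzRingType) (D : nat).

Definition mons : seq 'X_{1..3} :=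
  [seq val a | a <- enum {: 'X_{1..3 < D.+1}} & mdeg (val a) == D].

Lemma mons_uniq : uniq mons.
Proof.
rewrite map_inj_in_uniq => [|a b _ _]; last exact: val_inj.
by apply: filter_uniq; apply: enum_uniq.
Qed.

Lemma mem_mons a : (a \in mons) = (mdeg a == D).
Proof.
apply/mapP/idP => [[b + ->]|da]; first by rewrite mem_filter => /andP[].
have lt : (mdeg a < D.+1)%N by rewrite (eqP da).
by exists (BMultinom lt); rewrite // mem_filter /= da mem_enum.
Qed.

Definition mon (l : 'I_(size mons)) := nth 0%MM mons l.

Lemma mdeg_mon l : mdeg (mon l) = D.
Proof. by apply/eqP; rewrite -mem_mons mem_nth. Qed.

Definition form (u : 'rV[K]_(size mons)) : {mpoly K[3]} := \sum_l u 0 l *: 'X_[mon l].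

Lemma form_homog u : form u \is D.-homog.
Proof. by apply: rpred_sum => l _; apply: rpredZ; rewrite dhomogX; apply/eqP/mdeg_mon. Qed.

Lemma form_coef u l : (form u)@_(mon l) = u 0 l.
Proof.
rewrite /form raddf_sum /= (bigD1 l) //= mcoeffZ mcoeffX eqxx mulr1.
rewrite big1 ?addr0 // => l' ne; rewrite mcoeffZ mcoeffX.
by rewrite /mon nth_uniq ?mons_uniq // -[(_ == _ :> nat)]/(l' == l) (negbTE ne) mulr0.
Qed.

Lemma form_surj G : G \is D.-homog -> G = form (\row_l G@_(mon l)).
Proof.
move=> HG; apply/mpolyP => a.
have [ain|an] := boolP (a \in mons); last first.
  rewrite !(dhomog_nemf_coeff _ (_ : mdeg a != D)) ?form_homog //; first by rewrite -mem_mons.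
  by rewrite -mem_mons.
have lt : (index a mons < size mons)%N by rewrite index_mem.
have -> : a = mon (Ordinal lt) by rewrite /mon /= nth_index.
by rewrite form_coef mxE.
Qed.

End Forms.

(** * Emptiness of linear systems by deformation *)

Section Conditions.
Variables (R : realType) (D n : nat) (s : 'I_n -> nat).
Notation C := (R[i] : numClosedFieldType).

Definition smax : nat := \max_i s i.

(** The conditions imposed on forms, indexed by a point and an order of differentiation,
    with a common bound on the orders; columns in excess are set to zero. *)
Definition conds : Type := ('I_n * 'X_{1..3 < smax})%type.

Notation nD := (size (mons D)).
Notation nc := #|{: conds}|.

Definition cond (j : 'I_nc) : 'I_n * 'X_{1..3} :=
  let c := enum_val j : conds in (c.1, val c.2).

Lemma condP i (a : 'X_{1..3}) : (mdeg a < s i)%N -> exists j, cond j = (i, a).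
Proof.
move=> lt; have lt' : (mdeg a < smax)%N by apply: leq_trans lt _; apply: leq_bigmax.
by exists (enum_rank ((i, BMultinom lt') : conds)); rewrite /cond enum_rankK.
Qed.

(** The matrix of the conditions in the basis of monomials, with entries that are
    polynomials in the coordinates of the points: its minors are equations of the
    configurations for which the system is not empty. *)
Definition cond_mx : 'M[{mpoly C[n * 3]}]_(nD, nc) := \matrix_(l, j)
  if (mdeg (cond j).2 < s (cond j).1)%N then
    mmap (@mpolyC (n * 3) C) (fun t => 'X_(mxvec_index (cond j).1 t))
      (mderivm (cond j).2 'X_[mon l])
  else 0.

Lemma cond_mx_multihom l j : multihom (fun i => if i == (cond j).1 then
  (D - mdeg (cond j).2)%N else 0%N) (cond_mx l j).
Proof.
rewrite mxE; case: ifP => _; last exact: multihom0.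
rewrite mderivmX mmapZ mul_mpolyC; set c := _%:R.
have [le|nle] := boolP ((cond j).2 <= mon l)%MM.
  apply: multihomZ; have := @multihom_subst C n (cond j).1 (mon l - (cond j).2)%MM.
  have -> // : mdeg (mon l - (cond j).2)%MM = (D - mdeg (cond j).2)%N.
  have e : (mdeg (mon l - (cond j).2)%MM + mdeg (cond j).2 = D)%N.
    by rewrite -mdegD submK // mdeg_mon.
  by apply/eqP; rewrite -(eqn_add2r (mdeg (cond j).2)) e subnK // -[leqRHS]e leq_addl.
suff -> : c = 0 by rewrite scale0r; apply: multihom0.
move: nle; rewrite /c => /mnm_lepP/existsNP[t /negP]; rewrite -ltnNge => lt.
by rewrite (bigD1 t) //= ffact_small // mul0n.
Qed.

Definition cond_mx_at (P : 'M[C]_(n, 3)) : 'M[C]_(nD, nc) :=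
  map_mx (meval (fun k => mxvec P 0 k)) cond_mx.

Lemma cond_mx_atE P l j : cond_mx_at P l j =
  if (mdeg (cond j).2 < s (cond j).1)%N then
    (mderivm (cond j).2 'X_[mon l]).@[fun t => P (cond j).1 t] else 0.
Proof.
rewrite !mxE; case: ifP => _; last by rewrite meval0.
rewrite [LHS](mmap_mmap idfun); apply: meval_eq => t.
by rewrite -[LHS]/(('X_(mxvec_index (cond j).1 t)).@[_]) mevalXU mxvecE.
Qed.

Lemma form_cond (P : 'M[C]_(n, 3)) (u : 'rV[C]_nD) j : (u *m cond_mx_at P) 0 j =
  if (mdeg (cond j).2 < s (cond j).1)%N then
    (mderivm (cond j).2 (form u)).@[fun t => P (cond j).1 t] else 0.
Proof.
rewrite mxE; under eq_bigr do rewrite cond_mx_atE.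
case: ifP => _; last by rewrite big1 // => l _; rewrite mulr0.
rewrite /form !raddf_sum /=; apply: eq_bigr => l _.
by rewrite mderivmZ mevalZ.
Qed.

Definition nondegenerate (P : 'M[C]_(n, 3)) :=
  exists f : 'I_nD -> 'I_nc, \det (colsub f (cond_mx_at P)) != 0.

Lemma colsub_map_mx (K L : comNzRingType) (g : {rmorphism K -> L}) k c (A : 'M[K]_(k, c)) f :
  \det (colsub f (map_mx g A)) = g (\det (colsub f A)) :> L.
Proof. by rewrite -det_map_mx; congr (\det _); apply/matrixP => a b; rewrite !mxE. Qed.

Lemma nondegenerate_open : zariski_open nondegenerate.
Proof.
exists (fun G => exists f : 'I_nD -> 'I_nc, G = \det (colsub f cond_mx)); split.
  move=> G [f ->].
  exists (fun i => \sum_(l < nD) if i == (cond (f l)).1 then (D - mdeg (cond (f l)).2)%N else 0%N)%N.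
  by apply: (@multihom_det _ _ _ _ (fun l i => if i == (cond (f l)).1 then (D - mdeg (cond (f l)).2)%N else 0%N)) => l j; rewrite mxE; apply: cond_mx_multihom.
move=> P _; split=> [nd G [f ->]|H [f]].
  apply/eqP/negPn/negP => ne; apply: nd; exists f.
  by rewrite /cond_mx_at colsub_map_mx.
by move/negP; apply; rewrite /cond_mx_at colsub_map_mx; apply/eqP; apply: H; exists f.
Qed.

Lemma nondegenerate_empty P F : nondegenerate P -> F \is D.-homog ->
  (forall i, vanishes_to_order (s i) F (row i P)) -> F = 0.
Proof.
move=> [f nf] HF Hv; rewrite (form_surj HF); set u := \row_l _.
suff -> : u = 0 by rewrite /form big1 // => l _; rewrite mxE scale0r.
have uA : u *m cond_mx_at P = 0.
  apply/rowP => j; rewrite form_cond -(form_surj HF) mxE; case: ifP => // lt.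
  by rewrite -[RHS](Hv _ _ lt); apply: meval_eq => t; rewrite mxE.
have : u *m colsub f (cond_mx_at P) = 0.
  apply/rowP => l; rewrite [RHS]mxE -[RHS](_ : (u *m cond_mx_at P) 0 (f l) = 0); last by rewrite uA mxE.
  by rewrite !mxE; apply: eq_bigr => t _; rewrite !mxE.
move=> H; apply/eqP; apply: contraNT nf => un0; apply/eqP/eqP/det0P.
by exists u.
Qed.

(** Along the line P + t V, either some minor is not identically zero, and it is nonzero for
    some t; or there is a kernel vector over C[t] that does not vanish at t = 0, and its
    coefficients of orders 0 and 1 contradict the hypothesis. *)
Lemma nondegenerate_exists (P V : 'M[C]_(n, 3)) :
    (forall i, P i i2 = 1) -> (forall i, V i i2 = 0) ->
    (forall F0 F1 : {mpoly C[3]}, F0 \is D.-homog -> F1 \is D.-homog ->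
      (forall i a, (mdeg a < s i)%N -> (mderivm a F0).@[fun t => P i t] = 0) ->
      (forall i a, (mdeg a < s i)%N -> (mderivm a F1).@[fun t => P i t] +
         \sum_(t < 3) V i t * (mderivm a (mderiv t F0)).@[fun t => P i t] = 0) ->
      F0 = 0) ->
  exists P', configuration P' /\ nondegenerate P'.
Proof.
move=> P2 V2 rigid.
pose pt k : {poly C} := (mxvec P 0 k)%:P + (mxvec V 0 k)%:P * 'X.
pose h i t : {poly C} := (P i t)%:P + (V i t)%:P * 'X.
pose B : 'M[{poly C}]_(nD, nc) := map_mx (mmap (@polyC C) pt) cond_mx.
pose Pt (x : C) : 'M[C]_(n, 3) := P + x *: V.
have BE l j : B l j = if (mdeg (cond j).2 < s (cond j).1)%N then
    along (h (cond j).1) (mderivm (cond j).2 'X_[mon l]) else 0.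
  rewrite !mxE; case: ifP => _; last by rewrite rmorph0.
  rewrite (mmap_mmap (@polyC C)) /along /mmap; apply: eq_bigr => m _; congr (_ * _).
  apply: mmap1_eq => t; rewrite -[LHS]/(mmap _ pt 'X_(mxvec_index (cond j).1 t)).
  by rewrite mmapX mmap1U /pt !mxvecE.
have Bx x : map_mx (horner_eval x) B = cond_mx_at (Pt x).
  apply/matrixP => l j; rewrite mxE cond_mx_atE BE; case: ifP => _; last by rewrite /horner_eval horner0.
  rewrite /horner_eval along_horner; apply: meval_eq => t.
  by rewrite /h !mxE !hornerE mulrC.
case: (kernel_or_minor B) => [[f nf]|[u uB [l0 ul0]]].
  have [bad Hbad] := poly_roots_seq nf; have [x xb] := avoid_seq bad.
  exists (Pt x); split.
    move=> i; apply/eqP => /rowP/(_ i2); rewrite !mxE P2 V2 mulr0 addr0 => /eqP.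
    by rewrite oner_eq0.
  exists f; rewrite -Bx (colsub_map_mx (horner_eval x)) /=.
  by apply: contra xb => rx; apply: Hbad.
(* F0 and F1 are the terms of orders 0 and 1 in t of the family given by u. *)
pose u0 := \row_l (u 0 l).[0]; pose u1 := \row_l (u 0 l)^`().[0].
have h0 i : (fun t => (h i t).[0]) =1 (fun t => P i t).
  by move=> t; rewrite /h !hornerE ?mulr0 ?addr0.
have dh i t : (h i t)^`() = (V i t)%:P.
  by rewrite /h derivD derivC add0r derivM derivC mul0r add0r derivX mulr1.
have colB j : (mdeg (cond j).2 < s (cond j).1)%N ->
    \sum_l u 0 l * along (h (cond j).1) (mderivm (cond j).2 'X_[mon l]) = 0.
  move=> lt; have := congr1 (fun A : 'rV__ => A 0 j) uB; rewrite [LHS]mxE [RHS]mxE => E.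
  by rewrite -[RHS]E; apply: eq_bigr => l _; rewrite BE lt.
have F00 : form u0 = 0.
  apply: (rigid (form u0) (form u1)); rewrite ?form_homog //.
    move=> i a lt; have [j ej] := condP lt; have := colB j; rewrite ej => /(_ lt) E.
    have := congr1 (fun f : {poly C} => f.[0]) E; rewrite /= horner0 horner_sum => E0.
    rewrite -[RHS]E0 /form !raddf_sum /=; apply: eq_bigr => l _.
    by rewrite mderivmZ mevalZ mxE hornerM along_horner (meval_eq _ (h0 i)).
  move=> i a lt; have [j ej] := condP lt; have := colB j; rewrite ej => /(_ lt) E.
  have := congr1 (fun f : {poly C} => f^`().[0]) E; rewrite /= deriv0 horner0 (raddf_sum (@deriv C)) /= horner_sum => E0.
  have dF t : (mderivm a (mderiv t (form u0))).@[fun t => P i t] =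
      \sum_l u0 0 l * (mderivm a (mderiv t 'X_[mon l])).@[fun t => P i t].
    rewrite /form (raddf_sum (mderiv t)) /= !raddf_sum; apply: eq_bigr => l _ /=.
    by rewrite mderivZ mderivmZ mevalZ.
  rewrite -[RHS]E0 {1}/form !raddf_sum /=.
  under [X in _ + X]eq_bigr do rewrite dF mulr_sumr.
  rewrite [X in _ + X]exchange_big -big_split; apply: eq_bigr => l _ /=.
  rewrite mderivmZ mevalZ mxE derivM hornerD !hornerM along_horner (meval_eq _ (h0 i)).
  congr (_ + _); rewrite along_deriv horner_sum mulr_sumr; apply: eq_bigr => t _.
  rewrite dh hornerM hornerC along_horner (meval_eq _ (h0 i)).
  rewrite mxE -!mderivmU1m -!mderivmDm addmC; ring.
have : (form u0)@_(mon l0) = 0 by rewrite F00 mcoeff0.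
by rewrite form_coef mxE => /eqP; rewrite (negbTE ul0).
Qed.

End Conditions.

Lemma system_empty_by_deformation (R : realType) d n (m : n.-tuple nat) (P V : 'M[R[i]]_(n, 3)) :
    (forall i, P i i2 = 1) -> (forall i, V i i2 = 0) ->
    (forall F0 F1 : {mpoly R[i][3]}, F0 \is d.-homog -> F1 \is d.-homog ->
      (forall i a, (mdeg a < tnth m i)%N -> (mderivm a F0).@[fun t => P i t] = 0) ->
      (forall i a, (mdeg a < tnth m i)%N -> (mderivm a F1).@[fun t => P i t] +
         \sum_(t < 3) V i t * (mderivm a (mderiv t F0)).@[fun t => P i t] = 0) ->
      F0 = 0) ->
  system_empty R d m.
Proof.
move=> P2 V2 H; exists (@nondegenerate R d n (tnth m)); split.
- exact: nondegenerate_open.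
- exact: nondegenerate_exists P2 V2 H.
- by move=> P' _ nd F [HF Hv]; apply: nondegenerate_empty nd HF Hv.
Qed.

(** * Multiplicities of a system of self-intersection zero *)

Section Numerics.
Local Open Scope nat_scope.
Variables (n d : nat) (m : n.-tuple nat).
Hypothesis m_noninc : forall i j : 'I_n, i <= j -> tnth m j <= tnth m i.
Hypothesis cremona : nth 0 m 0 + nth 0 m 1 + nth 0 m 2 <= d.
Hypothesis selfint0 : d ^ 2 = \sum_(i < n) tnth m i ^ 2.
Hypothesis N_le8 : #|[set j : 'I_n | 2 <= tnth m j]| <= 8.

Local Notation mm := (nth 0 m).

Lemma mm_noninc i j : i <= j -> mm j <= mm i.
Proof.
move=> le; have [ltj|gej] := ltnP j n; last by rewrite nth_default // size_tuple.
have := m_noninc (i := Ordinal (leq_ltn_trans le ltj)) (j := Ordinal ltj) le.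
by rewrite !(tnth_nth 0).
Qed.

Lemma mm_tail i : 8 <= i -> mm i <= 1.
Proof.
move=> ge8; apply: leq_trans (mm_noninc ge8) _; rewrite leqNgt; apply/negP => gt1.
have lt8 : 8 < n.
  by rewrite ltnNge; apply/negP => le; rewrite nth_default ?size_tuple in gt1.
suff : 9 <= #|[set j : 'I_n | 2 <= tnth m j]| by move=> h; have := leq_trans h N_le8.
have inj : injective (widen_ord lt8) by move=> i' j' /(congr1 val) /= /val_inj.
rewrite -[X in X <= _](card_ord 9) -(card_codom inj); apply/subset_leq_card/subsetP => _ /codomP[j ->].
by rewrite inE (tnth_nth 0) /=; apply: leq_trans gt1 _; apply: mm_noninc; rewrite -ltnS.
Qed.

(** The number of points of multiplicity one beyond the first eight. *)
Definition ones := \sum_(8 <= i < n) mm i.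

Lemma selfint_split : ones + \sum_(0 <= i < 8) mm i ^ 2 = d ^ 2.
Proof.
have -> : d ^ 2 = \sum_(0 <= i < n) mm i ^ 2.
  by rewrite selfint0 big_mkord; apply: eq_bigr => i _; rewrite (tnth_nth 0).
rewrite /ones; have [le|ge] := leqP 8 n.
  rewrite [RHS](big_cat_nat _ (n := 8)) //= addnC; congr (_ + _).
  rewrite big_nat [RHS]big_nat; apply: eq_bigr => i /andP[/mm_tail].
  by case: (mm i) => [|[|]].
rewrite big_geq ?add0n; last exact: ltnW.
rewrite [LHS](big_cat_nat _ (n := n)) //=; last exact: ltnW.
rewrite [X in _ + X]big_nat [X in _ + X]big1 ?addn0 // => i /andP[gei _].
by rewrite nth_default // size_tuple.
Qed.

Lemma ones_index b : b < ones -> mm (8 + b) = 1 /\ 8 + b < n.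
Proof.
move=> ltb; have [m0|mn0] := posnP (mm (8 + b)).
  suff : ones <= b by rewrite leqNgt ltb.
  have [le|ge] := leqP n (8 + b).
    apply: leq_trans (_ : \sum_(8 <= i < n) 1 <= _); last by rewrite sum_nat_const_nat muln1 leq_subLR.
    by rewrite /ones big_nat [leqRHS]big_nat; apply: leq_sum => i /andP[/mm_tail].
  rewrite /ones (big_cat_nat _ (n := 8 + b)) ?leq_addr //=; last exact: ltnW.
  rewrite [X in _ + X]big_nat [X in _ + X]big1 ?addn0.
    apply: leq_trans (_ : \sum_(8 <= i < 8 + b) 1 <= _); last by rewrite sum_nat_const_nat muln1 addKn.
    by rewrite big_nat [leqRHS]big_nat; apply: leq_sum => i /andP[/mm_tail].
  by move=> i /andP[le _]; apply/eqP; rewrite -leqn0 (leq_trans (mm_noninc le)) // m0.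
split; last by rewrite ltnNge; apply: contraTN mn0 => le; rewrite nth_default // size_tuple.
by apply/eqP; rewrite eqn_leq mn0 andbT mm_tail // leq_addr.
Qed.

Lemma index_ones i : 8 <= i -> i < n -> mm i != 0 -> i - 8 < ones.
Proof.
move=> ge8 lti mi; rewrite /ones (big_cat_nat _ (n := i.+1)) //=; last exact: leqW.
apply: leq_trans (leq_addr _ _); apply: leq_trans (_ : \sum_(8 <= j < i.+1) 1 <= _).
  by rewrite sum_nat_const_nat muln1 subSn.
rewrite big_nat [leqRHS]big_nat; apply: leq_sum => j /andP[_ lej].
by rewrite lt0n; apply: contraNneq mi => mj; rewrite -leqn0 (leq_trans (mm_noninc (lej : j <= i))) // mj.
Qed.

(** Without points of multiplicity one beyond the first eight, the Cremona condition
    leaves room for a single multiple point only. *)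
Lemma pencil_case : 0 < d -> ones = 0 -> mm 0 = d /\ mm 1 = 0.
Proof.
move=> d0 o0; have := selfint_split; rewrite o0 add0n sum8 => E.
have h i : mm i.+1 <= mm i by apply: mm_noninc.
(* The cross terms in the square of mm 0 + mm 1 + mm 2 are at least six times the
   square of mm 2, whereas only five more squares follow, each at most that one. *)
have c0 : mm 2 = 0.
  apply/eqP; rewrite -leqn0 leqNgt; apply/negP => c0.
  have tl i : 2 <= i -> mm i ^ 2 <= mm 2 ^ 2 by move=> le; rewrite leq_sqr mm_noninc.
  have := tl 3 isT; have := tl 4 isT; have := tl 5 isT; have := tl 6 isT; have := tl 7 isT.
  have := h 0; have := h 1; move: cremona E c0.
  have := leq_sqr (mm 0 + mm 1 + mm 2) d; rewrite cremona => sq.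
  move: sq; move: (mm 3 ^ 2) (mm 4 ^ 2) (mm 5 ^ 2) (mm 6 ^ 2) (mm 7 ^ 2) => s3 s4 s5 s6 s7.
  rewrite -!mulnn; move: (mm 0) (mm 1) (mm 2) (d * d) => a b c D sq _ E c0 cb ba t7 t6 t5 t4 t3.
  have ab : c * c <= a * b by rewrite leq_mul // (leq_trans cb).
  have ac : c * c <= a * c by rewrite leq_mul // (leq_trans cb).
  have bc : c * c <= b * c by rewrite leq_mul.
  have cc : 0 < c * c by rewrite muln_gt0 c0.
  have EE : (a + b + c) * (a + b + c) = a * a + b * b + c * c + 2 * (a * b) + 2 * (a * c) + 2 * (b * c) by ring.
  move: sq E ab ac bc cc t7 t6 t5 t4 t3; rewrite EE.
  move: (a * a) (b * b) (c * c) (a * b) (a * c) (b * c) => x1 x2 x3 x4 x5 x6; clear; lia.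
have z i : 2 <= i -> mm i = 0 by move=> le; apply/eqP; rewrite -leqn0 (leq_trans (mm_noninc le)) // c0.
move: E; rewrite (z 2) // (z 3) // (z 4) // (z 5) // (z 6) // (z 7) // exp0n // !addn0; move: cremona (h 0); rewrite c0 addn0 => le ba E.
have b0 : mm 1 = 0.
  apply/eqP; rewrite -leqn0 leqNgt; apply/negP => b0.
  have := leq_sqr (mm 0 + mm 1) d; rewrite le -E -!mulnn.
  have : 0 < mm 0 * mm 1 by rewrite muln_gt0 b0 (leq_trans b0).
  rewrite mulnDl !mulnDr [mm 1 * mm 0]mulnC; move: (mm 0 * mm 0) (mm 0 * mm 1) (mm 1 * mm 1) => x y w; lia.
by split=> //; apply/eqP; rewrite -eqn_sqr -E b0 addn0.
Qed.

End Numerics.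

Local Open Scope nat_scope.

Lemma filter_leading_zeros (s : seq nat) :
  (forall i, nth 0 s i.+1 = 0) -> nth 0 s 0 != 0 -> [seq x <- s | x != 0] = [:: nth 0 s 0].
Proof.
case: s => [|x s] //= H x0; rewrite x0; congr (_ :: _).
apply/eqP; rewrite -size_eq0 size_filter -leqn0 leqNgt -has_count; apply/hasPn => y /(nthP 0)[i _ <-].
by rewrite negbK H.
Qed.

Lemma filter_leading_ones k (s : seq nat) :
  (forall i, i < k -> nth 0 s i = 1) -> (forall i, k <= i -> nth 0 s i = 0) ->
  [seq x <- s | x != 0] = nseq k 1.
Proof.
elim: k s => [|k IH] s H1 H0.
  apply/eqP; rewrite -size_eq0 size_filter -leqn0 leqNgt -has_count; apply/hasPn => y /(nthP 0)[i _ <-].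
  by rewrite negbK H0.
case: s H1 H0 => [|x s] H1 H0; first by have := H1 0 isT.
have /= -> := H1 0 isT; congr (_ :: _); apply: IH => i lei; first exact: (H1 i.+1).
exact: (H0 i.+1).
Qed.

Lemma nth_scale_mult c n (m : n.-tuple nat) i : nth 0 (scale_mult c m) i = c * nth 0 m i.
Proof.
have [lti|gei] := ltnP i n; last by rewrite !nth_default ?size_tuple ?muln0.
by rewrite -(tnth_nth 0 _ (Ordinal lti)) tnth_mktuple (tnth_nth 0).
Qed.

Section MainCases.
Variables (n d : nat) (m : n.-tuple nat).
Hypothesis m_noninc : forall i j : 'I_n, i <= j -> tnth m j <= tnth m i.
Hypothesis cremona : nth 0 m 0 + nth 0 m 1 + nth 0 m 2 <= d.
Hypothesis selfint0 : d ^ 2 = \sum_(i < n) tnth m i ^ 2.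
Hypothesis N_le8 : #|[set j : 'I_n | 2 <= tnth m j]| <= 8.

Let noninc i j : i <= j -> nth 0 m j <= nth 0 m i.
Proof. exact: mm_noninc. Qed.

Lemma multiple_of_line_system : 0 < d -> ones m = 0 -> is_multiple_of d m 1 [tuple of [:: 1]].
Proof.
move=> d_gt0 o0; have [e0 e1] := pencil_case m_noninc cremona selfint0 N_le8 d_gt0 o0.
exists d; split=> //; split; first by rewrite muln1.
rewrite !filter_leading_zeros ?nth_scale_mult ?e0 ?muln1 -?lt0n // => i.
  by rewrite nth_scale_mult [nth 0 _ _]nth_default ?muln0.
by apply/eqP; rewrite -leqn0 (leq_trans (noninc (ltn0Sn i))) // e1.
Qed.

Lemma ninth_mult : 0 < ones m -> nth 0 m 8 = 1 /\ 8 < n.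
Proof. by move/(ones_index m_noninc N_le8). Qed.

Lemma first_nine_pos i : 0 < ones m -> i <= 8 -> 0 < nth 0 m i.
Proof. by move=> /ninth_mult[m8 _] le; rewrite (leq_trans _ (noninc le)) // m8. Qed.

Lemma multiple_of_cubic_system : 0 < ones m -> d <= 3 ->
  is_multiple_of d m 3 [tuple of nseq 9 1].
Proof.
move=> o_gt0 d3; have pos i := @first_nine_pos i o_gt0.
have dE : d = 3 by have := pos 0 isT; have := pos 1 isT; have := pos 2 isT; lia.
have m0 : nth 0 m 0 = 1 by have := pos 0 isT; have := pos 1 isT; have := pos 2 isT; lia.
have m1 i : i <= 8 -> nth 0 m i = 1.
  by move=> le; apply/eqP; rewrite eqn_leq pos // andbT (leq_trans (noninc (leq0n i))) // m0.
have o1 : ones m = 1.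
  have := selfint_split m_noninc selfint0 N_le8; rewrite sum8 !m1 // dE => /eqP.
  by rewrite -[3 ^ 2]/(1 + 8) eqn_add2r => /eqP.
exists 1; split=> //; split; first by rewrite mul1n.
transitivity (nseq 9 1); last apply/esym; apply: filter_leading_ones => i.
- by move=> lti; apply: m1.
- move=> gei; have [lt|ge] := ltnP i n; last by rewrite nth_default // size_tuple.
  apply/eqP/negPn/negP => mi.
  by have := index_ones m_noninc (ltnW gei) lt mi; rewrite o1; lia.
- by move=> lti; rewrite nth_scale_mult mul1n nth_nseq lti.
- by move=> gei; rewrite nth_scale_mult nth_default.
Qed.

Local Open Scope ring_scope.

(** The points of multiplicity one move in the direction of y; those of multiplicity zero
    may sit anywhere. *)
Lemma system_empty_of_ones (R : realType) k : (0 < ones m)%N -> (3 < d)%N -> (0 < k)%N ->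
  system_empty R (k * d) (scale_mult k m).
Proof.
move=> o_gt0 d_gt3 k_gt0; have [_ n8] := ninth_mult o_gt0.
have ones_at b : (b < ones m)%N -> nth 0%N m (8 + b)%N = 1%N /\ (8 + b < n)%N.
  exact: (ones_index m_noninc N_le8).
set C := (R[i] : Num.ClosedField.type).
have m7 := first_nine_pos o_gt0 (isT : 7 <= 8)%N.
have noninc8 i j : (i <= j)%N -> (j < 8)%N -> (nth 0%N m j <= nth 0%N m i)%N by move=> le _; apply: noninc.
have [pt [v rigid]] := @special_position C d k (nth 0%N m) noninc8 m7 cremona d_gt3 (ones m)
  k_gt0 (selfint_split m_noninc selfint0 N_le8).
pose base (i : nat) : C * C := if (i < 8)%N then base_q C i else pt (i - 8)%N.
pose P : 'M[C]_(n, 3) := \matrix_(i, j) nth 1 [:: (base i).1; (base i).2] j.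
pose V : 'M[C]_(n, 3) := \matrix_(i, j) (if (j == i1) && (8 <= i)%N then v (i - 8)%N else 0).
apply: (@system_empty_by_deformation R _ n _ P V) => [i|i|F0 F1 hF0 hF1 H0 H1].
- by rewrite mxE.
- by rewrite mxE.
have lt_n i : (i < 8)%N -> (i < n)%N by move=> lti; apply: ltn_trans n8.
have mult_at i (lti : (i < n)%N) : tnth (scale_mult k m) (Ordinal lti) = (k * nth 0%N m i)%N.
  by rewrite tnth_mktuple (tnth_nth 0%N).
have mult_pt b (ltb : (b < ones m)%N) : tnth (scale_mult k m) (Ordinal (ones_at b ltb).2) = k.
  by rewrite mult_at (ones_at b ltb).1 muln1.
have base_pt b : base (8 + b)%N = pt b by rewrite /base ltnNge leq_addr addKn.
apply: (dehom_eq0 hF0); apply: (rigid (dehom F0) (dehom F1)).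
- split; [exact: tdeg_dehom|exact: tdeg_dehom| |] => i lti.
  + have := @van_dehom C (k * nth 0%N m i)%N F0 (row (Ordinal (lt_n i lti)) P).
    rewrite !mxE -/(base i) /= /base lti -surjective_pairing; apply=> // a lta.
    have := H0 (Ordinal (lt_n i lti)) a; rewrite mult_at => /(_ lta) <-.
    by apply: meval_eq => j; rewrite mxE.
  + have := @van_dehom C (k * nth 0%N m i)%N F1 (row (Ordinal (lt_n i lti)) P).
    rewrite !mxE -/(base i) /= /base lti -surjective_pairing; apply=> // a lta.
    have := H1 (Ordinal (lt_n i lti)) a; rewrite mult_at => /(_ lta) <-.
    rewrite [X in _ = _ + X]big1 ?addr0.
      by apply: meval_eq => j; rewrite mxE.
    by move=> j _; rewrite mxE leqNgt /= lti andbF mul0r.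
- move=> b ltb; have := @van_dehom C k F0 (row (Ordinal (ones_at b ltb).2) P).
  rewrite !mxE /= base_pt -surjective_pairing; apply=> // a lta.
  have := H0 (Ordinal (ones_at b ltb).2) a; rewrite mult_pt => /(_ lta) <-.
  by apply: meval_eq => j; rewrite mxE.
- move=> b ltb.
  have := @van_dehom C k (F1 + v b *: mderiv i1 F0) (row (Ordinal (ones_at b ltb).2) P).
  rewrite !mxE /= base_pt -surjective_pairing dehomD dehomZ -dehom_deriv; apply=> // a lta.
  have := H1 (Ordinal (ones_at b ltb).2) a; rewrite mult_pt => /(_ lta) <-.
  rewrite mderivmD mevalD.
  rewrite mderivmZ mevalZ sum_ord3 !mxE /= addKn !mul0r add0r addr0.
  by congr (_ + _ * _); apply: meval_eq => j; rewrite mxE.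
Qed.

End MainCases.

Theorem theorem1 (R : realType) (n d : nat) (m : n.-tuple nat)
  (n_ge3 : 3 <= n) (d_gt0 : 0 < d)
  (d_ge_m1 : nth 0 m 0 <= d)
  (m_noninc : forall i j : 'I_n, i <= j -> tnth m j <= tnth m i)
  (cremona : nth 0 m 0 + nth 0 m 1 + nth 0 m 2 <= d)
  (selfint0 : d ^ 2 = \sum_(i < n) tnth m i ^ 2)
  (N_le8 : #|[set j : 'I_n | 2 <= tnth m j]| <= 8)
  (not_a : ~ is_multiple_of d m 1 [tuple of [:: 1]])
  (not_b : ~ is_multiple_of d m 3 [tuple of nseq 9 1]) :
  forall k : nat, 1 <= k -> system_empty R (k * d) (scale_mult k m).
Proof.
move=> k k_gt0.
have [o0|o_gt0] := posnP (ones m).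
  by case: not_a; apply: multiple_of_line_system.
have [d_le3|d_gt3] := leqP d 3; first by case: not_b; apply: multiple_of_cubic_system.
exact: system_empty_of_ones.
Qed.
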